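(* Let $Y=v_2(\mathbf{P}^3)\subset\mathbf{P}^9$ be the $2$-Veronese embedding of $\mathbf{P}^3$, let $S$ be a smooth quadric section of $Y$ (the intersection of $Y$ with a quadric hypersurface of $\mathbf{P}^9$), and let $C\subset\mathbf{P}^8$ be a smooth hyperplane section of $S$. Then: (i) $h^0(N_{Y/\mathbf{P}^9}(-1))=10$ and $h^0(N_{Y/\mathbf{P}^9}(-k))=0$ for all $k\geq2$; (ii) $h^0(N_{S/\mathbf{P}^9}(-1))=10+10$, $h^0(N_{S/\mathbf{P}^9}(-2))=1$, and $h^0(N_{S/\mathbf{P}^9}(-k))=0$ for all $k\geq3$; (iii) $h^0(N_{C/\mathbf{P}^8}(-1))=10+9$, $h^0(N_{C/\mathbf{P}^8}(-2))=1$, and $h^0(N_{C/\mathbf{P}^8}(-k))=0$ for all $k\geq3$.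
   Context: Work over $\mathbf{C}$. $N_{X/\mathbf{P}^N}$ denotes the normal bundle of $X$ in $\mathbf{P}^N$, and $N_{X/\mathbf{P}^N}(-k)=N_{X/\mathbf{P}^N}\otimes\mathcal{O}_{\mathbf{P}^N}(-k)$ (so for $Y=v_2(\mathbf{P}^3)$ the twist by $-k$ is the tensor product with $\mathcal{O}_{\mathbf{P}^3}(-2k)$). *)

(* Defs.v *)
From HB Require Import structures.
From mathcomp Require Import all_boot all_order all_algebra.
From mathcomp Require Import reals.
From mathcomp Require Import complex mpoly.
Set Implicit Arguments.
Unset Strict Implicit.
Unset Printing Implicit Defensive.
Import GRing.Theory.
Local Open Scope ring_scope.

(* A closed subscheme X of P^N is presented by a homogeneous ideal I of the
   coordinate ring K[x_0, ..., x_N] cutting it out, and a point of P^N by any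
   nonzero vector on the corresponding line of V = K^(N+1). *)

Section Subschemes.
Variable K : fieldType.

Definition ideal_pred (N : nat) := {mpoly K[N.+1]} -> Prop.

(* x is a nonzero vector whose class [x] lies on X. *)
Definition on_cone (N : nat) (I : ideal_pred N) (x : 'rV[K]_N.+1) : Prop :=
  x != 0 /\ forall F, I F -> F.@[x ord0] = 0.

(* The Zariski tangent space at x of the affine cone over X, a subspace of V.
   It contains the line K x, and its quotient by K x is the fibre at [x] of
   T_X(-1) inside the fibre V / K x of T_{P^N}(-1) (Euler sequence). *)
Definition cone_tangent (N : nat) (I : ideal_pred N) (x v : 'rV[K]_N.+1) :
    Prop :=
  forall F, I F -> \sum_(j < N.+1) (F^`M(j)).@[x ord0] * v ord0 j = 0.

(* X is smooth of pure dimension d (Jacobian criterion): near each of its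
   points, X is cut out scheme-theoretically in P^N by N - d forms whose
   differentials are linearly independent at that point.  The neighbourhood is
   {g <> 0}: over it the F_i generate the whole ideal of X. *)
Definition smooth_of_dim (N : nat) (I : ideal_pred N) (d : nat) : Prop :=
  (d <= N)%N /\
  forall x, on_cone I x ->
  exists F : 'I_(N - d) -> {mpoly K[N.+1]},
    [/\ forall i, I (F i) /\ exists e : nat, F i \is e.-homog,
        row_free (\matrix_(i < N - d, j < N.+1) ((F i)^`M(j)).@[x ord0])
      & exists g : {mpoly K[N.+1]},
          [/\ exists e : nat, g \is e.-homog,
              g.@[x ord0] != 0
            & forall G, I G -> exists A : 'I_(N - d) -> {mpoly K[N.+1]},
                g * G = \sum_(i < N - d) A i * F i]].

(* Let X be smooth (hence reduced) and N_X = T_{P^N}|_X / T_X.  By the Euler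
   sequence, the fibre of N_X(-1) at [x] is V / T_x with T_x the tangent space
   of the cone, and a section of N_X(-k) is a function x |-> s(x) in V / T_x on
   the punctured cone which is regular and homogeneous of degree 1 - k in x.
   As N_X is a quotient sheaf, regularity means that s lifts locally to a
   section of T_{P^N}(-k), i.e. to a vector f / g of fractions of forms with
   deg f - deg g = 1 - k.
   The class s(x) is given below by a representative in V; values of s outside
   the punctured cone are irrelevant. *)
Definition normal_section (N : nat) (I : ideal_pred N) (k : nat)
    (s : 'rV[K]_N.+1 -> 'rV[K]_N.+1) : Prop :=
  forall x, on_cone I x ->
  exists (m e : nat) (f : 'I_N.+1 -> {mpoly K[N.+1]}) (g : {mpoly K[N.+1]}),
    [/\ forall j, f j \is m.-homog,
        g \is e.-homog,
        (m + k = e + 1)%N,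
        g.@[x ord0] != 0
      & forall y, on_cone I y -> g.@[y ord0] != 0 ->
          cone_tangent I y (s y - \row_j ((f j).@[y ord0] / g.@[y ord0]))].

(* Equality of sections of N_X(-k): s(x) = t(x) in V / T_x for all x. *)
Definition normal_eq (N : nat) (I : ideal_pred N)
    (s t : 'rV[K]_N.+1 -> 'rV[K]_N.+1) : Prop :=
  forall x, on_cone I x -> cone_tangent I x (s x - t x).

(* h^0(N_X(-k)) = n: the space of sections of N_X(-k), taken modulo
   normal_eq, has a basis with n elements. *)
Definition h0_normal (N : nat) (I : ideal_pred N) (k n : nat) : Prop :=
  exists s : 'I_n -> ('rV[K]_N.+1 -> 'rV[K]_N.+1),
    [/\ forall i, normal_section I k (s i),
        forall c : 'I_n -> K,
          normal_eq I (fun x => \sum_(i < n) c i *: s i x) (fun=> 0) ->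
          forall i, c i = 0
      & forall t, normal_section I k t ->
          exists c : 'I_n -> K,
            normal_eq I t (fun x => \sum_(i < n) c i *: s i x)].

(* The scheme-theoretic intersection of X with the hypersurface q = 0. *)
Definition hypersurface_section (N : nat) (I : ideal_pred N)
    (q : {mpoly K[N.+1]}) : ideal_pred N :=
  fun F => exists G A, I G /\ F = G + A * q.

(* A full-rank matrix A embeds P^M linearly in P^N by y |-> y *m A; this is the
   scheme-theoretic intersection of X with that linear subspace, as a subscheme
   of P^M.  Hyperplanes of P^N are the case M = N - 1. *)
Definition linear_section (N M : nat) (I : ideal_pred N)
    (A : 'M[K]_(M.+1, N.+1)) : ideal_pred M :=
  fun F => exists2 G, I G &
    F = G \mPo [tuple \sum_(i < M.+1) A i j *: 'X_i | j < N.+1].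

(* The ten monomials x_i x_j with i <= j, in lexicographic order. *)
Definition veronese2_index : seq (nat * nat) :=
  [seq (i, j) | i <- iota 0 4, j <- iota i (4 - i)].

Definition veronese2 (x : 'rV[K]_4) : 'rV[K]_10 :=
  \row_(l < 10) let p := nth (0, 0)%N veronese2_index l in
    x ord0 (inord p.1) * x ord0 (inord p.2).

(* The homogeneous ideal of v_2(P^3). *)
Definition veronese2_ideal : ideal_pred 9 :=
  fun F => forall x : 'rV[K]_4, F.@[veronese2 x ord0] = 0.

End Subschemes.
Arguments veronese2_ideal : clear implicits.

(* Main.v *)
Require Import Defs.
From HB Require Import structures.
From mathcomp Require Import all_boot all_order all_algebra.
From mathcomp Require Import boolp classical_sets reals.
From mathcomp Require Import complex mpoly ring lra zify.
Set Implicit Arguments.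
Unset Strict Implicit.
Unset Printing Implicit Defensive.
Import GRing.Theory Num.Theory Order.TTheory.
Local Open Scope ring_scope.

(* Write W = C^4, so that the ambient space of Y is the projective space of Sym^2 W and the cone
   over Y consists of the squares z^T z.  A section of N_X(-k) pulls back to a function of degree
   2 - 2k on the common zeros of F = q(z^T z) (and of the quadric Q of the hyperplane) in W, with
   values in Sym^2 W modulo the tangent matrices z^T w + w^T z.  Gluing its local lifts along two
   parameters u, v which form a regular sequence on the zero locus, the obstruction lies in a
   local cohomology group where it is killed by all quadrics, and the socle in the relevant
   degrees vanishes; hence modulo tangent matrices the section is a constant m of Sym^2 W, equal
   to 0 for k >= 2.  What remains is the function dq(s - m), homogeneous of degree 4 - 2k, and the
   same gluing shows that it is the restriction of a form H.  Thus sections of N_X(-k) are the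
   pairs (m, H), with H absent for Y, a quadric on W modulo Q for k = 1, and a constant for k = 2.

   That F (respectively F, Q) generate the ideal of their zero locus follows from smoothness:
   the local ring at each point is a domain because its quotient by suitable linear parameters
   is one (Krull's intersection theorem).  The Nullstellensatz is elementary over an
   uncountable field. *)

(** * The Nullstellensatz over an uncountable field *)

(** The obstacle is the curve. On [W] the normal sheaf is a quotient of Sym^2 W by the image of w
    |-> z^T w + w^T z, so the obstruction to a global lift lies in W tensor H^1(O(1 - 2k)). This is
    zero on P^3 and on the surface, but not on the curve, where O(1 - 2k) is negative. No vanishing
    theorem can serve there; instead the map from W tensor H^1(O(1 - 2k)) to Sym^2 W tensor H^1(O(2
    - 2k)) is shown to be injective. Multiplication by all linear forms has no common kernel on
    H^1(O(d)) for d <= 0: a complete intersection of degrees 2 and 4 in P^3 has canonical sheaf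
    O(2), so by duality the socle sits in degree 2. The bound k >= 1 keeps both 1 - 2k and 2 - 2k at
    most 0. No cohomology group is formed: the class b/(uv)^n vanishes when b lies in I + (u^n,
    v^n), and every argument is a congruence of polynomials. Conversely, sections with a prescribed
    pair (m, H) are built from the tangent fields z_l (z^T e_i + e_i^T z). *)

Section Ideals.
Variable P : comNzRingType.
Implicit Types (I J : P -> Prop) (f g y : P).

Definition is_ideal I :=
  [/\ I 0, forall f g, I f -> I g -> I (f + g) & forall a f, I f -> I (a * f)].

(** Quotient rings are never formed: an equation modulo I is a membership in I, so I + (y) and the
    nonzerodivisors modulo I are expressed on P itself. *)
Definition add_gen I y : P -> Prop := fun f => exists a, I (f - a * y).

Definition nzd I y := forall f, I (y * f) -> I f.

Lemma ideal0 I : is_ideal I -> I 0. Proof. by case. Qed.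

Lemma idealD I f g : is_ideal I -> I f -> I g -> I (f + g).
Proof. by case=> _ h _; apply: h. Qed.

Lemma idealMl I a f : is_ideal I -> I f -> I (a * f).
Proof. by case=> _ _ h; apply: h. Qed.

Lemma idealMr I a f : is_ideal I -> I f -> I (f * a).
Proof. by rewrite mulrC; apply: idealMl. Qed.

Lemma idealN I f : is_ideal I -> I f -> I (- f).
Proof. by move=> hI If; rewrite -mulN1r; apply: idealMl. Qed.

Lemma idealB I f g : is_ideal I -> I f -> I g -> I (f - g).
Proof. by move=> hI If Ig; apply: idealD => //; apply: idealN. Qed.

Lemma ideal_sum I (T : Type) (r : seq T) (p : pred T) F :
  is_ideal I -> (forall i, p i -> I (F i)) -> I (\sum_(i <- r | p i) F i).
Proof.
move=> hI h; elim/big_rec: _ => [|i x pi Ix]; first exact: ideal0.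
by apply: idealD => //; apply: h.
Qed.

Lemma ideal_eq I f g : is_ideal I -> I g -> I (f - g) -> I f.
Proof. by move=> hI Ig Ifg; rewrite -(subrK g f); apply: idealD. Qed.

Lemma add_gen_ideal I y : is_ideal I -> is_ideal (add_gen I y).
Proof.
move=> hI; split.
- by exists 0; rewrite mul0r subr0; apply: ideal0.
- move=> f g [a Ia] [b Ib]; exists (a + b).
  have -> : f + g - (a + b) * y = (f - a * y) + (g - b * y) by ring.
  by apply: idealD.
- move=> c f [a Ia]; exists (c * a).
  by rewrite -mulrA -mulrBr; apply: idealMl.
Qed.

Lemma add_genl I y f : I f -> add_gen I y f.
Proof. by move=> If; exists 0; rewrite mul0r subr0. Qed.

Lemma add_genr I y a : is_ideal I -> add_gen I y (a * y).
Proof. by move=> hI; exists a; rewrite subrr; apply: ideal0. Qed.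

Lemma add_gen_sub I J y :
  (forall f, I f -> J f) -> forall f, add_gen I y f -> add_gen J y f.
Proof. by move=> h f [a Ia]; exists a; apply: h. Qed.

Lemma add_gen_min I J y : is_ideal J -> (forall f, I f -> J f) -> J y ->
  forall f, add_gen I y f -> J f.
Proof.
by move=> hJ h Jy f [a Ia]; apply: (@ideal_eq J _ (a * y)) => //;
  [apply: idealMl | apply: h].
Qed.

Lemma add_genAC I y z f : add_gen (add_gen I y) z f -> add_gen (add_gen I z) y f.
Proof. by move=> [a [b h]]; exists b, a; rewrite addrAC. Qed.

Lemma nzd_iff I J y : (forall f, I f <-> J f) -> nzd I y -> nzd J y.
Proof. by move=> h nI f /h /nI /h. Qed.

Lemma nzdM I y z : nzd I y -> nzd I z -> nzd I (y * z).
Proof. by move=> hy hz f; rewrite -mulrA => /hy /hz. Qed.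

Lemma nzdX I y n : nzd I y -> nzd I (y ^+ n).
Proof.
move=> hy; elim: n => [|n IHn]; first by move=> f; rewrite expr0 mul1r.
by rewrite exprS; apply: nzdM.
Qed.

(** Induction on n: write f = b y modulo I, cancel one y, and apply the induction hypothesis to
    b. *)
Lemma nzd_add_genX I y z n : is_ideal I -> nzd I y -> nzd (add_gen I y) z ->
  nzd (add_gen I (y ^+ n)) z.
Proof.
move=> hI hy hz; elim: n => [|n IHn] f [a Ia].
  by exists f; rewrite mulr1 subrr; apply: ideal0.
have [|b Ib] := hz f.
  by exists (a * y ^+ n); rewrite -mulrA -exprSr.
have [c Ic] : add_gen I (y ^+ n) b.
  apply: IHn; exists a; apply: hy.
  have -> : y * (z * b - a * y ^+ n) =
    (z * f - a * y ^+ n.+1) - z * (f - b * y) by rewrite exprS; ring.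
  by apply: idealB => //; apply: idealMl.
exists c.
have -> : f - c * y ^+ n.+1 = (f - b * y) + y * (b - c * y ^+ n).
  by rewrite exprS; ring.
by apply: idealD => //; apply: idealMl.
Qed.

(* A power of the regular element lies in I + (y), so that y becomes a nonzerodivisor as well. *)
Lemma nzd_power I l y N : is_ideal I -> nzd I l -> add_gen I y (l ^+ N) ->
  nzd I y.
Proof.
move=> hI hl [a Ia] f If; apply: (nzdX (n := N) hl).
have -> : l ^+ N * f = (l ^+ N - a * y) * f + a * (y * f) by ring.
by apply: idealD => //; [apply: idealMr | apply: idealMl].
Qed.

End Ideals.

Lemma meval_sum (K : comNzRingType) n (v : 'I_n -> K) (T : Type) (r : seq T) (p : pred T)
  (F : T -> {mpoly K[n]}) :
  (\sum_(i <- r | p i) F i).@[v] = \sum_(i <- r | p i) (F i).@[v].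
Proof. exact: (big_morph _ (mevalD v) (meval0 v)). Qed.

Lemma mderiv_sum (K : comNzRingType) n j (T : Type) (r : seq T) (p : pred T)
  (F : T -> {mpoly K[n]}) :
  (\sum_(i <- r | p i) F i)^`M(j) = \sum_(i <- r | p i) (F i)^`M(j).
Proof. exact: (big_morph _ (mderivD j) (mderiv0 _ j)). Qed.

(** A pigeonhole form: some fibre is infinite. The target consists of pairs because an exponent and
    a degree have to be bounded together. *)
Definition uncountable (K : eqType) := forall h : K -> nat * nat,
  exists k, forall m, exists s : seq K,
    [/\ size s = m, uniq s & all (fun a => h a == k) s].

Section Nullstellensatz.
Variables (K : closedFieldType) (n : nat).
Hypothesis unc : uncountable K.
Local Notation P := {mpoly K[n]}.
Implicit Types (J : P -> Prop) (f g u : P).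

Lemma bounded_dependence (d m : nat) (u : 'I_m -> P) :
  (forall i, (msize (u i) <= d)%N) -> (#|{: 'X_{1..n < d}}| < m)%N ->
  exists2 c : 'I_m -> K, (exists i, c i != 0) & \sum_i c i *: u i = 0.
Proof.
move=> hu hm; pose M := \matrix_(i < m, j < #|{: 'X_{1..n < d}}|)
  (u i)@_(enum_val j : 'X_{1..n < d}).
have : kermx M != 0.
  rewrite -mxrank_eq0 mxrank_ker subn_eq0 -ltnNge.
  by apply: leq_ltn_trans hm; apply: rank_leq_col.
case/rowV0Pn => c /sub_kermxP cM c0.
exists (fun i => c ord0 i).
  by have /rV0Pn[i ci] := c0; exists i.
apply/mpolyP => k; rewrite linear_sum mcoeff0 /=.
under eq_bigr do rewrite mcoeffZ.
case: (ltnP (mdeg k) d) => kd; last first.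
  rewrite big1 // => i _; rewrite memN_msupp_eq0 ?mulr0 //.
  by apply: msize_mdeg_ge; apply: leq_trans kd.
have /matrixP /(_ ord0 (enum_rank (BMultinom kd))) := cM.
rewrite !mxE => e; rewrite -[RHS]e; apply: eq_bigr => i _.
by rewrite mxE enum_rankK.
Qed.

(** J does not become the unit ideal once f is inverted; carrying f along builds the Rabinowitsch
    trick into the induction. *)
Definition avoids J f := forall N : nat, ~ J (f ^+ N).

(* If every p - a is invertible modulo J up to a power of f, then by uncountability
   infinitely many of the inverses u_a live in one finite-dimensional space, and a
   linear relation between them yields a nonzero univariate q with f^N q(p) in J. *)
Lemma avoids_step J f (p : P) : is_ideal J -> avoids J f ->
  exists a : K, avoids (add_gen J (p - a%:MP)) f.
Proof.
move=> hJ hf; apply: contrapT => /forallNP H.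
have H1 a : exists Nu : nat * P, J (f ^+ Nu.1 - Nu.2 * (p - a%:MP)).
  by have /existsNP [N /contrapT [u Hu]] := H a; exists (N, u).
have [Nu HNu] := choice H1.
have [[N d] hk] := unc (fun a => ((Nu a).1, msize (Nu a).2)).
have [s [ss us /allP hs]] := hk #|{: 'X_{1..n < d}}|.+1.
pose u (i : 'I_(size s)) := (Nu s`_i).2.
have [||c [i0 ci0] cu] := @bounded_dependence d (size s) u.
- by move=> i; have /hs := mem_nth 0 (ltn_ord i); move=> /eqP[_ <-].
- by rewrite ss.
(* Lagrange numerators weighted by the relation between the inverses: at [s_i0] only the term with
   coefficient [c i0] survives. *)
pose q : {poly K} := \sum_i c i *: \prod_(j < size s | j != i) ('X - (s`_j)%:P).
have q0 : q != 0.
  apply/eqP => /(congr1 (fun q : {poly K} => q.[s`_i0])) /eqP.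
  rewrite horner_sum horner0 (bigD1 i0) //= [X in _ + X]big1 ?addr0.
    rewrite hornerZ mulf_eq0 (negPf ci0) /= horner_prod => /prodf_eq0[j ji].
    rewrite hornerXsubC subr_eq0 nth_uniq // => /eqP/val_inj e.
    by rewrite e eqxx in ji.
  move=> i ii; rewrite hornerZ horner_prod (bigD1 i0) 1?eq_sym //=.
  by rewrite hornerXsubC subrr mul0r mulr0.
pose ev (r : {poly K}) : P := (map_poly (@mpolyC n K) r).[p].
have evM r1 r2 : ev (r1 * r2) = ev r1 * ev r2 by rewrite /ev rmorphM hornerM.
have evX a : ev ('X - a%:P) = p - a%:MP.
  by rewrite /ev rmorphB /= map_polyX map_polyC /= hornerXsubC.
(* Modulo J, the i-th term allows f^N to be replaced by u_i (p - s_i); what results is the relation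
   sum c_i u_i = 0 times the full product. *)
have evq : J (f ^+ N * ev q).
  have -> : f ^+ N * ev q = \sum_(i < size s)
      (c i)%:MP * ev (\prod_(j < size s | j != i) ('X - (s`_j)%:P)) *
       (f ^+ N - u i * (p - (s`_i)%:MP)).
    under [RHS]eq_bigr do rewrite mulrBr.
    rewrite sumrB [X in _ = _ - X](_ : _ = 0) ?subr0.
      rewrite -mulr_suml mulrC; congr (_ * _).
      rewrite /ev /q rmorph_sum horner_sum; apply: eq_bigr => i _ /=.
      by rewrite map_polyZ hornerZ.
    transitivity ((\sum_i c i *: u i) * ev (\prod_(j < size s) ('X - (s`_j)%:P))).
      rewrite mulr_suml; apply: eq_bigr => i _.
      by rewrite [in RHS](bigD1 i) //= evM evX -mul_mpolyC; ring.
    by rewrite cu mul0r.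
  apply: ideal_sum => // i _; apply: idealMl => //.
  have /hs := mem_nth 0 (ltn_ord i); move=> /eqP[<- _].
  exact: HNu.
(* q splits, and each root z is removed by the relation between a power of f and u_z (p - z), at the
   price of a higher power of f. In the end a power of f lies in J. *)
have [r qr] := closed_field_poly_normal q.
have evr : J (f ^+ N * ev (\prod_(z <- r) ('X - z%:P))).
  have l0 : lead_coef q != 0 by rewrite lead_coef_eq0.
  move: evq; rewrite {1}qr -mul_polyC evM => /(idealMl (lead_coef q)^-1%:MP hJ).
  by rewrite /ev map_polyC hornerC /= mulrCA [X in _ * X]mulrA -mpolyCM mulVf // mul1r.
elim: r N {qr evq hk hs} evr => [|z r IHr] N.
  by rewrite big_nil /ev rmorph1 hornerC mulr1 => /hf.
rewrite big_cons evM evX => h; apply: (IHr (N + (Nu z).1)%N).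
set E := ev _ in h *.
have -> : f ^+ (N + (Nu z).1) * E =
  f ^+ N * E * (f ^+ (Nu z).1 - (Nu z).2 * (p - z%:MP)) +
  (Nu z).2 * (f ^+ N * ((p - z%:MP) * E)) by rewrite exprD; ring.
by apply: idealD => //; apply: idealMl.
Qed.

(** Congruence of f with its image is stable under sums and products. Applied to evaluation at a
    point and to a linear projection. *)
Lemma ideal_sub_morph J (phi : {rmorphism P -> P}) : is_ideal J ->
  (forall c : K, phi c%:MP = c%:MP) -> (forall i, J ('X_i - phi 'X_i)) ->
  forall f, J (f - phi f).
Proof.
move=> hJ phiC h f.
have hM g1 g2 : J (g1 - phi g1) -> J (g2 - phi g2) -> J (g1 * g2 - phi (g1 * g2)).
  move=> h1 h2; rewrite rmorphM.
  have -> : g1 * g2 - phi g1 * phi g2 = g2 * (g1 - phi g1) + phi g1 * (g2 - phi g2).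
    by ring.
  by apply: idealD => //; apply: idealMl.
have h1 : J (1 - phi 1) by rewrite rmorph1 subrr; apply: ideal0.
elim/mpolyind: f => [|c m p _ _ IHp].
  by rewrite rmorph0 subrr; apply: ideal0.
rewrite rmorphD /=.
set A := c *: _; have -> : A + p - (phi A + phi p) = (A - phi A) + (p - phi p) by ring.
apply: idealD => //; rewrite /A -mul_mpolyC; apply: (hM).
  by rewrite phiC subrr; apply: ideal0.
rewrite mpolyXE_id; elim/big_rec: _ => // i q _ hq; apply: (hM) => //.
by elim: (m i) => // k IHk; rewrite exprS; apply: (hM).
Qed.

Lemma mpoly_mod_point J (a : 'I_n -> K) : is_ideal J ->
  (forall i, J ('X_i - (a i)%:MP)) -> forall f, J (f - (f.@[a])%:MP).
Proof.
move=> hJ h f; apply: (@ideal_sub_morph _ (@mpolyC n K \o meval a)) => //=.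
  by move=> c; rewrite mevalC.
by move=> i; rewrite mevalXU.
Qed.

(** The variables are specialised one at a time, adding X_k - b so that f is still avoided; the
    final ideal contains every X_i - a_i, hence is the ideal of the point a. *)
Theorem nullstellensatz J f : is_ideal J -> avoids J f ->
  exists2 a : 'I_n -> K, (forall g, J g -> g.@[a] = 0) & f.@[a] != 0.
Proof.
move=> hJ hf.
have step k : exists J' : P -> Prop, exists a : 'I_n -> K,
   [/\ is_ideal J', avoids J' f, (forall g, J g -> J' g) &
     forall i : 'I_n, (i < k)%N -> J' ('X_i - (a i)%:MP)].
  elim: k => [|k [J' [a [hJ' aJ' JJ' ha]]]]; first by exists J, (fun=> 0).
  case: (ltnP k n) => kn; last first.
    exists J', a; split=> // i _; apply: ha; exact: leq_trans kn.
  have [b hb] := avoids_step 'X_(Ordinal kn) hJ' aJ'.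
  exists (add_gen J' ('X_(Ordinal kn) - b%:MP)).
  exists (fun i => if i == Ordinal kn then b else a i); split=> //.
  - exact: add_gen_ideal.
  - by move=> g Jg; apply: add_genl; apply: JJ'.
  - move=> i; rewrite ltnS leq_eqVlt; case: (i =P Ordinal kn) => [->|ne] /=.
      by move=> _; rewrite -[X in add_gen _ _ X]mul1r; apply: add_genr.
    move=> /orP[/eqP e|ik]; first by case: ne; apply: val_inj.
    by apply: add_genl; apply: ha.
have [J' [a [hJ' aJ' JJ' ha]]] := step n.
have mp := mpoly_mod_point hJ' (fun i => ha i (ltn_ord i)).
exists a.
  move=> g /JJ' Jg; apply/eqP/negPn/negP => g0; apply: (aJ' 0%N).
  have : J' (g.@[a])%:MP.
    by apply: (@ideal_eq _ _ _ g) => //; rewrite -opprB; apply: idealN.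
  move=> /(idealMl (g.@[a])^-1%:MP hJ'); rewrite -mpolyCM mulVf //.
apply/negP => /eqP f0; apply: (aJ' 1%N).
by have := mp f; rewrite f0 mpolyC0 subr0.
Qed.

End Nullstellensatz.

(** * Uncountability of the complex numbers *)

Section Uncountable.
Variable R : realType.

Lemma avoiding_interval (s : seq R) (a b : R) : a < b ->
  exists ab : R * R, [/\ a <= ab.1, ab.1 < ab.2, ab.2 <= b &
    forall x, x \in s -> ~~ (ab.1 <= x <= ab.2)].
Proof.
elim: s a b => [|y s IHs] a b ab; first by exists (a, b).
have [a1 [b1 [h1 h2 h3 h4]]] : exists a1 b1, [/\ a <= a1, a1 < b1, b1 <= b &
    ~~ (a1 <= y <= b1)].
  (* A point in the first third is avoided by the right half, any other point by the first third. *)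
  have [y1|y1] := leP y (a + (b - a) / 3%:R).
    exists (a + (b - a) / 2%:R), b; split; lra.
  exists a, (a + (b - a) / 3%:R); split; lra.
have [[a2 b2] /= [h5 h6 h7 h8]] := IHs _ _ h2.
exists (a2, b2); split => //=; try lra.
move=> x; rewrite inE => /orP[/eqP ->|]; last exact: h8.
apply: contra h4 => /andP[? ?]; apply/andP; split; lra.
Qed.

(** Cantor's nested intervals, each stage avoiding a whole finite set; the supremum of the left ends
    lies in all of them. *)
Lemma real_not_enumerable (g : nat -> seq R) : ~ forall x, exists n, x \in g n.
Proof.
move=> hg.
have /choice [next hnext] : forall nab : nat * (R * R), exists ab : R * R,
    nab.2.1 < nab.2.2 -> [/\ nab.2.1 <= ab.1, ab.1 < ab.2, ab.2 <= nab.2.2 &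
    forall x, x \in g nab.1 -> ~~ (ab.1 <= x <= ab.2)].
  move=> [n [a b]] /=; have [ab|ab] := ltP a b; last by exists (a, b).
  by have [cd h] := avoiding_interval (g n) ab; exists cd.
pose I := fix I n := if n is m.+1 then next (m, I m) else (0, 1).
have Ilt n : (I n).1 < (I n).2.
  elim: n => [|n IHn]; first exact: ltr01.
  by have [] := hnext (n, I n) IHn.
have Inc n m : (n <= m)%N -> (I n).1 <= (I m).1 /\ (I m).2 <= (I n).2.
  move=> /subnK <-; elim: (m - n)%N => [|k [IH1 IH2]]; first by rewrite add0n.
  have /= [h1 _ h2 _] := hnext ((k + n)%N, I (k + n)%N) (Ilt _).
  by split; [apply: le_trans IH1 h1 | apply: le_trans h2 IH2].
have cross n m : (I n).1 <= (I m).2.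
  have [h1 _] := Inc _ _ (leq_maxl n m); have [_ h2] := Inc _ _ (leq_maxr n m).
  by apply: le_trans h1 (le_trans (ltW (Ilt _)) h2).
pose E := range (fun n => (I n).1).
have supE : has_sup E.
  split; first by exists (I 0).1; exists 0%N.
  by exists (I 0).2 => _ [n _ <-].
have [n xn] := hg (sup E).
have [_ _ _ /= /(_ _ xn) /negP] := hnext (n, I n) (Ilt n); apply.
apply/andP; split.
  by apply: sup_upper_bound => //; exists n.+1.
by apply: sup_le_ub => //; [by exists (I 0).1; exists 0%N | move=> _ [m _ <-]; apply: (cross m n.+1)].
Qed.

(** Without an infinite fibre, C is a union of finite fibres indexed by pairs of integers, and their
    real parts enumerate the reals. *)
Lemma uncountable_complex : uncountable R[i].
Proof.
move=> h; apply: contrapT => /forallNP H.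
have fin k : exists t : seq R[i], forall a, h a = k -> a \in t.
  have /existsNP [m /forallNP hm] := H k.
  suff sf : forall d e (t : seq R[i]), (e + d = m)%N -> size t = e -> uniq t ->
      all (fun a => h a == k) t -> exists t : seq R[i], forall a, h a = k -> a \in t.
    by apply: (sf m 0%N [::]).
  elim=> [|d IHd] e t ed st ut ht.
    by case: (hm t); split => //; rewrite st -ed addn0.
  have [|/existsNP [a /not_implyP [ha /negP at']]] := pselect (forall a, h a = k -> a \in t).
    by exists t.
  apply: (IHd e.+1 (a :: t)); rewrite ?addSnnS //=; first by rewrite st.
    by rewrite at'.
  by rewrite ha eqxx.
have [t ht] := choice fin.
pose g n := if unpickle n is Some k then [seq complex.Re a | a <- t k] else [::].
apply: (@real_not_enumerable g) => x.
exists (pickle (h x%:C%C)); rewrite /g pickleK.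
by apply/mapP; exists x%:C%C => //; apply: ht.
Qed.

End Uncountable.

(** * Hilbert's basis theorem *)

(** [next N] is an index at which u is minimal among all indices from N on; iterating it gives the
    subsequence. *)
Lemma monotone_subsequence (u : nat -> nat) : exists2 phi : nat -> nat,
  {homo phi : i j / (i < j)%N} & {homo u \o phi : i j / (i <= j)%N}.
Proof.
have /choice [next hnext] : forall N, exists i, (N <= i)%N /\ forall j, (N <= j)%N -> (u i <= u j)%N.
  move=> N.
  have ex : exists k, `[< exists2 i, (N <= i)%N & u i = k >].
    by exists (u N); apply/asboolP; exists N.
  have [k /asboolP [i Ni <-] mink] := ex_minnP ex.
  by exists i; split => // j Nj; apply: mink; apply/asboolP; exists j.
pose phi := fix phi k := if k is l.+1 then next (phi l).+1 else next 0.
exists phi; apply: homo_ltn || apply: homo_leq => //.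
- exact: ltn_trans.
- by move=> i /=; have [] := hnext (phi i).+1.
- exact: leq_trans.
- move=> i /=; have [h1 _] := hnext (phi i).+1.
  case: i h1 => [|i] h1 /=; first by have [_] := hnext 0%N; apply; lia.
  by have [h2 h3] := hnext (phi i).+1; apply: h3; apply: leq_trans (ltnW h1).
Qed.

(** Subsequences are extracted one coordinate at a time until all coordinates are nondecreasing. *)
Lemma dickson n (u : nat -> 'X_{1..n}) : exists i j, (i < j)%N /\ (u i <= u j)%MM.
Proof.
have H k : exists2 phi : nat -> nat, {homo phi : i j / (i < j)%N} &
    forall l : 'I_n, (l < k)%N -> {homo (fun i => u (phi i) l) : i j / (i <= j)%N}.
  elim: k => [|k [phi h1 h2]]; first by exists id.
  case: (ltnP k n) => kn; last first.
    by exists phi => // l _; apply: h2; apply: leq_trans kn.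
  have [psi h3 h4] := monotone_subsequence (fun i => u (phi i) (Ordinal kn)).
  exists (phi \o psi) => [i j ij|l] /=; first by apply: h1; apply: h3.
  rewrite ltnS leq_eqVlt; case: (l =P Ordinal kn) => [->|ne] /=; first by move=> _ i j; apply: h4.
  move=> /orP[/eqP e|lk i j ij]; first by case: ne; apply: val_inj.
  apply: h2 => //; move: ij; rewrite leq_eqVlt => /orP[/eqP -> //|/h3 /ltnW //].
have [phi h1 h2] := H n.
exists (phi 0%N), (phi 1%N); split; first exact: h1.
by apply/mnm_lepP => l; apply: (h2 l (ltn_ord l)).
Qed.

Section Generated.
Variable P : comNzRingType.

Definition gen_ideal (s : seq P) : P -> Prop :=
  foldr (fun y I => add_gen I y) (fun f => f = 0) s.

Lemma gen_ideal_ideal s : is_ideal (gen_ideal s).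
Proof.
elim: s => [|y s IHs] /=; last exact: add_gen_ideal.
by split=> // [f g -> ->|a f ->]; rewrite ?addr0 ?mulr0.
Qed.

Lemma gen_idealP s f : gen_ideal s f ->
  exists c : 'I_(size s) -> P, f = \sum_i c i * s`_i.
Proof.
elim: s f => [|y s IHs] f /=; first by move=> ->; exists (fun=> 0); rewrite big_ord0.
move=> [a /IHs [c hc]].
exists (fun i => if unlift ord0 i is Some j then c j else a).
rewrite big_ord_recl unlift_none /= -(subrK (a * y) f) addrC hc; congr (_ + _).
by apply: eq_bigr => i _; rewrite liftK.
Qed.

Lemma gen_ideal_mem s y : y \in s -> gen_ideal s y.
Proof.
elim: s => //= z s IHs; rewrite inE => /orP[/eqP ->|/IHs h].
  by rewrite -[X in add_gen _ _ X]mul1r; apply: add_genr; apply: gen_ideal_ideal.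
exact: add_genl.
Qed.

End Generated.

Section HilbertBasis.
Variables (K : fieldType) (n : nat).
Local Notation P := {mpoly K[n]}.
Implicit Types (I J : P -> Prop) (f g : P).

(** Keep choosing, outside the ideal generated so far, an element of I with minimal leading
    monomial. By Dickson's lemma one leading monomial divides a later one, and cancelling it gives a
    smaller leading monomial that is still outside. *)
Theorem hilbert_basis I : is_ideal I ->
  exists2 s : seq P, (forall f, f \in s -> I f) & forall f, I f -> gen_ideal s f.
Proof.
move=> hI; apply: contrapT => H.
have /choice [next hnext] : forall s : seq P, exists f, (forall f, f \in s -> I f) ->
    [/\ I f, ~ gen_ideal s f & forall g, I g -> ~ gen_ideal s g -> (mlead f <= mlead g)%O].
  move=> s; have [hs|] := pselect (forall f, f \in s -> I f); last by exists 0.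
  have [f0 If0 sf0] : exists2 f, I f & ~ gen_ideal s f.
    apply: contrapT => h; apply: H; exists s => // f If.
    by apply: contrapT => h'; apply: h; exists f.
  move: {2}(mlead f0) (erefl (mlead f0)) => m.
  elim/(well_founded_ind (@ltom_wf n)): m f0 If0 sf0 => m IHm f If sf fm.
  have [h|/existsNP [g /not_implyP [Ig /not_implyP [sg /negP]]]] :=
      pselect (forall g, I g -> ~ gen_ideal s g -> (mlead f <= mlead g)%O).
    by exists f.
  by rewrite -ltNge fm => gm; apply: (IHm _ gm g).
pose S := fix S k := if k is l.+1 then next (S l) :: S l else [::].
have SI k f : f \in S k -> I f.
  elim: k f => [|k IHk] f //=; rewrite inE => /orP[/eqP ->|]; last exact: IHk.
  by have [] := hnext (S k) IHk.
have Sin j k : (j < k)%N -> next (S j) \in S k.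
  elim: k => // k IHk; rewrite ltnS leq_eqVlt inE => /orP[/eqP ->|/IHk ->]; first by rewrite eqxx.
  by rewrite orbT.
have [j [k [jk le]]] := dickson (fun k => mlead (next (S k))).
set f := next (S j) in le; set g := next (S k) in le.
have [Ig sg ming] := hnext (S k) (SI k); rewrite -/g in Ig sg ming.
have [If sf _] := hnext (S j) (SI j); rewrite -/f in If sf.
have f0 : f != 0 by apply/eqP => e; apply: sf; rewrite e; apply: (ideal0 (gen_ideal_ideal _)).
have g0 : g != 0 by apply/eqP => e; apply: sg; rewrite e; apply: (ideal0 (gen_ideal_ideal _)).
pose m := (mlead g - mlead f)%MM; pose c := mleadc g / mleadc f.
have c0 : c != 0 by rewrite mulf_neq0 ?invr_eq0 // mleadc_eq0.
pose q := c *: 'X_[m] * f; pose h := g - q.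
have Sf : gen_ideal (S k) q.
  by apply: (idealMl _ (gen_ideal_ideal _)); apply: gen_ideal_mem; apply: Sin.
have sh : ~ gen_ideal (S k) h.
  by move=> Sh; apply: sg; apply: (ideal_eq (gen_ideal_ideal _) Sf Sh).
have Ih : I h by apply: (idealB hI) => //; apply: (idealMl _ hI).
have h0 : h != 0.
  by apply/eqP => e; apply: sh; rewrite e; apply: (ideal0 (gen_ideal_ideal _)).
have Xf0 : 'X_[m] * f != 0.
  by apply: mulf_neq0 => //; rewrite -msupp_eq0 msuppX.
have qlead : mlead q = mlead g.
  rewrite /q -scalerAl mleadZ // mleadM // ?mleadXm ?submK //.
  by rewrite -msupp_eq0 msuppX.
have hg : (mlead h <= mlead g)%O.
  by apply: le_trans (mleadB_le _ _) _; rewrite qlead joinxx.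
have hc : h@_(mlead g) = 0.
  rewrite mcoeffB -{2}qlead /q -scalerAl.
  have X0 : 'X_[m] != 0 :> P by rewrite -msupp_eq0 msuppX.
  rewrite (mleadZ _ c0) mcoeffZ (mleadM X0 f0) mleadcM mleadXm mcoeffX eqxx mul1r.
  by rewrite /c divfK ?subrr // mleadc_eq0.
have := ming h Ih sh; rewrite leNgt => /negP; apply.
rewrite lt_neqAle hg andbT; apply: contra h0 => /eqP e.
by rewrite -mleadc_eq0 e hc.
Qed.

End HilbertBasis.

(** * Local rings at a point *)

Section LocalTheory.
Variables (K : closedFieldType) (n : nat) (a : 'I_n -> K).
Local Notation P := {mpoly K[n]}.
Implicit Types (I J : P -> Prop) (f g y : P).

(* The preimage in P of the ideal generated by I in the local ring at a. *)
Definition loc I : P -> Prop := fun f => exists2 g, g.@[a] != 0 & I (g * f).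

Definition prime_ideal I := forall f g, I (f * g) -> I f \/ I g.

Lemma loc_ideal I : is_ideal I -> is_ideal (loc I).
Proof.
move=> hI; split.
- by exists 1; rewrite ?meval1 ?oner_neq0 // mulr0; apply: ideal0.
- move=> f g [u u0 uf] [v v0 vg]; exists (u * v).
    by rewrite mevalM mulf_neq0.
  have -> : u * v * (f + g) = v * (u * f) + u * (v * g) by ring.
  by apply: (idealD hI); apply: (idealMl _ hI).
- move=> c f [u u0 uf]; exists u => //.
  by rewrite mulrCA; apply: (idealMl _ hI).
Qed.

Lemma sub_loc I f : I f -> loc I f.
Proof. by exists 1; rewrite ?meval1 ?oner_neq0 ?mul1r. Qed.

Lemma loc_sub I J : (forall f, I f -> J f) -> forall f, loc I f -> loc J f.
Proof. by move=> h f [g g0 gf]; exists g => //; apply: h. Qed.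

Lemma loc_idem I f : loc (loc I) f -> loc I f.
Proof.
by move=> [g g0 [h h0 hgf]]; exists (h * g); rewrite ?mevalM ?mulf_neq0 // -mulrA.
Qed.

Lemma loc_add_gen I y f : loc (add_gen I y) f <-> loc (add_gen (loc I) y) f.
Proof.
split; first by apply: loc_sub; apply: add_gen_sub; apply: sub_loc.
move=> [g g0 [b [h h0 Ih]]]; exists (h * g); first by rewrite mevalM mulf_neq0.
by exists (h * b); rewrite -!mulrA -mulrBr.
Qed.

Lemma nzd_loc I y : nzd I y -> nzd (loc I) y.
Proof. by move=> hy f [g g0 h]; exists g => //; apply: hy; rewrite mulrCA. Qed.

Lemma loc_vanish I f : (forall f, I f -> f.@[a] = 0) -> loc I f -> f.@[a] = 0.
Proof.
move=> h [g g0 /h /eqP]; rewrite mevalM mulf_eq0 (negPf g0) /=.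
by move/eqP.
Qed.

Section Krull.
Variables (I : P -> Prop) (y : P).
Hypotheses (hI : is_ideal I) (satI : forall f, loc I f -> I f).
Hypotheses (y0 : y.@[a] = 0) (hy : nzd I y).

(* The determinant trick, applied to finitely many generators of the intersection N, for
   which N = y N locally. *)
Lemma krull_intersection f : (forall k, loc (add_gen I (y ^+ k)) f) -> I f.
Proof.
pose N h := forall k, loc (add_gen I (y ^+ k)) h.
have hN : is_ideal N.
  split.
  - by move=> k; apply: (ideal0 (loc_ideal (add_gen_ideal _ hI))).
  - by move=> u v hu hv k; apply: (idealD (loc_ideal (add_gen_ideal _ hI)) (hu k) (hv k)).
  - by move=> c u hu k; apply: (idealMl _ (loc_ideal (add_gen_ideal _ hI)) (hu k)).
(* Locally N = y N: if g h = w y modulo I, then w is again in N because y can be cancelled. *)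
have Ndiv h : N h -> exists gw : P * P, [/\ gw.1.@[a] != 0, N gw.2 & I (gw.1 * h - gw.2 * y)].
  move=> hh; have [g g0 [w Iw]] := hh 1%N; rewrite expr1 in Iw.
  exists (g, w); split=> // k /=.
  have [g1 g10 [b Ib]] := hh k.+1; exists g1 => //.
  exists (g * b); apply: hy.
  have -> : y * (g1 * w - g * b * y ^+ k) =
    g * (g1 * h - b * y ^+ k.+1) - g1 * (g * h - w * y) by rewrite exprS; ring.
  by apply: (idealB hI); apply: (idealMl _ hI).
have [s sN Ns] := hilbert_basis hN.
have /choice [gw hgw] : forall i : 'I_(size s), exists gw : P * P,
    [/\ gw.1.@[a] != 0, N gw.2 & I (gw.1 * s`_i - gw.2 * y)].
  by move=> i; apply/Ndiv/sN/mem_nth.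
have /choice [m hm] : forall i : 'I_(size s), exists c : 'I_(size s) -> P,
    (gw i).2 = \sum_j c j * s`_j.
  by move=> i; have [_ Nw _] := hgw i; apply/gen_idealP/Ns.
(* Modulo I, [D] annihilates the generators of N. At the point it is diagonal with entries g_i(a),
   as y(a) = 0, so its determinant is a unit of the local ring. *)
pose D : 'M[P]_(size s) := \matrix_(i, j) ((gw i).1 *+ (i == j) - y * m i j).
have Dv i : I (\sum_j D i j * s`_j).
  have [_ _] := hgw i; rewrite hm; congr I.
  under [RHS]eq_bigr do rewrite mxE mulrBl.
  rewrite sumrB; congr (_ - _).
    rewrite (bigD1 i) //= eqxx mulr1n big1 ?addr0 // => j ji.
    by rewrite eq_sym (negPf ji) mulr0n mul0r.
  by rewrite mulr_suml; apply: eq_bigr => j _; ring.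
have detv (i : 'I_(size s)) : I (\det D * s`_i).
  have -> : \det D * s`_i = \sum_k \adj D i k * \sum_j D k j * s`_j.
    transitivity (\sum_j (\adj D *m D) i j * s`_j).
      rewrite mul_adj_mx (bigD1 i) //= mxE eqxx mulr1n big1 ?addr0 // => j ji.
      by rewrite mxE eq_sym (negPf ji) mulr0n mul0r.
    under eq_bigr do rewrite mxE mulr_suml.
    rewrite exchange_big /=; apply: eq_bigr => k _.
    by rewrite mulr_sumr; apply: eq_bigr => j _; rewrite mulrA.
  by apply: (ideal_sum _ hI) => k _; apply: (idealMl _ hI).
have det0 : (\det D).@[a] != 0.
  rewrite -det_map_mx.
  have -> : map_mx (meval a) D = diag_mx (\row_i (gw i).1.@[a]).
    apply/matrixP => i j; rewrite !mxE mevalB mevalM y0 mul0r subr0.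
    by rewrite mevalMn.
  rewrite det_diag; apply/prodf_neq0 => i _; rewrite mxE.
  by have [] := hgw i.
move=> /Ns /gen_idealP [c ->]; apply: (ideal_sum _ hI) => i _.
apply: (idealMl _ hI); apply: satI; exists (\det D) => //.
Qed.

(** k is the y-adic order of f in the local ring; Krull's theorem makes it finite outside I. *)
Lemma exact_power f : ~ I f ->
  exists k b g, [/\ g.@[a] != 0, I (g * f - b * y ^+ k) & ~ loc (add_gen I y) b].
Proof.
move=> If.
have ex : exists k, `[< ~ loc (add_gen I (y ^+ k)) f >].
  apply: contrapT => h; apply: If; apply: krull_intersection => k.
  by apply: contrapT => h'; apply: h; exists k; apply/asboolP.
have [[|k] /asboolP hk mink] := ex_minnP ex.
  case: hk; apply: sub_loc; exists f; rewrite expr0 mulr1 subrr; exact: ideal0.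
have [g g0 [b Ib]] : loc (add_gen I (y ^+ k)) f.
  apply: contrapT => h; suff : (k.+1 <= k)%N by rewrite ltnn.
  by apply: mink; apply/asboolP.
exists k, b, g; split => // - [g1 g10 [c Ic]]; apply: hk.
exists (g1 * g); first by rewrite mevalM mulf_neq0.
exists c.
have -> : g1 * g * f - c * y ^+ k.+1 =
  g1 * (g * f - b * y ^+ k) + y ^+ k * (g1 * b - c * y) by rewrite exprS; ring.
by apply: (idealD hI); apply: (idealMl _ hI).
Qed.

(** Orders add: elements outside I have leading coefficients b1, b2 outside I + (y), and cancelling
    y^(k1 + k2) in f1 f2 would put b1 b2 into I, against primality modulo y. *)
Lemma prime_lift : prime_ideal (loc (add_gen I y)) -> prime_ideal I.
Proof.
move=> pr f1 f2 If; apply: contrapT => /not_orP [/exact_power [k1 [b1 [g1 [g10 I1 n1]]]]].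
move=> /exact_power [k2 [b2 [g2 [g20 I2 n2]]]].
have [] // := pr b1 b2.
apply: sub_loc; apply: add_genl; apply: (nzdX (n := k1 + k2) hy).
have -> : y ^+ (k1 + k2) * (b1 * b2) = g1 * g2 * (f1 * f2) -
   g2 * f2 * (g1 * f1 - b1 * y ^+ k1) - b1 * y ^+ k1 * (g2 * f2 - b2 * y ^+ k2).
  by rewrite exprD; ring.
by do 2?apply: (idealB hI); apply: (idealMl _ hI).
Qed.

End Krull.

(** Hadamard's form of Taylor's formula: the coefficients are polynomials, so n such expansions can
    be inverted in the local ring by Cramer's rule. *)
Lemma taylor1 f : exists A : 'I_n -> P,
  f - (f.@[a])%:MP = \sum_i A i * ('X_i - (a i)%:MP) /\ forall i, (A i).@[a] = (f^`M(i)).@[a].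
Proof.
pose J f := exists A : 'I_n -> P, f = \sum_i A i * ('X_i - (a i)%:MP).
have hJ : is_ideal J.
  split.
  - by exists (fun=> 0); rewrite big1 // => i _; rewrite mul0r.
  - move=> u v [A ->] [B ->]; exists (fun i => A i + B i).
    by rewrite -big_split; apply: eq_bigr => i _ /=; rewrite mulrDl.
  - move=> c u [A ->]; exists (fun i => c * A i).
    by rewrite mulr_sumr; apply: eq_bigr => i _; rewrite mulrA.
have [|A hA] := @mpoly_mod_point _ _ J a hJ _ f.
  move=> i; exists (fun j => (j == i)%:R).
  rewrite (bigD1 i) //= eqxx mul1r big1 ?addr0 // => j /negPf ->.
  by rewrite mul0r.
exists A; split => // j.
have /(congr1 (fun g : P => (g^`M(j)).@[a])) := hA.
rewrite mderivB mderivC subr0 => ->.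
rewrite mderiv_sum meval_sum (bigD1 j) //= [X in _ + X]big1 => [|i ij];
  rewrite mderivM mevalD !mevalM mderivB mderivC subr0 mevalB mevalXU mevalC subrr mulr0 add0r mderivX mevalZ mnm1E.
  rewrite eqxx mul1r (_ : (U_(j) - U_(j) = 0)%MM) ?mpolyX0 ?meval1 ?mulr1 ?addr0 //.
  by apply/mnmP => k; rewrite mnmBE subnn mnm0E.
by rewrite (negPf ij) mul0r mulr0.
Qed.

Section RegularPoint.
Variables (J : P -> Prop) (h : 'I_n -> P).
Hypotheses (hJ : is_ideal J) (J0 : forall f, J f -> f.@[a] = 0) (Jh : forall i, J (h i)).
Hypothesis jac : \det (\matrix_(i, j) ((h i)^`M(j)).@[a]) != 0.

Lemma loc_maximal f : f.@[a] = 0 -> loc J f.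
Proof.
move=> f0.
have hl := loc_ideal hJ.
suff hX i : loc J ('X_i - (a i)%:MP).
  by have := mpoly_mod_point hl hX f; rewrite f0 mpolyC0 subr0.
have /choice [A hA] := fun i => taylor1 (h i).
pose M : 'M[P]_n := \matrix_(i, j) A i j.
exists (\det M).
  rewrite -det_map_mx (_ : map_mx _ _ = \matrix_(i, j) ((h i)^`M(j)).@[a]) //.
  apply/matrixP => k j; rewrite !mxE; have [_ e] := hA k; exact: e.
have -> : \det M * ('X_i - (a i)%:MP) = \sum_k \adj M i k * h k.
  transitivity (\sum_j (\adj M *m M) i j * ('X_j - (a j)%:MP)).
    rewrite mul_adj_mx (bigD1 i) //= mxE eqxx mulr1n big1 ?addr0 // => j ji.
    by rewrite mxE eq_sym (negPf ji) mulr0n mul0r.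
  under eq_bigr do rewrite mxE mulr_suml.
  rewrite exchange_big /=; apply: eq_bigr => k _.
  have [e _] := hA k; rewrite J0 // mpolyC0 subr0 in e.
  rewrite e mulr_sumr; apply: eq_bigr => j _.
  by rewrite [M _ _]mxE mulrA.
by apply: (ideal_sum _ hJ) => k _; apply: (idealMl _ hJ).
Qed.

Lemma regular_point_prime : prime_ideal (loc J).
Proof.
move=> f g fg; have /eqP := loc_vanish J0 fg; rewrite mevalM mulf_eq0.
by case/orP => /eqP h0; [left | right]; apply: loc_maximal.
Qed.

End RegularPoint.

End LocalTheory.

(** * Regular sequences of forms *)

Section GenIdeal.
Variable P : comNzRingType.
Implicit Types (s t : seq P).

Lemma gen_ideal_min s (J : P -> Prop) : is_ideal J -> (forall y, y \in s -> J y) ->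
  forall f, gen_ideal s f -> J f.
Proof.
move=> hJ; elim: s => [|y s IHs] h f /=; first by move=> ->; apply: ideal0.
apply: add_gen_min => //; last by apply: h; rewrite mem_head.
by apply: IHs => z zs; apply: h; rewrite inE zs orbT.
Qed.

Lemma gen_ideal_subset s t : {subset s <= t} -> forall f, gen_ideal s f -> gen_ideal t f.
Proof.
move=> st; apply: gen_ideal_min; first exact: gen_ideal_ideal.
by move=> y /st; apply: gen_ideal_mem.
Qed.

Lemma gen_ideal_eqmem s t : s =i t -> forall f, gen_ideal s f <-> gen_ideal t f.
Proof. by move=> st f; split; apply: gen_ideal_subset => y; rewrite st. Qed.

(* Listed backwards: the last element comes first in the usual order of a regular sequence. *)
Fixpoint regular_seq s := if s is y :: t then nzd (gen_ideal t) y /\ regular_seq t else True.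

Lemma nzd_swapr (I : P -> Prop) a b : is_ideal I -> nzd I a -> nzd (add_gen I a) b ->
  nzd (add_gen I b) a.
Proof.
move=> hI ha hb f [c Ic].
have [|e Ie] := hb c.
  exists f; rewrite -opprB.
  by apply: (idealN hI); rewrite [b * c]mulrC [f * a]mulrC.
exists e; apply: ha.
have -> : a * (f - e * b) = (a * f - c * b) + b * (c - e * a) by ring.
by apply: (idealD hI) => //; apply: (idealMl _ hI).
Qed.

End GenIdeal.

Section Graded.
Variables (K : fieldType) (n : nat).
Local Notation P := {mpoly K[n]}.
Implicit Types (I : P -> Prop) (f g y : P).

Definition hc d f : P := pihomog mdeg d f.

Lemma hc_homog d f : hc d f \is d.-homog. Proof. exact: pihomogP. Qed.

Lemma hc_id d f : f \is d.-homog -> hc d f = f.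
Proof. exact: pihomog_dE. Qed.

Lemma hc_ne d e f : f \is d.-homog -> d != e -> hc e f = 0.
Proof. by move=> h ne; apply: (pihomog_ne0 ne). Qed.

Lemma hcD d f g : hc d (f + g) = hc d f + hc d g. Proof. exact: pihomogD. Qed.
Lemma hcB d f g : hc d (f - g) = hc d f - hc d g. Proof. exact: pihomogB. Qed.
Lemma hc0 d : hc d 0 = 0. Proof. exact: pihomog0. Qed.

Lemma hcZ d c f : hc d (c *: f) = c *: hc d f.
Proof. exact: linearZ. Qed.

Lemma hc_sum d (T : Type) (r : seq T) (p : pred T) (F : T -> P) :
  hc d (\sum_(i <- r | p i) F i) = \sum_(i <- r | p i) hc d (F i).
Proof. exact: (big_morph _ (hcD d) (hc0 d)). Qed.

Lemma hc_partition f k0 : exists2 k, (k0 <= k)%N & f = \sum_(d < k) hc d f.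
Proof.
exists (maxn k0 (msize f)); first exact: leq_maxl.
exact: pihomog_partitionE (leq_maxr _ _).
Qed.

Lemma hcM m d p g : p \is m.-homog -> hc (m + d) (p * g) = p * hc d g.
Proof.
move=> hp; have [k dk {1}->] := hc_partition g d.+1.
rewrite mulr_sumr hc_sum (bigD1 (Ordinal dk)) //= big1 ?addr0.
  by rewrite hc_id //; apply: dhomogM => //; apply: hc_homog.
move=> e ed; apply: (@hc_ne (m + e)); first by apply: dhomogM => //; apply: hc_homog.
by rewrite eqn_add2l; apply: contra ed => /eqP e1; apply/eqP/val_inj.
Qed.

Lemma hcM_lt m d p g : p \is m.-homog -> (d < m)%N -> hc d (p * g) = 0.
Proof.
move=> hp dm; have [k _ {1}->] := hc_partition g 0.
rewrite mulr_sumr hc_sum big1 // => e _.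
apply: (@hc_ne (m + e)); first by apply: dhomogM => //; apply: hc_homog.
by have := ltn_ord e; lia.
Qed.

Lemma hcMr m d p g : p \is m.-homog -> hc (d + m) (g * p) = hc d g * p.
Proof. by move=> hp; rewrite mulrC addnC hcM // mulrC. Qed.

Definition graded I := forall d f, I f -> I (hc d f).

Lemma graded_ind I f : is_ideal I -> (forall d, I (hc d f)) -> I f.
Proof.
by move=> hI h; have [k _ ->] := hc_partition f 0; apply: (ideal_sum _ hI).
Qed.

Lemma add_gen_graded I m y : is_ideal I -> y \is m.-homog -> graded I ->
  graded (add_gen I y).
Proof.
move=> hI hy gI d f [c /(gI d)]; rewrite hcB.
case: (ltnP d m) => dm.
  by rewrite mulrC (hcM_lt _ hy dm) subr0; apply: add_genl.
by rewrite -(subnK dm) hcMr // => h; exists (hc (d - m) c).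
Qed.

Lemma add_gen_hc I m y d f : is_ideal I -> y \is m.-homog -> graded I ->
  f \is d.-homog -> add_gen I y f ->
  I f \/ (m <= d)%N /\ exists2 c, c \is (d - m).-homog & I (f - c * y).
Proof.
move=> hI hy gI hf [c /(gI d)]; rewrite hcB (hc_id hf).
case: (ltnP d m) => dm.
  by rewrite mulrC (hcM_lt _ hy dm) subr0; left.
rewrite -(subnK dm) hcMr // subnK // => h; right; split => //.
by exists (hc (d - m) c); rewrite ?hc_homog.
Qed.

Lemma nzd_graded I m y : is_ideal I -> y \is m.-homog -> graded I ->
  (forall d f, f \is d.-homog -> I (y * f) -> I f) -> nzd I y.
Proof.
move=> hI hy gI h f If; apply: graded_ind => // d; apply: (h d); first exact: hc_homog.
by rewrite -(hcM _ _ hy); apply: gI.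
Qed.

(** The grading replaces locality: if b f is in I, then f = c a modulo I and b c is in I, with c of
    smaller degree. *)
Lemma nzd_swapl I d e a b : is_ideal I -> graded I -> (0 < d)%N ->
  a \is d.-homog -> b \is e.-homog ->
  nzd I a -> nzd (add_gen I a) b -> nzd I b.
Proof.
move=> hI gI d0 ha hb na nb; apply: (nzd_graded hI hb gI) => m.
have [k] := ubnP m; elim: k m => // k IHk m mk f hf If.
have [//|[dm [c hc Ic]]] := add_gen_hc hI ha gI hf (nb _ (add_genl _ If)).
apply: (ideal_eq hI _ Ic); apply: (idealMr _ hI); apply: (IHk _ _ _ hc); first by lia.
apply: na.
have -> : a * (b * c) = b * f - b * (f - c * a) by ring.
by apply: (idealB hI) => //; apply: (idealMl _ hI).
Qed.

(** Used to pass to an affine chart. Since y raises degrees, the lowest component of (y - c) f is -c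
    times that of f, and the higher components follow by induction. *)
Lemma nzd_shift I y c : is_ideal I -> graded I -> y \is 1.-homog -> c != 0 ->
  nzd I (y - c%:MP).
Proof.
move=> hI gI hy c0 f If; apply: graded_ind => // d.
have key m : I (hc m (y * f)) -> I (hc m f).
  move=> h; rewrite -[hc m f]scale1r -(mulVf c0) -scalerA -mul_mpolyC.
  apply: (idealMl _ hI).
  have -> : c *: hc m f = hc m (y * f) - hc m ((y - c%:MP) * f).
    by rewrite -hcB -mulrBl opprB addrC subrK mul_mpolyC hcZ.
  by apply: (idealB hI) => //; apply: gI.
elim: d => [|d IHd]; apply: key.
  by rewrite (hcM_lt _ hy) //; apply: ideal0.
by rewrite -[d.+1]add1n hcM //; apply: (idealMl _ hI).
Qed.

Definition homog_pos f := exists2 d, (0 < d)%N & f \is d.-homog.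

Lemma gen_ideal_graded s : (forall y, y \in s -> homog_pos y) -> graded (gen_ideal s).
Proof.
elim: s => [|y s IHs] h /=; first by move=> d f ->; rewrite hc0.
have [d _ hy] := h y (mem_head _ _).
apply: (add_gen_graded _ hy); first exact: gen_ideal_ideal.
by apply: IHs => z zs; apply: h; rewrite inE zs orbT.
Qed.

(** As lists are read backwards, moving [y] to the head makes it the last element of the sequence;
    it is exchanged with each element that came after it. *)
Lemma regular_seq_cat s1 y s2 : (forall z, z \in s1 ++ y :: s2 -> homog_pos z) ->
  regular_seq (s1 ++ y :: s2) -> regular_seq (y :: s1 ++ s2).
Proof.
elim: s1 => [|x s1 IHs] //= h [nx /IHs [|ny rs]].
  by move=> z zs; apply: h; rewrite inE zs orbT.
have hg : graded (gen_ideal (s1 ++ s2)).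
  apply: gen_ideal_graded => z; rewrite mem_cat => zs; apply: h.
  by rewrite inE mem_cat inE; case/orP: zs => ->; rewrite ?orbT.
have hI := gen_ideal_ideal (s1 ++ s2).
have [d d0 hx] := h x (mem_head _ _).
have [e e0 hy] : homog_pos y by apply: h; rewrite inE mem_cat mem_head !orbT.
have nx' : nzd (add_gen (gen_ideal (s1 ++ s2)) y) x.
  apply: (@nzd_iff _ (gen_ideal (s1 ++ y :: s2))) nx => f.
  apply: (@gen_ideal_eqmem _ _ (y :: s1 ++ s2)) => z.
  by rewrite !(mem_cat, inE) orbCA.
split; first exact: nzd_swapr nx'.
by split=> //; apply: nzd_swapl nx'; eauto.
Qed.

Lemma regular_seq_perm s t : (forall z, z \in s -> homog_pos z) -> perm_eq s t ->
  regular_seq s -> regular_seq t.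
Proof.
elim: t s => [|y t IHt] s h st rs //.
have ys : y \in s by rewrite (perm_mem st) mem_head.
case/splitPr: ys h st rs => s1 s2 h st rs.
have st' : perm_eq (s1 ++ s2) t.
  by move: st; rewrite -[y :: s2]cat1s perm_catCA perm_cons.
have /= [ny rs'] := regular_seq_cat h rs.
split; last first.
  apply: IHt st' rs' => z zs; apply: h; move: zs.
  by rewrite !(mem_cat, inE) => /orP[] ->; rewrite ?orbT.
apply: nzd_iff ny => f; apply: gen_ideal_eqmem; exact: perm_mem.
Qed.

End Graded.

(** The substitution occurring in [linear_section]: composing with it is pullback along y |-> y *m
    M. *)
Definition lin_subst (K : fieldType) m n (M : 'M[K]_(m, n)) : n.-tuple {mpoly K[m]} :=
  [tuple \sum_(i < m) M i j *: 'X_i | j < n].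

Lemma meval_lin_subst (K : fieldType) m n (M : 'M[K]_(m, n)) (f : {mpoly K[n]}) (z : 'rV_m) :
  (f \mPo lin_subst M).@[z ord0] = f.@[(z *m M) ord0].
Proof.
rewrite comp_mpoly_meval; apply: meval_eq => j.
rewrite tnth_mktuple meval_sum mxE; apply: eq_bigr => i _.
by rewrite mevalZ mevalXU mulrC.
Qed.

Section Points.
Variables (K : closedFieldType) (n : nat).
Hypothesis unc : uncountable K.
Local Notation P := {mpoly K[n]}.
Implicit Types (J : P -> Prop) (f g : P) (z : 'rV[K]_n).

Lemma nullstellensatz_rV J f : is_ideal J -> avoids J f ->
  exists2 z : 'rV[K]_n, (forall g, J g -> g.@[z ord0] = 0) & f.@[z ord0] != 0.
Proof.
move=> hJ /(nullstellensatz unc hJ)[a ha fa].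
have e g : g.@[(\row_i a i : 'rV_n) ord0] = g.@[a] by apply: meval_eq => i; rewrite mxE.
by exists (\row_i a i : 'rV_n) => [g /ha|]; rewrite e.
Qed.

Lemma mpoly_fun_eq0 f : (forall z, f.@[z ord0] = 0) -> f = 0.
Proof.
move=> h; apply/eqP/negPn/negP => f0.
have [||z _] := @nullstellensatz_rV (fun g => g = 0) f.
- by split=> // [u v -> ->|a u ->]; rewrite ?addr0 ?mulr0.
- by move=> N /eqP; rewrite expf_eq0 (negPf f0) andbF.
- by rewrite h eqxx.
Qed.

End Points.

(** * Ideals of linear subspaces *)

Section LinearForms.
Variables (K : closedFieldType) (n : nat).
Hypothesis unc : uncountable K.
Local Notation P := {mpoly K[n]}.
Implicit Types (f g y : P) (z : 'rV[K]_n) (c : 'cV[K]_n).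

Definition lin_form c : P := \sum_i c i ord0 *: 'X_i.

Lemma meval_lin_form c z : (lin_form c).@[z ord0] = (z *m c) ord0 ord0.
Proof.
by rewrite meval_sum mxE; apply: eq_bigr => i _; rewrite mevalZ mevalXU mulrC.
Qed.

Lemma lin_form_eq0 c z : z *m c = 0 -> (lin_form c).@[z ord0] = 0.
Proof. by rewrite meval_lin_form => ->; rewrite mxE. Qed.

Lemma lin_form_neq0 c z : z *m c = 1%:M -> (lin_form c).@[z ord0] != 0.
Proof. by rewrite meval_lin_form => ->; rewrite mxE oner_neq0. Qed.

Lemma lin_form_homog c : lin_form c \is 1.-homog.
Proof.
by apply: rpred_sum => i _; apply: rpredZ; rewrite dhomogX; apply/eqP/mdeg1.
Qed.

Lemma lin_form_homog_pos c : homog_pos (lin_form c).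
Proof. by exists 1%N => //; apply: lin_form_homog. Qed.

(** The matrix [Q] projects onto the subspace. A polynomial vanishing there is killed by
    substituting [Q], while the substitution changes each variable by a combination of the given
    linear forms. *)
Lemma gen_lin_formsP (cs : seq 'cV[K]_n) f :
  (forall z, (forall c, c \in cs -> z *m c = 0) -> f.@[z ord0] = 0) <->
  gen_ideal (map lin_form cs) f.
Proof.
split; last first.
  move=> h z hz; move: f h; apply: gen_ideal_min.
    split=> [|f g h1 h2|a f h1]; first exact: meval0.
      by rewrite mevalD h1 h2 addr0.
    by rewrite mevalM h1 mulr0.
  by move=> _ /mapP[c /hz zc ->]; rewrite meval_lin_form zc mxE.
move=> h.
pose L : 'M[K]_(n, size cs) := \matrix_(i, k) (cs`_k) i ord0.
pose Q := 1%:M - L *m pinvmx L.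
have hI := gen_ideal_ideal (map lin_form cs).
have QL : Q *m L = 0.
  by rewrite mulmxBl mul1mx mulmxKpV ?subrr.
have f0 : f \mPo lin_subst Q = 0.
  apply: (mpoly_fun_eq0 unc) => z; rewrite meval_lin_subst; apply: h => c /(nthP 0)[k kc <-].
  have e : (z *m Q *m L) ord0 (Ordinal kc) = 0 by rewrite -mulmxA QL mulmx0 mxE.
  apply/matrixP => i j; rewrite !ord1 [RHS]mxE -[RHS]e !mxE.
  by apply: eq_bigr => l _; rewrite [L _ _]mxE.
rewrite -[f]subr0 -f0.
apply: (@ideal_sub_morph _ _ _ (comp_mpoly (lin_subst Q))) => // [c|j /=].
  exact: comp_mpolyC.
rewrite comp_mpolyXU -tnth_nth tnth_mktuple.
have -> : 'X_j - \sum_i Q i j *: 'X_i = \sum_k (pinvmx L k j)%:MP * lin_form cs`_k :> P.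
  have -> : 'X_j = \sum_i (1%:M i j : K) *: 'X_i :> P.
    rewrite (bigD1 j) //= mxE eqxx scale1r big1 ?addr0 // => i /negPf ij.
    by rewrite mxE ij scale0r.
  have QE i : 1%:M i j - Q i j = \sum_k L i k * pinvmx L k j.
    have -> : 1%:M i j - Q i j = (1%:M - Q) i j by rewrite !mxE.
    by rewrite subKr mxE.
  rewrite -sumrB; under eq_bigr do rewrite -scalerBl QE scaler_suml.
  rewrite exchange_big /=; apply: eq_bigr => k _.
  rewrite mul_mpolyC scaler_sumr; apply: eq_bigr => i _.
  by rewrite scalerA [L _ _]mxE mulrC.
apply: (ideal_sum _ hI) => k _; apply: (idealMl _ hI).
by apply: gen_ideal_mem; apply: map_f; apply: mem_nth.
Qed.

(* Restriction to a linear subspace lands in a domain. *)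
Lemma nzd_lin_forms (cs : seq 'cV[K]_n) g z :
  (forall c, c \in cs -> z *m c = 0) -> g.@[z ord0] != 0 ->
  nzd (gen_ideal (map lin_form cs)) g.
Proof.
move=> zc gz f /gen_lin_formsP gf; apply/gen_lin_formsP => w wc.
apply/eqP/negPn/negP => fw.
pose M : 'M[K]_(1 + 1, n) := col_mx z w.
have g0 : g \mPo lin_subst M != 0.
  apply: contra gz => /eqP g0.
  have := meval_lin_subst M g (row_mx 1%:M 0 : 'rV_(1 + 1)); rewrite g0 meval0 mul_row_col mul1mx mul0mx addr0.
  by move=> <-.
have f0 : f \mPo lin_subst M != 0.
  apply: contra fw => /eqP f0.
  have := meval_lin_subst M f (row_mx 0 1%:M : 'rV_(1 + 1)); rewrite f0 meval0 mul_row_col mul1mx mul0mx add0r.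
  by move=> <-.
have : (g \mPo lin_subst M) * (f \mPo lin_subst M) = 0; last first.
  by move/eqP; rewrite mulf_eq0 (negPf g0) (negPf f0).
rewrite -rmorphM; apply: (mpoly_fun_eq0 unc) => t; rewrite meval_lin_subst; apply: gf => c cc.
by rewrite -mulmxA mul_col_mx zc // wc // col_mx0 mulmx0.
Qed.

End LinearForms.

(** * Directional derivatives and regular points *)

Section Differentials.
Variables (K : fieldType) (n : nat).
Local Notation P := {mpoly K[n]}.
Implicit Types (f g : P) (x v : 'rV[K]_n).

Definition dd f x v : K := \sum_j (f^`M(j)).@[x ord0] * v ord0 j.

Lemma dd_col f x v : dd f x v = (v *m \col_j (f^`M(j)).@[x ord0]) ord0 ord0.
Proof. by rewrite mxE; apply: eq_bigr => j _; rewrite !mxE mulrC. Qed.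

Lemma ddDr f x v w : dd f x (v + w) = dd f x v + dd f x w.
Proof. by rewrite !dd_col mulmxDl mxE. Qed.

Lemma ddZr f x c v : dd f x (c *: v) = c * dd f x v.
Proof. by rewrite !dd_col -scalemxAl mxE. Qed.

Lemma dd0r f x : dd f x 0 = 0.
Proof. by rewrite dd_col mul0mx mxE. Qed.

Lemma ddBr f x v w : dd f x (v - w) = dd f x v - dd f x w.
Proof. by rewrite !dd_col mulmxBl !mxE. Qed.

Lemma ddDl f g x v : dd (f + g) x v = dd f x v + dd g x v.
Proof.
by rewrite /dd -big_split; apply: eq_bigr => j _ /=; rewrite mderivD mevalD mulrDl.
Qed.

Lemma ddB f g x v : dd (f - g) x v = dd f x v - dd g x v.
Proof.
by rewrite /dd -sumrB; apply: eq_bigr => j _ /=; rewrite mderivB mevalB mulrBl.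
Qed.

Lemma ddM f g x v : dd (f * g) x v = f.@[x ord0] * dd g x v + g.@[x ord0] * dd f x v.
Proof.
rewrite /dd !mulr_sumr -big_split; apply: eq_bigr => j _ /=.
by rewrite mderivM mevalD !mevalM; ring.
Qed.

Lemma ddC c x v : dd c%:MP x v = 0.
Proof. by rewrite /dd big1 // => j _; rewrite mderivC meval0 mul0r. Qed.

Lemma ddX i x v : dd 'X_i x v = v ord0 i.
Proof.
rewrite /dd (bigD1 i) //= big1 ?addr0 => [|j ji]; rewrite mderivX mevalZ mnm1E.
  rewrite eqxx mul1r (_ : (U_(i) - U_(i) = 0)%MM) ?mpolyX0 ?meval1 ?mul1r //.
  by apply/mnmP => k; rewrite mnmBE subnn mnm0E.
by rewrite eq_sym (negPf ji) !mul0r.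
Qed.

Lemma meval_homog d f c x : f \is d.-homog -> f.@[(c *: x) ord0] = c ^+ d * f.@[x ord0].
Proof.
move=> /dhomogP hf; rewrite [f in LHS]mpolyE [f in RHS]mpolyE !meval_sum mulr_sumr.
apply: eq_big_seq => m /hf /= <-; rewrite !mevalZ mulrCA !mevalX; congr (_ * _).
rewrite mdegE -prodrXr -big_split; apply: eq_bigr => i _ /=.
by rewrite mxE exprMn.
Qed.

Lemma euler d f x : f \is d.-homog -> dd f x x = d%:R * f.@[x ord0].
Proof.
move=> /dhomogP hf; rewrite [f in LHS]mpolyE [f in RHS]mpolyE.
rewrite (big_morph (fun f => dd f x x) (fun a b => ddDl a b x x) (_ : dd 0 x x = 0)); last first.
  by rewrite -mpolyC0 ddC.
rewrite meval_sum mulr_sumr; apply: eq_big_seq => m /hf /= <-.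
rewrite -mul_mpolyC ddM mevalC ddC mulr0 addr0 mul_mpolyC mevalZ mulrCA; congr (_ * _).
rewrite mdegE natr_sum mulr_suml; apply: eq_bigr => i _.
rewrite mderivX mevalZ -mulrA; have [->|m0] := posnP (m i); first by rewrite !mul0r.
congr (_ * _); rewrite !mevalX (bigD1 i) //= [RHS](bigD1 i) //=.
rewrite mnmBE mnm1E eqxx -[in RHS](prednK m0) exprSr -mulrA mulrCA mulrC subn1; congr (_ * _).
apply: eq_bigr => j ji.
by rewrite mnmBE mnm1E eq_sym (negPf ji) subn0.
Qed.

End Differentials.

Lemma dd_lin_form (K : closedFieldType) n (c : 'cV[K]_n) (x v : 'rV[K]_n) :
  dd (lin_form c) x v = (v *m c) ord0 ord0.
Proof.
rewrite /lin_form (big_morph (fun f => dd f x v) (fun a b => ddDl a b x v) (_ : dd 0 x v = 0)).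
  by rewrite mxE; apply: eq_bigr => i _; rewrite -mul_mpolyC ddM ddC mulr0 addr0 mevalC ddX mulrC.
by rewrite -mpolyC0 ddC.
Qed.

Section LocalPrime.
Variables (K : closedFieldType) (n : nat) (a : 'rV[K]_n).
Local Notation P := {mpoly K[n]}.
Local Notation loc := (@loc K n (a ord0)).
Implicit Types (I : P -> Prop) (f g y t : P).

Lemma regular_point_prime_seq (I : P -> Prop) (s : seq P) : is_ideal I -> size s = n ->
  (forall f, I f -> f.@[a ord0] = 0) -> (forall y, y \in s -> I y) ->
  (forall v, (forall y, y \in s -> dd y a v = 0) -> v = 0) ->
  (forall f, f.@[a ord0] = 0 -> loc I f) /\ prime_ideal (loc I).
Proof.
move=> hI hs h0 sI hv.
have hdet : \det (\matrix_(i < n, j < n) ((s`_i)^`M(j)).@[a ord0]) != 0.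
  set M := \matrix_(i, j) _.
  rewrite -unitfE -unitmxE -unitmx_tr -row_free_unit -kermx_eq0.
  apply/eqP/row_matrixP => i; rewrite row0; apply: hv => y /(nthP 0)[k ks <-].
  have ks' : (k < n)%N by rewrite -hs.
  have /matrixP /(_ ord0 (Ordinal ks')) := row_mul i (kermx M^T) M^T.
  rewrite mulmx_ker row0 mxE => e; rewrite /dd [RHS]e mxE; apply: eq_bigr => j _.
  by rewrite mulrC [M^T _ _]mxE [M _ _]mxE.
have sI' (i : 'I_n) : I s`_i by apply/sI/mem_nth; rewrite hs.
split; first exact: (loc_maximal hI h0 sI' hdet).
exact: (regular_point_prime hI h0 sI' hdet).
Qed.

(* At a smooth point any local parameter t divides L up to I, so it is regular as soon as L is. *)
Lemma prime_lift_param I t L : is_ideal I -> nzd I L -> loc (add_gen I t) L ->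
  t.@[a ord0] = 0 -> prime_ideal (loc (add_gen I t)) -> prime_ideal (loc I).
Proof.
move=> hI nL [g g0 [b Ib]] t0 pr.
have hl := loc_ideal (a ord0) hI.
apply: (@prime_lift _ _ (a ord0) _ t) => //.
- exact: loc_idem.
- move=> f tf; apply: (nzd_loc nL); apply: loc_idem; exists g => //.
  have -> : g * (L * f) = (g * L - b * t) * f + b * (t * f) by ring.
  apply: (idealD hl); last exact: (idealMl _ hl).
  by apply: sub_loc; apply: (idealMr _ hI).
- move=> u v /(proj2 (loc_add_gen _ _ _ _)) /pr [] h; [left|right];
  exact: (proj1 (loc_add_gen _ _ _ _) h).
Qed.

Lemma prime_lift_gen I y : is_ideal I -> nzd I y -> y.@[a ord0] = 0 ->
  prime_ideal (loc (add_gen I y)) -> prime_ideal (loc I).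
Proof.
move=> hI ny y0 pr; apply: (@prime_lift_param I y y) => //; apply: sub_loc.
by rewrite -[X in add_gen _ _ X]mul1r; apply: add_genr.
Qed.

End LocalPrime.

Lemma frame_completion (K : fieldType) n (x r : 'rV[K]_n.+2) :
  row_free (col_mx x r) -> exists2 G : 'M_n.+2, G \in unitmx &
    row 0 G = x /\ row 1 G = r.
Proof.
move=> xr; pose A : 'M[K]_(2, 2 + n) := pid_mx 2.
pose f : 'M[K]_(2 + n, 2 + n) := col_mx (col_mx x r) 0.
have Af : A *m f = col_mx x r.
  have -> : A = row_mx 1%:M (0 : 'M_(2, n)) by rewrite -pid_mx_row.
  by rewrite /f mul_row_col mul1mx mulmx0 addr0.
have [g ug Ag] : exists2 g : 'M_n.+2, g \in unitmx & A *m f = A *m g.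
  have [|g ? ?] := @complete_unitmx _ _ _ A f; last by exists g.
  by rewrite Af (eqP xr) rank_pid_mx.
have rA (i : 'I_(1 + 1)) (j : 'I_(2 + n)) : i = j :> nat -> row j g = row i (col_mx x r).
  move=> ij; rewrite -Af Ag row_mul (rowE j).
  congr (_ *m _); apply/rowP => k.
  by rewrite !mxE eqxx /= ij -val_eqE /= eq_sym -ij ltn_ord andbT.
exists g => //; split.
  by rewrite (rA (@lshift 1 1 0)) // rowKu row_id.
by rewrite (rA (@rshift 1 1 0)) // rowKd row_id.
Qed.

(** * Hypersurfaces *)

Definition grad (K : fieldType) n (f : {mpoly K[n]}) (x : 'rV[K]_n) : 'rV[K]_n :=
  \row_j (f^`M(j)).@[x ord0].

Lemma dd_grad (K : fieldType) n (f : {mpoly K[n]}) (x v : 'rV[K]_n) :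
  dd f x v = (v *m (grad f x)^T) ord0 ord0.
Proof. by rewrite dd_col; congr (_ _ _); congr (_ *m _); apply/colP => j; rewrite !mxE. Qed.

Lemma mulmx_rc_eq0 (K : fieldType) n (z : 'rV[K]_n) (c : 'cV_n) :
  (z *m c) ord0 ord0 = 0 -> z *m c = 0.
Proof. by move=> h; apply/matrixP => i j; rewrite !ord1 h mxE. Qed.

Lemma row_free_ker (K : fieldType) m n (M : 'M[K]_(m, n)) :
  (forall v : 'rV_m, v *m M = 0 -> v = 0) -> row_free M.
Proof.
move=> h; rewrite -kermx_eq0; apply/eqP/row_matrixP => i; rewrite row0.
by apply: h; rewrite -row_mul mulmx_ker row0.
Qed.

Section DualFrame.
Variables (K : fieldType) (n : nat) (G : 'M[K]_n).
Hypothesis uG : G \in unitmx.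

Lemma dual_frame i j : row i G *m col j (invmx G) = (i == j)%:R%:M.
Proof.
apply/matrixP => k l; rewrite !ord1 mxE [RHS]mxE eqxx mulr1n.
transitivity ((G *m invmx G) i j); last by rewrite mulmxV // mxE.
by rewrite mxE; apply: eq_bigr => m _; rewrite [row _ _ _ _]mxE [col _ _ _ _]mxE.
Qed.

Lemma dual_frame_decomp (v : 'rV_n) :
  v = \sum_i (v *m col i (invmx G)) ord0 ord0 *: row i G.
Proof.
rewrite -[LHS]mulmx1 -(mulVmx uG) mulmxA mulmx_sum_row; apply: eq_bigr => i _.
by congr (_ *: _); rewrite !mxE; apply: eq_bigr => k _; rewrite [col _ _ _ _]mxE.
Qed.

End DualFrame.

Section Quadratic.
Variables (K : fieldType) (n : nat) (q : {mpoly K[n]}).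
Hypothesis hq : q \is 2.-homog.
Implicit Types (z w : 'rV[K]_n).

Lemma quadratic_add z w :
  q.@[(z + w) ord0] = q.@[z ord0] + dd q z w + q.@[w ord0].
Proof.
move/dhomogP: hq => h; pose E (f : {mpoly K[n]}) :=
  f.@[(z + w) ord0] - (f.@[z ord0] + dd f z w + f.@[w ord0]).
have ED : {morph E : f g / f + g}.
  by move=> f g; rewrite /E !mevalD ddDl; ring.
have E0 : E 0 = 0 by rewrite /E !meval0 -mpolyC0 ddC; ring.
suff : E q = 0 by move/eqP; rewrite subr_eq0 => /eqP.
rewrite [q]mpolyE (big_morph _ ED E0) big_seq big1 // => m /h /= md.
have [i [j ->]] : exists i j, m = (U_(i) + U_(j))%MM.
  have : [exists i, m i != 0%N].
    apply: contraT; rewrite negb_exists => /forallP h0.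
    by move: md; rewrite mdegE big1 // => i _; apply/eqP; rewrite -[_ == _]negbK h0.
  case/existsP => i mi; exists i.
  have le : (U_(i) <= m)%MM by rewrite lep1mP.
  have : mdeg (m - U_(i))%MM == 1%N.
    by have := mdegD (m - U_(i))%MM U_(i); rewrite submK // md mdeg1 addn1 => -[<-].
  by case/mdeg1P => j /eqP mj; exists j; rewrite -mj addmC submK.
rewrite /E -mul_mpolyC mpolyXD ddM ddC !mulr0 addr0 ddM !ddX !mevalM !mevalC !mevalXU !mxE.
ring.
Qed.

Lemma quadratic_sym z w : dd q z w = dd q w z.
Proof.
have e := quadratic_add w z; rewrite addrC quadratic_add in e.
apply: (addrI q.@[z ord0]); apply: (addIr q.@[w ord0]); rewrite e; ring.
Qed.

End Quadratic.

Section Regular4.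
Variable K : numClosedFieldType.
Hypothesis unc : uncountable K.
Local Notation P := {mpoly K[4]}.
Implicit Types (f g q : P) (x z v r : 'rV[K]_4) (c : 'cV[K]_4).

Lemma vanish_ideal n (a : 'I_n -> K) : is_ideal (fun f : {mpoly K[n]} => f.@[a] = 0).
Proof.
split=> [|f g f0 g0|h f f0]; first exact: meval0.
  by rewrite mevalD f0 g0 addr0.
by rewrite mevalM f0 mulr0.
Qed.

Lemma independent_points d q x r : (0 < d)%N -> q \is d.-homog -> x != 0 ->
  q.@[x ord0] = 0 -> q.@[r ord0] != 0 -> row_free (col_mx x r).
Proof.
move=> d0 hq x0 qx qr; apply: row_free_ker => v.
rewrite -(hsubmxK v) mul_row_col [lsubmx v]mx11_scalar [rsubmx v]mx11_scalar !mul_scalar_mx.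
set a := _ ord0 ord0; set b := _ ord0 ord0 => e.
have b0 : b = 0.
  apply/eqP/negPn/negP => bn; case/eqP: qr.
  have -> : r = (- (a / b)) *: x.
    apply: (scalerI bn); rewrite scalerA mulrN mulrCA divff // mulr1 scaleNr.
    by apply/eqP; rewrite -addr_eq0 addrC e.
  by rewrite (meval_homog _ _ hq) qx mulr0.
have a0 : a = 0.
  by move/eqP: e; rewrite b0 scale0r addr0 scaler_eq0 (negPf x0) orbF => /eqP.
rewrite a0 b0; apply/matrixP => i j; rewrite !mxE.
by case: splitP => k _; rewrite !ord1 !mxE mul0rn.
Qed.

(** Coordinates adapted to the line through x and r: [c2] and [c3] cut it out, and [c0] takes the
    values 1 at x and 0 at r on it. [e2] and [e3] witness that the forms are independent. *)
Lemma line_frame x r : row_free (col_mx x r) -> exists c0 c2 c3 e2 e3,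
  [/\ (x *m c0 = 1%:M) /\ (r *m c0 = 0), (x *m c2 = 0) /\ (x *m c3 = 0),
      (r *m c2 = 0) /\ (r *m c3 = 0),
      [/\ e2 *m c2 = 1%:M, e3 *m c2 = 0 & e3 *m c3 = 1%:M]
    & forall v, v *m c2 = 0 -> v *m c3 = 0 -> exists b, v = (v *m c0) ord0 ord0 *: x + b *: r].
Proof.
move=> /frame_completion [G uG [Gx Gr]].
pose c i := col i (invmx G).
have E i j := dual_frame uG i j.
exists (c 0), (c 2%:R), (c 3%:R), (row 2%:R G), (row 3%:R G).
have Z : (0 : K)%:M = 0 :> 'M_1 by apply/matrixP => i j; rewrite !mxE mul0rn.
rewrite -Gx -Gr !E /= !Z; split => // v v2 v3.
exists ((v *m c 1) ord0 ord0).
rewrite {1}(dual_frame_decomp uG v) !big_ord_recl big_ord0.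
have l1 : lift (ord0 : 'I_4) (ord0 : 'I_3) = 1 by apply/val_inj.
have l2 : lift (ord0 : 'I_4) (lift (ord0 : 'I_3) (ord0 : 'I_2)) = 2%:R by apply/val_inj.
have l3 : lift (ord0 : 'I_4) (lift (ord0 : 'I_3) (lift (ord0 : 'I_2) (ord0 : 'I_1))) = 3%:R.
  exact/val_inj.
rewrite l1 l2 l3 [v *m col 2%:R _]v2 [v *m col 3%:R _]v3.
by rewrite !(mxE, scale0r, addr0).
Qed.

Lemma nzd_lin_shift (I : P -> Prop) c : is_ideal I -> graded I -> nzd I (lin_form c - 1%:MP).
Proof. by move=> hI gI; apply: nzd_shift => //; [apply: lin_form_homog | apply: oner_neq0]. Qed.

Lemma gen_vanish s x : (forall y : P, y \in s -> y.@[x ord0] = 0) ->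
  forall f, gen_ideal s f -> f.@[x ord0] = 0.
Proof. by move=> h; apply: gen_ideal_min => //; apply: vanish_ideal. Qed.

(* The local ring of a hypersurface at a smooth point is a domain: cut down by the two linear
   forms vanishing on a transversal line through the point, and dehomogenize. *)
Lemma hypersurface_prime d q x v : (0 < d)%N -> q \is d.-homog -> x != 0 ->
  q.@[x ord0] = 0 -> dd q x v != 0 -> prime_ideal (loc (x ord0) (gen_ideal [:: q])).
Proof.
move=> d0 hq x0 qx dqv.
(* The product of q and its differential at x is a nonzero polynomial; r lies off both zero sets, so
   the line through x and r is transversal to the hypersurface at x. *)
have [r qr dqr] : exists2 r : 'rV[K]_4, q.@[r ord0] != 0 & dd q x r != 0.
  apply: contrapT => h.
  have q0 : q != 0 by apply: contra dqv => /eqP ->; rewrite -mpolyC0 ddC.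
  have L0 : lin_form (grad q x)^T != 0.
    by apply: contra dqv => /eqP e; rewrite dd_grad -meval_lin_form e meval0.
  have : q * lin_form (grad q x)^T != 0 by rewrite mulf_neq0.
  case/eqP; apply: (mpoly_fun_eq0 unc) => z; apply/eqP/negPn/negP => h'; apply: h.
  move: h'; rewrite mevalM mulf_eq0 negb_or meval_lin_form -dd_grad => /andP[h1 h2].
  by exists z.
have xr := independent_points d0 hq x0 qx qr.
have [c0 [c2 [c3 [e2 [e3 [[xc0 rc0] [xc2 xc3] [rc2 rc3] [e22 e32 e33] dec]]]]]] := line_frame xr.
have hp : homog_pos q by exists d.
have hpl := @lin_form_homog_pos K 4.
have reg : regular_seq [:: lin_form c3; lin_form c2; q].
  have st : forall y : P, y \in [:: q; lin_form c3; lin_form c2] -> homog_pos y.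
    by move=> z; rewrite !inE => /or3P[] /eqP ->.
  apply: (regular_seq_perm st); first by rewrite perm_sym (perm_rot 1 [:: q; _; _]).
  split; [|split; [|split]] => //.
  - apply: (nzd_lin_forms unc (cs := [:: c3; c2]) (z := r)) => // c.
    by rewrite !inE => /orP[] /eqP ->.
  - apply: (nzd_lin_forms unc (cs := [:: c2]) (z := e3)); last exact: lin_form_neq0.
    by move=> c; rewrite !inE => /eqP ->.
  - by apply: (nzd_lin_forms unc (cs := [::]) (z := e2)); last exact: lin_form_neq0.
have [n3 [n2 _]] := reg.
pose s := [:: lin_form c0 - 1%:MP; lin_form c3; lin_form c2; q].
have hg t := @gen_ideal_ideal P t.
have gr3 : graded (gen_ideal [:: lin_form c3; lin_form c2; q]).
  by apply: gen_ideal_graded => z; rewrite !inE => /or3P[] /eqP ->.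
have n1 := nzd_lin_shift (c := c0) (hg _) gr3.
have y0 : (lin_form c0 - 1%:MP).@[x ord0] = 0.
  by rewrite mevalB meval_lin_form xc0 mxE mevalC subrr.
have s0 y : y \in s -> y.@[x ord0] = 0.
  by rewrite !inE => /or4P[] /eqP -> //; apply: lin_form_eq0.
(* A vector killed by [c0], [c2], [c3] is a multiple of r, on which the differential of q is
   nonzero. *)
have [|_ pr] := @regular_point_prime_seq _ _ x _ s (hg s) (erefl _) (gen_vanish s0) (@gen_ideal_mem _ s).
  move=> w h.
  have w2 : w *m c2 = 0 by apply: mulmx_rc_eq0; rewrite -(dd_lin_form c2 x) h // !inE eqxx !orbT.
  have w3 : w *m c3 = 0 by apply: mulmx_rc_eq0; rewrite -(dd_lin_form c3 x) h // !inE eqxx !orbT.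
  have w0 : (w *m c0) ord0 ord0 = 0.
    by rewrite -(dd_lin_form c0 x) -[LHS]subr0 -[X in _ - X](ddC 1 x w) -ddB h // !inE eqxx.
  have [b we] := dec w w2 w3; rewrite w0 scale0r add0r in we.
  have : dd q x w = 0 by rewrite h // !inE eqxx !orbT.
  by rewrite we ddZr => /eqP; rewrite mulf_eq0 (negPf dqr) orbF => /eqP ->; rewrite scale0r.
apply: (prime_lift_gen (hg _) n2) => //; first exact: lin_form_eq0.
apply: (prime_lift_gen (hg _) n3) => //; first exact: lin_form_eq0.
exact: (prime_lift_gen (hg _) n1).
Qed.

(* f is locally in I at each point of X; then the conductor (I : f) contains a power of the
   regular element l. *)
Lemma radical_of_local_primes (I : P -> Prop) c : is_ideal I -> nzd I (lin_form c) ->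
  (forall x, x != 0 -> (forall g, I g -> g.@[x ord0] = 0) -> prime_ideal (loc (x ord0) I)) ->
  forall f, (forall x, x != 0 -> (forall g, I g -> g.@[x ord0] = 0) -> f.@[x ord0] = 0) -> I f.
Proof.
move=> hI nl pr f hf; set l := lin_form c in nl.
have nz x : l.@[x ord0] != 0 -> x != 0.
  by apply: contra => /eqP ->; apply/eqP/lin_form_eq0; rewrite mul0mx.
(* The factor l keeps the zero away from the origin, about which the hypothesis on f says nothing;
   being regular, it can be cancelled. *)
have [e fe] : exists e, I (f ^+ e).
  apply: contrapT => /forallNP h.
  have [|x Ix lfx] := @nullstellensatz_rV _ _ unc I (l * f) hI.
    by move=> N; rewrite exprMn => /(nzdX nl); apply: h.
  move: lfx; rewrite mevalM mulf_eq0 negb_or => /andP[/nz x0].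
  by rewrite hf ?eqxx.
have loc_f x : x != 0 -> (forall g, I g -> g.@[x ord0] = 0) -> loc (x ord0) I f.
  move=> x0 Ix; have px := pr x x0 Ix; have hl := loc_ideal (x ord0) hI.
  elim: e fe => [|e IHe].
    move=> I1; have /eqP := Ix _ I1; by rewrite expr0 meval1 oner_eq0.
  have : forall e, loc (x ord0) I (f ^+ e) -> loc (x ord0) I f.
    elim=> [|k IHk]; last by rewrite exprS => /px [].
    by rewrite expr0 => h1; rewrite -[f]mulr1; apply: (idealMl _ hl).
  by move=> h /sub_loc /h.
pose Q g := I (g * f).
have hQ : is_ideal Q.
  split; rewrite /Q.
  - by rewrite mul0r; apply: ideal0.
  - by move=> u v hu hv; rewrite mulrDl; apply: idealD.
  - by move=> b u hu; rewrite -mulrA; apply: idealMl.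
have [N lN] : exists N, Q (l ^+ N).
  apply: contrapT => /forallNP h.
  have [x Qx /nz x0] := nullstellensatz_rV unc hQ h.
  have [|g g0 /Qx g0'] := loc_f x x0; last by rewrite g0' eqxx in g0.
  by move=> g Ig; apply: Qx; apply: (idealMr _ hI).
exact: (nzdX (n := N) nl).
Qed.

End Regular4.

(** * Complete intersection curves *)

Section Permutations.
Variables (T : eqType) (a b c d : T).
Lemma perm_bacd : perm_eq [:: a; b; c; d] [:: b; a; c; d].
Proof. by apply/permP => p /=; lia. Qed.
Lemma perm_cdab : perm_eq [:: a; b; c; d] [:: c; d; a; b].
Proof. by apply/permP => p /=; lia. Qed.
End Permutations.

Section Curve.
Variable K : numClosedFieldType.
Hypothesis unc : uncountable K.
Local Notation P := {mpoly K[4]}.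
Local Notation lf := (@lin_form K 4).
Implicit Types (f g : P) (x z v r : 'rV[K]_4) (c : 'cV[K]_4).

Lemma rc_comb (a b : K) z c c' : (z *m (a *: c - b *: c')) ord0 ord0 =
  a * (z *m c) ord0 ord0 - b * (z *m c') ord0 ord0.
Proof.
rewrite mulmxBr -!scalemxAr; set X := z *m c; set Y := z *m c'.
by rewrite !mxE.
Qed.

Variables (Q F : P).
Hypotheses (hQ : Q \is 2.-homog) (hF : F \is 4.-homog) (Q0 : Q != 0).
Hypothesis jac : forall x, x != 0 -> Q.@[x ord0] = 0 -> F.@[x ord0] = 0 ->
  row_free (col_mx (grad Q x) (grad F x)).

Let hpQ : homog_pos Q. Proof. by exists 2%N. Qed.
Let hpF : homog_pos F. Proof. by exists 4%N. Qed.
Let hpl c : homog_pos (lf c). Proof. exact: lin_form_homog_pos. Qed.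
Let hg (s : seq P) : is_ideal (gen_ideal s). Proof. exact: gen_ideal_ideal. Qed.

Let hom2 c c' (s : seq P) : {subset s <= [:: lf c; Q; F; lf c']} ->
  forall y, y \in s -> homog_pos y.
Proof. by move=> h y /h; rewrite !inE => /or4P[] /eqP ->. Qed.

Lemma jac_indep x a b : x != 0 -> Q.@[x ord0] = 0 -> F.@[x ord0] = 0 ->
  a *: grad Q x + b *: grad F x = 0 -> a = 0 /\ b = 0.
Proof.
move=> x0 Qx Fx e; have := jac x0 Qx Fx; rewrite -kermx_eq0 => /eqP k0.
have : row_mx a%:M b%:M *m col_mx (grad Q x) (grad F x) = 0 :> 'rV_4.
  by rewrite mul_row_col !mul_scalar_mx.
move/sub_kermxP; rewrite k0 submx0 => /eqP e'.
have := congr1 (fun M : 'rV_(1 + 1) => lsubmx M ord0 ord0) e'.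
have := congr1 (fun M : 'rV_(1 + 1) => rsubmx M ord0 ord0) e'.
by rewrite row_mxKl row_mxKr !mxE eqxx !mulr1n => -> ->.
Qed.

Lemma jac_dd x : x != 0 -> Q.@[x ord0] = 0 -> F.@[x ord0] = 0 -> exists v, dd Q x v != 0.
Proof.
move=> x0 Qx Fx; apply: contrapT => /forallNP h.
have g0 : grad Q x = 0.
  apply/rowP => j; rewrite [RHS]mxE; have /negP/negPn/eqP := h (delta_mx ord0 j).
  by rewrite dd_grad -rowE mxE [X in X = _]mxE.
have [|/eqP] := @jac_indep x 1 0 x0 Qx Fx; last by rewrite oner_eq0.
by rewrite g0 scaler0 scale0r addr0.
Qed.

Lemma quadric_nonzero : exists r, Q.@[r ord0] != 0.
Proof.
apply: contrapT => /forallNP h; case/eqP: Q0; apply: (mpoly_fun_eq0 unc) => z.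
by apply/eqP/negPn/negP/h.
Qed.

(** Take a nonzero form vanishing at a point off the quadric: Q is then regular modulo this form,
    and the two can be exchanged. *)
Lemma linear_nzd_quadric : exists c, nzd (gen_ideal [:: Q]) (lf c).
Proof.
have [r Qr] := quadric_nonzero.
have [i ri] : exists i, r ord0 i != 0.
  by apply/rV0Pn; apply: contra Qr => /eqP ->; rewrite -(scale0r 0) (meval_homog _ _ hQ) expr0n mul0r.
have [x [c [x1 rc]]] : exists x c, x *m c = 1%:M /\ r *m c = 0.
  pose j : 'I_4 := if i == ord0 then ord_max else ord0.
  have ji : j != i by rewrite /j; case: (i =P ord0) => [->|/eqP]; rewrite // eq_sym.
  exists (delta_mx ord0 j), (delta_mx j ord0 - (r ord0 j / r ord0 i) *: delta_mx i ord0).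
  rewrite !mulmxBr -!scalemxAr !mul_delta_mx_cond (negPf ji) mulr0n scaler0 subr0 eqxx mulr1n.
  split; first by apply/matrixP => k l; rewrite !ord1 !mxE.
  rewrite -!colE; apply/matrixP => k l; rewrite !ord1 !mxE divfK ?subrr //.
exists c.
have reg : regular_seq [:: Q; lf c].
  split; [|split] => //.
    by apply: (nzd_lin_forms unc (cs := [:: c]) (z := r)) => // c'; rewrite inE => /eqP ->.
  by apply: (nzd_lin_forms unc (cs := [::]) (z := x)) => //; exact: lin_form_neq0.
have [] // := @regular_seq_perm _ _ [:: Q; lf c] [:: lf c; Q] _ _ reg.
  by apply: (@hom2 c c) => y; rewrite !inE => /orP[] ->; rewrite ?orbT.
by apply/permP => p /=; lia.
Qed.

(* At a common zero the local ring of the quadric is a domain, and F is nonzero in it because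
   the differentials are independent. *)
Lemma nzd_quartic : nzd (gen_ideal [:: Q]) F.
Proof.
have [c nl] := linear_nzd_quadric.
move=> f Ff; pose J g := gen_ideal [:: Q] (g * f).
have hJ : is_ideal J.
  split; rewrite /J.
  - by rewrite mul0r; apply: (ideal0 (hg _)).
  - by move=> u v hu hv; rewrite mulrDl; apply: (idealD (hg _)).
  - by move=> b u hu; rewrite -mulrA; apply: (idealMl _ (hg _)).
suff [N lN] : exists N, J (lf c ^+ N) by apply: (nzdX (n := N) nl).
apply: contrapT => /forallNP h; have [z Jz lz] := nullstellensatz_rV unc hJ h.
have z0 : z != 0 by apply: contra lz => /eqP ->; apply/eqP/lin_form_eq0; rewrite mul0mx.
have Qz : Q.@[z ord0] = 0.
  by apply: Jz; apply: (idealMr _ (hg _)); apply: gen_ideal_mem; rewrite inE.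
have Fz : F.@[z ord0] = 0 by apply: Jz.
have [v dv] := jac_dd z0 Qz Fz.
have [|[g g0 [a /eqP]]|[g g0 Jg]] :=
    hypersurface_prime unc (isT : 0 < 2)%N hQ z0 Qz dv (f := F) (g := f).
- exact: sub_loc.
- rewrite subr_eq0 => /eqP e.
  have [|_ g0'] := @jac_indep z (- a.@[z ord0]) g.@[z ord0] z0 Qz Fz; last first.
    by rewrite g0' eqxx in g0.
  apply/rowP => j; have := congr1 (fun f => dd f z (delta_mx ord0 j)) e.
  rewrite !ddM Qz Fz !mul0r !addr0 !dd_grad -!rowE !mxE => e'.
  by rewrite e' mulNr addrC subrr.
- by rewrite (Jz g Jg) eqxx in g0.
Qed.

(** The orthogonal reflection in r for the quadratic form Q; the gradient at r supplies the polar
    form. *)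
Definition reflection r : 'M[K]_4 := 1%:M - (Q.@[r ord0])^-1 *: ((grad Q r)^T *m r).

Lemma reflectionE r z : z *m reflection r = z - (dd Q r z / Q.@[r ord0]) *: r.
Proof.
rewrite /reflection mulmxBr mulmx1 -scalemxAr mulmxA; congr (_ - _).
by rewrite [z *m _]mx11_scalar mul_scalar_mx -dd_grad scalerA mulrC.
Qed.

Lemma reflection_quadric r z : Q.@[r ord0] != 0 ->
  Q.@[(z *m reflection r) ord0] = Q.@[z ord0].
Proof.
move=> Qr; rewrite reflectionE -scaleNr quadratic_add // (meval_homog _ _ hQ) ddZr.
rewrite (quadratic_sym hQ z r); set b := dd Q r z; set s := Q.@[r ord0] in Qr *.
rewrite -addrA (_ : - (b / s) * b + (- (b / s)) ^+ 2 * s = 0) ?addr0 //.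
by field.
Qed.

Lemma reflectionK r z : Q.@[r ord0] != 0 -> z *m reflection r *m reflection r = z.
Proof.
move=> Qr; rewrite reflectionE [z *m _]reflectionE ddBr ddZr (euler _ hQ).
set b := dd Q r z; set s := Q.@[r ord0] in Qr *.
rewrite -addrA -opprD -scalerDl (_ : b / s + _ = 0) ?scale0r ?subr0 //.
by field.
Qed.

(* p and its reflection are the two points in which a line through r meets the quadric. *)
Lemma secant_point r : Q.@[r ord0] != 0 -> exists p : 'rV[K]_4,
  [/\ Q.@[p ord0] = 0, F.@[p ord0] != 0 & F.@[(p *m reflection r) ord0] != 0].
Proof.
move=> Qr; pose F' := F \mPo lin_subst (reflection r).
have [|p Qp] := @nullstellensatz_rV _ _ unc (gen_ideal [:: Q]) (F * F') (hg _).
  move=> N; rewrite exprMn => /(nzdX nzd_quartic) [a /eqP].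
  rewrite subr_eq0 => /eqP e.
  (* Here a power of F' lies in (Q). The reflection preserves Q and exchanges F and F', so a power
     of F lies there too, and cancelling it leaves 1 in (Q). *)
  have : gen_ideal [:: Q] (F ^+ N * 1).
    exists (a \mPo lin_subst (reflection r)); apply: (mpoly_fun_eq0 unc) => z.
    rewrite mulr1 mevalB mevalM meval_lin_subst -(reflection_quadric z Qr) -mevalM -e.
    by rewrite !rmorphXn /= meval_lin_subst reflectionK // subrr.
  move=> /(nzdX nzd_quartic) [b /eqP]; rewrite subr_eq0 => /eqP e1.
  have /eqP := congr1 (meval ((0 : 'rV_4) ord0)) e1.
  by rewrite meval1 mevalM -(scale0r (0 : 'rV_4)) (meval_homog _ _ hQ) expr0n mul0r mulr0 oner_eq0.
rewrite mevalM meval_lin_subst mulf_eq0 negb_or => /andP[h1 h2].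
by exists p; split=> //; apply: Qp; apply: gen_ideal_mem; rewrite inE.
Qed.

(** [c2] and [c3] cut out the line through r and p. It meets the quadric only in p and its
    reflection, where F is nonzero, so it misses the curve. The form [c0] serves later to control
    the socle. *)
Lemma transversal_forms : exists c0 c2 c3,
  [/\ regular_seq [:: lf c0; Q; lf c3; lf c2], regular_seq [:: F; Q; lf c3; lf c2]
    & forall x, x *m c2 = 0 -> x *m c3 = 0 -> Q.@[x ord0] = 0 -> F.@[x ord0] = 0 -> x = 0].
Proof.
have [r Qr] := quadric_nonzero.
have [p [Qp Fp Fp']] := secant_point Qr.
have p0 : p != 0.
  by apply: contra Fp => /eqP ->; rewrite -(scale0r 0) (meval_homog _ _ hF) expr0n mul0r.
have pr := independent_points (isT : 0 < 2)%N hQ p0 Qp Qr.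
have [c0 [c2 [c3 [e2 [e3 [[xc0 rc0] [xc2 xc3] [rc2 rc3] [e22 e32 e33] dec]]]]]] := line_frame pr.
have F0 x : x *m c2 = 0 -> x *m c3 = 0 -> Q.@[x ord0] = 0 -> F.@[x ord0] = 0 ->
    (x *m c0) ord0 ord0 = 0.
  move=> x2 x3 Qx Fx; have [b xE] := dec x x2 x3.
  set a := _ ord0 ord0 in xE *; apply/eqP/negPn/negP => a0.
  move: Qx; rewrite xE quadratic_add // !(meval_homog _ _ hQ) Qp mulr0 add0r ddZr.
  rewrite quadratic_sym // ddZr => /eqP.
  have -> : b * (a * dd Q r p) + b ^+ 2 * Q.@[r ord0] = b * (a * dd Q r p + b * Q.@[r ord0]) by ring.
  rewrite mulf_eq0 => /orP[/eqP b0|].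
    move: Fx; rewrite xE b0 scale0r addr0 (meval_homog _ _ hF) => /eqP.
    by rewrite mulf_eq0 expf_eq0 (negPf a0) (negPf Fp).
  rewrite addr_eq0 => /eqP e.
  have xE' : x = a *: (p *m reflection r).
    rewrite xE reflectionE scalerBr scalerA mulrA e mulNr mulfK // scaleNr opprK //.
  move: Fx; rewrite xE' (meval_homog _ _ hF) => /eqP.
  by rewrite mulf_eq0 expf_eq0 (negPf a0) (negPf Fp').
have reg1 : regular_seq [:: Q; lf c0; lf c3; lf c2].
  split; [|split; [|split; [|split]]] => //.
  - apply: (nzd_lin_forms unc (cs := [:: c0; c3; c2]) (z := r)) => // c.
    by rewrite !inE => /or3P[] /eqP ->.
  - apply: (nzd_lin_forms unc (cs := [:: c3; c2]) (z := p)); last exact: lin_form_neq0.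
    by move=> c; rewrite !inE => /orP[] /eqP ->.
  - apply: (nzd_lin_forms unc (cs := [:: c2]) (z := e3)); last exact: lin_form_neq0.
    by move=> c; rewrite !inE => /eqP ->.
  - by apply: (nzd_lin_forms unc (cs := [::]) (z := e2)); last exact: lin_form_neq0.
have reg2 : regular_seq [:: lf c0; Q; lf c3; lf c2].
  apply: (@regular_seq_perm _ _ [:: Q; lf c0; lf c3; lf c2]) => //.
    by move=> y; rewrite !inE => /or4P[] /eqP ->.
  exact: perm_bacd.
exists c0, c2, c3; split; [exact: reg2| |].
  have [n0 [nQ [n3 n2]]] := reg2; split; last by [].
  (* [c0] vanishes at all common zeros, so a power of it lies in the ideal, and F inherits its
     regularity. *)
  have [N hN] : exists N, gen_ideal [:: F; Q; lf c3; lf c2] (lf c0 ^+ N).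
    apply: contrapT => /forallNP h.
    have [z Jz lz] := nullstellensatz_rV unc (hg _) h.
    have J0 y : y \in [:: F; Q; lf c3; lf c2] -> y.@[z ord0] = 0.
      by move=> hy; apply/Jz/gen_ideal_mem.
    case/eqP: lz; rewrite meval_lin_form; apply: F0.
    - by apply: mulmx_rc_eq0; rewrite -meval_lin_form J0 // !inE eqxx !orbT.
    - by apply: mulmx_rc_eq0; rewrite -meval_lin_form J0 // !inE eqxx !orbT.
    - by rewrite J0 // !inE eqxx !orbT.
    - by rewrite J0 // !inE eqxx.
  exact: (nzd_power (hg _) n0 hN).
move=> x x2 x3 Qx Fx; have x0 := F0 x x2 x3 Qx Fx.
have [b xE] := dec x x2 x3; move: Qx; rewrite xE x0 scale0r add0r (meval_homog _ _ hQ) => /eqP.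
by rewrite mulf_eq0 (negPf Qr) orbF expf_eq0 /= => /eqP ->; rewrite scale0r.
Qed.

Let hpFQ c c' y : y \in [:: F; Q; lf c; lf c'] -> homog_pos y.
Proof. by rewrite !inE => /or4P[] /eqP ->. Qed.

Lemma nzd_comb (I : P -> Prop) c c' (a b : K) : is_ideal I -> graded I -> b != 0 ->
  nzd I (lf c) -> nzd (add_gen I (lf c)) (lf c') -> nzd I (lf (a *: c + b *: c')).
Proof.
move=> hI gI b0 nc nc'.
have LE : lf (a *: c + b *: c') = a%:MP * lf c + b%:MP * lf c'.
  rewrite !mul_mpolyC /lin_form !scaler_sumr -big_split; apply: eq_bigr => i _ /=.
  by rewrite !mxE scalerDl !scalerA.
apply: (nzd_swapl hI gI (isT : 0 < 1)%N (lin_form_homog c) (lin_form_homog _) nc).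
have hI' := add_gen_ideal (lf c) hI.
move=> f; rewrite LE => h; apply: nc'.
have -> : lf c' * f = (b^-1)%:MP * ((a%:MP * lf c + b%:MP * lf c') * f - a%:MP * f * lf c).
  have bb : (b^-1)%:MP * b%:MP = 1 :> P by rewrite -mpolyCM mulVf // mpolyC1.
  rewrite -[LHS]mul1r -bb; ring.
by apply: (idealMl _ hI'); apply: (idealB hI') => //; apply: add_genr.
Qed.

(** The local parameter [t] is chosen for its differential, which gives no regularity by itself.
    Regularity comes from a form [L] through x built from the line missing the curve: [t] divides
    [L] locally. *)
Lemma curve_prime x : x != 0 -> Q.@[x ord0] = 0 -> F.@[x ord0] = 0 ->
  prime_ideal (loc (x ord0) (gen_ideal [:: F; Q])).
Proof.
move=> x0 Qx Fx; have [c0 [c2 [c3 [_ reg miss]]]] := transversal_forms.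
set I := gen_ideal [:: F; Q]; have hI : is_ideal I by apply: hg.
have gI : graded I.
  by apply: gen_ideal_graded => y; rewrite !inE => /orP[] /eqP ->.
have perm s : perm_eq [:: F; Q; lf c3; lf c2] s -> regular_seq s.
  by move=> h; apply: (regular_seq_perm (@hpFQ c3 c2) h).
(* [c2] and [c3] do not both vanish at x, as their line misses the curve; the combination vanishing
   at x is still regular. *)
have [L [Lx nL]] : exists c, x *m c = 0 /\ nzd I (lf c).
  pose a := (x *m c3) ord0 ord0; pose b := (x *m c2) ord0 ord0.
  have Ex (c c' : 'cV[K]_4) : x *m ((x *m c) ord0 ord0 *: c' - (x *m c') ord0 ord0 *: c) = 0.
    by apply: mulmx_rc_eq0; rewrite rc_comb mulrC subrr.
  have [b0|b0] := eqVneq b 0.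
    have [a0|a0] := eqVneq a 0.
      by case/eqP: x0; apply: miss => //; apply: mulmx_rc_eq0.
    exists c2; split; first exact: mulmx_rc_eq0.
    by have [_ []] := perm _ (perm_cdab _ _ _ _).
  exists (a *: c2 + (- b) *: c3); split.
    by have := Ex c3 c2; rewrite scaleNr.
  have [n3 [n2 _]] := perm _ (perm_cdab _ _ _ _).
  by apply: (@nzd_comb I c2 c3 a (- b) hI gI _ n2 n3); rewrite oppr_eq0.
have [G uG [Gq Gf]] := frame_completion (jac x0 Qx Fx).
(* The gradients are completed to a basis of linear forms. Both vanish on x by Euler's relation, so
   one of the two added forms does not: [w] is that form normalised at x, and [t] a combination
   vanishing at x. *)
have [t [w [xt xw dec]]] : exists t w : 'cV[K]_4, [/\ x *m t = 0, x *m w = 1%:M &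
   forall v, dd Q x v = 0 -> dd F x v = 0 -> v *m t = 0 -> v *m w = 0 -> v = 0].
  have key v : (forall i, (v *m (row i G)^T) ord0 ord0 = 0) -> v = 0.
    move=> h; have uGT : G^T \in unitmx by rewrite unitmx_tr.
    rewrite -[v]mulmx1 -(mulmxV uGT) mulmxA (_ : v *m G^T = 0) ?mul0mx //.
    apply/rowP => i; rewrite [RHS]mxE -[RHS](h i) !mxE; apply: eq_bigr => j _.
    by rewrite !mxE.
  have key4 v : dd Q x v = 0 -> dd F x v = 0 -> (v *m (row 2%:R G)^T) ord0 ord0 = 0 ->
      (v *m (row 3%:R G)^T) ord0 ord0 = 0 -> v = 0.
    rewrite !dd_grad -Gq -Gf => v0 v1 v2 v3; apply: key; case=> [[|[|[|[|//]]]] ii].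
    - by rewrite -[RHS]v0; congr ((v *m (row _ G)^T) _ _); apply: val_inj.
    - by rewrite -[RHS]v1; congr ((v *m (row _ G)^T) _ _); apply: val_inj.
    - by rewrite -[RHS]v2; congr ((v *m (row _ G)^T) _ _); apply: val_inj.
    - by rewrite -[RHS]v3; congr ((v *m (row _ G)^T) _ _); apply: val_inj.
  set e := (row 2%:R G)^T in key4; set f := (row 3%:R G)^T in key4.
  pose ex := (x *m e) ord0 ord0; pose fx := (x *m f) ord0 ord0.
  have [f0|f0] := eqVneq fx 0.
    have e0 : ex != 0.
      apply: contra x0 => /eqP e0; apply/eqP/key4 => //.
        by rewrite (euler _ hQ) Qx mulr0.
      by rewrite (euler _ hF) Fx mulr0.
    exists f, (ex^-1 *: e); split; first exact: mulmx_rc_eq0.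
      by rewrite -scalemxAr [x *m e]mx11_scalar scale_scalar_mx mulVf.
    move=> v v0 v1 v2; rewrite -scalemxAr => /eqP; rewrite scaler_eq0 invr_eq0 (negPf e0) /=.
    by move=> /eqP v3; apply: key4 => //; rewrite ?v2 ?v3 mxE.
  exists (fx *: e - ex *: f), (fx^-1 *: f); split.
  - by apply: mulmx_rc_eq0; rewrite rc_comb -/ex -/fx mulrC subrr.
  - by rewrite -scalemxAr [x *m f]mx11_scalar scale_scalar_mx mulVf.
  move=> v v0 v1; rewrite mulmxBr -!scalemxAr => v2 /eqP; rewrite scaler_eq0 invr_eq0 (negPf f0) /=.
  move=> /eqP v3; move/eqP: v2; rewrite v3 scaler0 subr0 scaler_eq0 (negPf f0) /= => /eqP v2.
  by apply: key4 => //; rewrite ?v2 ?v3 mxE.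
have n1 : nzd I (lf w - 1%:MP) by apply: nzd_lin_shift.
have nL1 : nzd (add_gen I (lf w - 1%:MP)) (lf L).
  apply: nzd_swapr => //; apply: nzd_lin_shift; first exact: add_gen_ideal.
  by apply: (add_gen_graded hI (lin_form_homog L)).
pose s := [:: lf t; lf w - 1%:MP; F; Q].
have w0 : (lf w - 1%:MP).@[x ord0] = 0.
  by rewrite mevalB meval_lin_form xw mxE mevalC subrr.
have s0 y : y \in s -> y.@[x ord0] = 0.
  by rewrite !inE => /or4P[] /eqP -> //; apply: lin_form_eq0.
have [|mx pr] := @regular_point_prime_seq _ _ x _ s (hg s) (erefl _) (gen_vanish s0) (@gen_ideal_mem _ s).
  move=> v h; apply: dec.
  - by rewrite h // !inE eqxx !orbT.
  - by rewrite h // !inE eqxx !orbT.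
  - by apply: mulmx_rc_eq0; rewrite -(dd_lin_form t x) h // !inE eqxx.
  - apply: mulmx_rc_eq0.
    by rewrite -(dd_lin_form w x) -[LHS]subr0 -[X in _ - X](ddC 1 x v) -ddB h // !inE eqxx orbT.
apply: (prime_lift_gen hI n1) => //.
apply: (@prime_lift_param _ _ x (add_gen I (lf w - 1%:MP)) (lf t) (lf L)) => //.
- exact: add_gen_ideal.
- by apply: mx; apply: lin_form_eq0.
- exact: lin_form_eq0.
Qed.

Lemma curve_radical f : (forall x, x != 0 -> Q.@[x ord0] = 0 -> F.@[x ord0] = 0 -> f.@[x ord0] = 0) ->
  gen_ideal [:: F; Q] f.
Proof.
move=> hf; have [c0 [c2 [c3 [_ reg _]]]] := transversal_forms.
have [n3 [n2 _]] := regular_seq_perm (@hpFQ c3 c2) (perm_cdab _ _ _ _) reg.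
have gens x : (forall g, gen_ideal [:: F; Q] g -> g.@[x ord0] = 0) -> Q.@[x ord0] = 0 /\ F.@[x ord0] = 0.
  by move=> Ix; split; apply/Ix/gen_ideal_mem; rewrite !inE eqxx ?orbT.
apply: (radical_of_local_primes unc (hg _) n2) => x x0 /gens [Qx Fx]; first exact: curve_prime.
exact: hf.
Qed.

End Curve.

(** * Powers of parameters *)

Section PowerParameters.
Variable P : comNzRingType.
Implicit Types (I : P -> Prop) (b f g u v : P).

(** For u, v a regular sequence modulo I, membership of b is the vanishing of the Cech class
    b/(uv)^n in the second local cohomology of P/I. *)
Definition powers_ideal I u v n := add_gen (add_gen I (u ^+ n)) (v ^+ n).

Lemma powers_ideal_ideal I u v n : is_ideal I -> is_ideal (powers_ideal I u v n).
Proof. by move=> hI; do 2!apply: add_gen_ideal. Qed.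

Variables (I : P -> Prop) (u v : P).
Hypotheses (hI : is_ideal I) (nu : nzd I u) (nvu : nzd (add_gen I u) v)
  (nv : nzd I v) (nuv : nzd (add_gen I v) u).
Variable n : nat.
Let J := powers_ideal I u v n.+1.

(** A class killed by u and v can be written f/(uv): it comes from P/(I, u, v). *)
Lemma powers_strip b : J (u * b) -> J (v * b) -> exists f, J (b - f * (u * v) ^+ n).
Proof.
have hIv m := add_gen_ideal (v ^+ m) hI.
have nuV m k : nzd (add_gen I (v ^+ m)) (u ^+ k).
  by apply: nzdX; apply: nzd_add_genX.
move=> /add_genAC [c hc] vb.
have {hc} bc : add_gen I (v ^+ n.+1) (b - c * u ^+ n).
  apply: (nuV _ 1%N); rewrite expr1.
  by rewrite (_ : u * _ = u * b - c * u ^+ n.+1) // exprS; ring.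
have [e he] : add_gen (add_gen I (v ^+ n.+1)) (u ^+ n.+1) (v * (c * u ^+ n)).
  have -> : v * (c * u ^+ n) = v * b - v * (b - c * u ^+ n) by ring.
  apply: (idealB (add_gen_ideal _ (hIv _))); first exact: add_genAC.
  by apply: add_genl; apply: (idealMl _ (hIv _)).
have [f hf] : add_gen I (v ^+ n.+1) (v * c - e * u).
  apply: (nuV _ n).
  by rewrite (_ : _ * _ = v * (c * u ^+ n) - e * u ^+ n.+1) // exprS; ring.
have [h hh] : add_gen I u (c - f * v ^+ n).
  apply: nvu; exists e.
  by rewrite (_ : _ - _ = v * c - e * u - f * v ^+ n.+1) // exprS; ring.
exists f; have -> : b - f * (u * v) ^+ n =
   (b - c * u ^+ n) + (u ^+ n * (c - f * v ^+ n - h * u) + h * u ^+ n.+1).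
  by rewrite exprMn exprS; ring.
have hJ := powers_ideal_ideal u v n.+1 hI.
apply: (idealD hJ); first by apply: add_genAC; apply: add_genl.
apply: (idealD hJ).
  by apply: (idealMl _ hJ); do 2!apply: add_genl.
by apply: add_genl; apply: add_genr.
Qed.

(** The transition map from P/(I, u, v), multiplication by (uv)^n, is injective. *)
Lemma powers_strip_iff g : J (g * (u * v) ^+ n) <-> add_gen (add_gen I u) v g.
Proof.
have hJ := powers_ideal_ideal u v n.+1 hI.
have nuV m k : nzd (add_gen I (v ^+ m)) (u ^+ k).
  by apply: nzdX; apply: nzd_add_genX.
split.
  move=> /add_genAC [a ha].
  have [c hc] : add_gen I (v ^+ n.+1) (g * v ^+ n - a * u).
    apply: (nuV _ n).
    by rewrite (_ : _ * _ = g * (u * v) ^+ n - a * u ^+ n.+1) // exprMn exprS; ring.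
  exists c; apply: (nzdX (n := n) nvu); exists a.
  by rewrite (_ : _ - _ = g * v ^+ n - a * u - c * v ^+ n.+1) // exprS; ring.
move=> [c [a h]]; have -> : g * (u * v) ^+ n =
   (u * v) ^+ n * (g - c * v - a * u) + (c * u ^+ n * v ^+ n.+1 + a * v ^+ n * u ^+ n.+1).
  by rewrite exprMn !exprS; ring.
apply: (idealD hJ); first by apply: (idealMl _ hJ); do 2!apply: add_genl.
apply: (idealD hJ); first by apply: add_genr; apply: add_gen_ideal.
by apply: add_genl; apply: add_genr.
Qed.

Lemma powers_nzd t : nzd (add_gen (add_gen I u) v) t -> nzd J t.
Proof.
move=> nt; apply: nzd_add_genX; first exact: add_gen_ideal.
  exact: nzd_add_genX.
apply: (@nzd_iff _ (add_gen (add_gen I v) (u ^+ n.+1))).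
  by move=> f; split; apply: add_genAC.
apply: nzd_add_genX => //; first exact: add_gen_ideal.
by apply: nzd_iff nt => f; split; apply: add_genAC.
Qed.

End PowerParameters.

(** * Parameters and socles for space, surface and curve *)

Section Packages.
Variable K : numClosedFieldType.
Hypothesis unc : uncountable K.
Local Notation P := {mpoly K[4]}.
Local Notation lf := (@lin_form K 4).
Implicit Types (f g : P) (x z r : 'rV[K]_4) (c : 'cV[K]_4).

Definition on_zeros (I : P -> Prop) x := x != 0 /\ forall g, I g -> g.@[x ord0] = 0.

(* The algebraic input: I is the ideal of its zero set X, the linear forms u, v are a regular
   sequence modulo I, and powers_socle says that H^1 of the line bundles involved injects under
   multiplication by the linear forms. *)
Record good_ideal (I : P -> Prop) (u v : P) := GoodIdeal {
  good_is_ideal : is_ideal I;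
  good_graded : graded I;
  good_radical : forall f, (forall x, on_zeros I x -> f.@[x ord0] = 0) -> I f;
  good_u : exists c, u = lf c;
  good_v : exists c, v = lf c;
  good_nzd_u : nzd I u;
  good_nzd_v : nzd (add_gen I u) v;
  powers_socle : forall n d b, (d <= n.*2)%N -> b \is d.-homog ->
    (forall i, powers_ideal I u v n ('X_i * b)) -> powers_ideal I u v n b }.

Lemma powers_ideal0 (I : P -> Prop) u v b : is_ideal I -> powers_ideal I u v 0 b.
Proof. by move=> hI; exists b; rewrite expr0 mulr1 subrr; apply: (ideal0 (add_gen_ideal _ hI)). Qed.

Lemma lin_form_ideal (J : P -> Prop) c b : is_ideal J -> (forall i, J ('X_i * b)) -> J (lf c * b).
Proof.
move=> hJ h; rewrite mulr_suml; apply: (ideal_sum _ hJ) => i _.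
by rewrite -mul_mpolyC -mulrA; apply: (idealMl _ hJ).
Qed.

(** A third form regular modulo u and v stays regular modulo their powers, so nothing is killed by
    all linear forms, in any degree. This serves space and the surface; the coordinate ring of the
    curve has depth two. *)
Lemma good_of_third_form (I : P -> Prop) c c' c'' : is_ideal I -> graded I ->
  (forall f, (forall x, on_zeros I x -> f.@[x ord0] = 0) -> I f) ->
  nzd I (lf c) -> nzd (add_gen I (lf c)) (lf c') ->
  nzd (add_gen (add_gen I (lf c)) (lf c')) (lf c'') -> good_ideal I (lf c) (lf c').
Proof.
move=> hI gI rad n1 n2 n3; split => //; [by exists c | by exists c' |].
case=> [|n] d b _ _ h; first exact: powers_ideal0.
apply: (powers_nzd hI n1 n2 (nzd_swapr hI n1 n2) n3).
by apply: lin_form_ideal => //; apply: powers_ideal_ideal.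
Qed.

Lemma independent_vector r : r != 0 -> exists x, row_free (col_mx x r).
Proof.
move=> r0; have /rV0Pn[i ri] := r0.
pose j : 'I_4 := if i == ord0 then ord_max else ord0.
have ji : j != i by rewrite /j; case: (i =P ord0) => [->|/eqP]; rewrite // eq_sym.
exists (delta_mx ord0 j); apply: row_free_ker => v.
rewrite -(hsubmxK v) mul_row_col [lsubmx v]mx11_scalar [rsubmx v]mx11_scalar !mul_scalar_mx.
set a := _ ord0 ord0; set b := _ ord0 ord0 => /rowP e.
have b0 : b = 0.
  by have /eqP := e i; rewrite !mxE [i == j]eq_sym (negPf ji) andbF mulr0 add0r mulf_eq0 (negPf ri) orbF => /eqP.
have a0 : a = 0 by have := e j; rewrite b0 !mxE !eqxx mulr1 mul0r addr0.
rewrite a0 b0; apply/matrixP => k l; rewrite !mxE.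
by case: splitP => m _; rewrite !ord1 !mxE mul0rn.
Qed.

(** Three forms cutting out the line of r: any form nonzero at r can then be added to the
    sequence. *)
Lemma forms_through r : r != 0 -> exists c0 c2 c3,
  [/\ r *m c0 = 0, r *m c2 = 0 & r *m c3 = 0] /\ regular_seq [:: lf c0; lf c3; lf c2].
Proof.
move=> /independent_vector [x xr].
have [c0 [c2 [c3 [e2 [e3 [[xc0 rc0] [xc2 xc3] [rc2 rc3] [e22 e32 e33] dec]]]]]] := line_frame xr.
exists c0, c2, c3; split=> //; split; [|split; [|split]] => //.
- apply: (nzd_lin_forms unc (cs := [:: c3; c2]) (z := x)); last exact: lin_form_neq0.
  by move=> c; rewrite !inE => /orP[] /eqP ->.
- apply: (nzd_lin_forms unc (cs := [:: c2]) (z := e3)); last exact: lin_form_neq0.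
  by move=> c; rewrite !inE => /eqP ->.
- by apply: (nzd_lin_forms unc (cs := [::]) (z := e2)); last exact: lin_form_neq0.
Qed.

Let hg (s : seq P) : is_ideal (gen_ideal s). Proof. exact: gen_ideal_ideal. Qed.
Let hpl c : homog_pos (lf c). Proof. exact: lin_form_homog_pos. Qed.

Lemma good_space : exists u v, good_ideal (gen_ideal [::]) u v.
Proof.
have [|c0 [c2 [c3 [_ [n0 [n3 [n2 _]]]]]]] := @forms_through (const_mx 1).
  by apply/eqP => /rowP /(_ ord0) /eqP; rewrite !mxE oner_eq0.
exists (lf c2), (lf c3); apply: (good_of_third_form (hg _) _ _ n2 n3 n0).
  exact: gen_ideal_graded.
move=> f0 hf0; apply: (radical_of_local_primes unc (hg _) n2) => x x0 Ix; last by apply: hf0.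
move=> f g [h h0 /= /eqP]; rewrite !mulf_eq0 => /or3P[] /eqP e.
- by rewrite e meval0 eqxx in h0.
- by left; rewrite e; apply: sub_loc.
- by right; rewrite e; apply: sub_loc.
Qed.

Lemma good_surface F : F \is 4.-homog -> F != 0 ->
  (forall x, x != 0 -> F.@[x ord0] = 0 -> exists v, dd F x v != 0) ->
  exists u v, good_ideal (gen_ideal [:: F]) u v.
Proof.
move=> hF F0 smooth.
have hpF : homog_pos F by exists 4%N.
have [r Fr] : exists r : 'rV[K]_4, F.@[r ord0] != 0.
  apply: contrapT => /forallNP h; case/eqP: F0; apply: (mpoly_fun_eq0 unc) => z.
  by apply/eqP/negPn/negP/h.
have r0 : r != 0.
  by apply: contra Fr => /eqP ->; rewrite -(scale0r 0) (meval_homog _ _ hF) expr0n mul0r.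
have [c0 [c2 [c3 [[r1 r2 r3] reg]]]] := forms_through r0.
have reg1 : regular_seq [:: F; lf c0; lf c3; lf c2].
  split=> //; apply: (nzd_lin_forms unc (cs := [:: c0; c3; c2]) (z := r)) => // c.
  by rewrite !inE => /or3P[] /eqP ->.
have st y : y \in [:: F; lf c0; lf c3; lf c2] -> homog_pos y.
  by rewrite !inE => /or4P[] /eqP ->.
have [n0 [n3 [n2 _]]] : regular_seq [:: lf c0; lf c3; lf c2; F].
  by apply: (regular_seq_perm st) reg1; rewrite perm_sym (perm_rot 3 [:: F; _; _; _]) || rewrite -(perm_rot 1).
exists (lf c2), (lf c3); apply: (good_of_third_form (hg _) _ _ n2 n3 n0).
  by apply: gen_ideal_graded => y; rewrite inE => /eqP ->.
move=> f hf.
have Fin x : (forall g, gen_ideal [:: F] g -> g.@[x ord0] = 0) -> F.@[x ord0] = 0.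
  by move=> h; apply/h/gen_ideal_mem; rewrite inE.
apply: (radical_of_local_primes unc (hg _) n2) => x x0 Ix; last by apply: hf.
have Fx := Fin x Ix; have [v dv] := smooth x x0 Fx.
exact: (hypersurface_prime unc (isT : 0 < 4)%N hF x0 Fx dv).
Qed.

(** P/(F, Q, u, v) is a complete intersection of degrees 4, 2, 1, 1, with socle in degree 4, that
    is, degree 2 for f/(uv). Below it the argument is one of degrees: stripping (uv)^n leaves f' of
    degree at most 2, so [c0] times f' has degree at most 3 < 4; F cannot enter, and [c0] cancels
    modulo (Q, v, u). *)
Lemma good_curve Q F : Q \is 2.-homog -> F \is 4.-homog -> Q != 0 ->
  (forall x, x != 0 -> Q.@[x ord0] = 0 -> F.@[x ord0] = 0 ->
    row_free (col_mx (grad Q x) (grad F x))) ->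
  exists u v, good_ideal (gen_ideal [:: F; Q]) u v.
Proof.
move=> hQ hF Q0 jac.
have [c0 [c2 [c3 [reg0 reg _]]]] := transversal_forms unc hQ hF Q0 jac.
have hpF : homog_pos F by exists 4%N.
have hpQ : homog_pos Q by exists 2%N.
have st y : y \in [:: F; Q; lf c3; lf c2] -> homog_pos y.
  by rewrite !inE => /or4P[] /eqP ->.
have [n3 [n2 _]] := regular_seq_perm st (perm_cdab _ _ _ _) reg.
set I := gen_ideal [:: F; Q] in n3 n2 *.
have hI : is_ideal I by apply: hg.
have gI : graded I by apply: gen_ideal_graded => y; rewrite !inE => /orP[] /eqP ->.
exists (lf c2), (lf c3); split => //; [| by exists c2 | by exists c3 |].
  move=> f hf; apply: (curve_radical unc hQ hF Q0 jac) => x x0 Qx Fx; apply: hf; split=> // g.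
  by apply: gen_vanish => y; rewrite !inE => /orP[] /eqP ->.
case=> [|n] d b dn hb h; first exact: powers_ideal0.
set u := lf c2 in n2 n3 h *; set v := lf c3 in n3 h *.
have m1 : nzd I v := nzd_swapl hI gI (isT : 0 < 1)%N (lin_form_homog c2) (lin_form_homog c3) n2 n3.
have m2 : nzd (add_gen I v) u := nzd_swapr hI n2 n3.
have hJ := powers_ideal_ideal u v n.+1 hI.
have uvh : (u * v) ^+ n \is (2 * n).-homog.
  by apply: dhomogMn; apply: (dhomogM (lin_form_homog c2) (lin_form_homog c3)).
have gJ : graded (powers_ideal I u v n.+1).
  have hh c : lf c ^+ n.+1 \is (1 * n.+1).-homog by apply/dhomogMn/lin_form_homog.
  by apply: (add_gen_graded _ (hh _)); [apply: add_gen_ideal | apply: (add_gen_graded _ (hh _))].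
have hl c := lin_form_ideal c hJ h.
have [f hf] := powers_strip hI n3 m1 m2 (hl c2) (hl c3).
have [//|[dn' [f' hf' hbf]]] := add_gen_hc hJ uvh gJ hb (ex_intro _ f hf).
apply: (ideal_eq hJ _ hbf); apply/(powers_strip_iff hI n3 m1 m2 n).
have iffQ g : add_gen (add_gen I u) v g <-> gen_ideal [:: F; Q; v; u] g.
  apply: (@gen_ideal_eqmem _ [:: v; u; F; Q]) => y; rewrite !inE.
  by case: (y == v); case: (y == u); case: (y == F); case: (y == Q).
have subQ g : gen_ideal [:: Q; v; u] g -> gen_ideal [:: F; Q; v; u] g.
  by apply: gen_ideal_subset => y; rewrite !inE => ->; rewrite orbT.
apply/iffQ/subQ; have [n0 _] := reg0; apply: (n0).
have : gen_ideal [:: F; Q; v; u] (lf c0 * f').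
  apply: (proj1 (iffQ _)); apply: (proj1 (powers_strip_iff hI n3 m1 m2 n _)).
  have -> : lf c0 * f' * (u * v) ^+ n = lf c0 * b - lf c0 * (b - f' * (u * v) ^+ n) by ring.
  by apply: (idealB hJ) => //; apply: (idealMl _ hJ).
have hlf : lf c0 * f' \is (1 + (d - 2 * n)).-homog by apply: dhomogM => //; apply: lin_form_homog.
have gQ : graded (gen_ideal [:: Q; v; u]).
  apply: gen_ideal_graded => y; rewrite !inE => /or3P[] /eqP ->; [exact: hpQ | exact: hpl | exact: hpl].
by move=> /(add_gen_hc (hg _) hF gQ hlf)[//|[dd4 _]]; exfalso; move: dd4 dn; clear; lia.
Qed.

End Packages.

(** * Extension of sections *)

Section Denominators.
Variable K : numClosedFieldType.
Hypothesis unc : uncountable K.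
Local Notation P := {mpoly K[4]}.
Local Notation lf := (@lin_form K 4).
Implicit Types (f g : P) (x z r : 'rV[K]_4) (c : 'cV[K]_4).

(* f is homogeneous of degree d + t - s, and zero when this is negative. *)
Definition shifted_homog s t d f := forall D, (D + s != d + t)%N -> hc D f = 0.

Lemma shifted_homogP s t d f : (s <= d + t)%N -> shifted_homog s t d f ->
  f \is (d + t - s).-homog.
Proof.
move=> st h; have [k dk ->] := hc_partition f (d + t - s).+1.
rewrite (bigD1 (Ordinal dk)) //= big1 ?addr0; first exact: hc_homog.
move=> i ne; apply: h; apply: contra ne => /eqP e; apply/eqP/val_inj => /=; lia.
Qed.

Lemma shifted_homog_eq0 s t f : (t < s)%N -> shifted_homog s t 0 f -> f = 0.
Proof.
move=> st h; have [k _ ->] := hc_partition f 0; rewrite big1 // => i _.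
by apply: h; lia.
Qed.

Variables (I : P -> Prop) (T : finType) (s t : nat).
Hypotheses (hI : is_ideal I) (gI : graded I).
Variable Z : 'rV[K]_4 -> (T -> K) -> Prop.
Hypothesis ZD : forall z M N, Z z M -> Z z N -> Z z (fun i => M i + N i).
Hypothesis ZZ : forall z a M, Z z M -> Z z (fun i => a * M i).
Hypothesis Z0 : forall z, Z z (fun=> 0).
Variable sigma : 'rV[K]_4 -> T -> K.

(** [Z z] is the space of values counted as zero at z: 0 for functions, tangent matrices for normal
    sections. The degree is t - s, kept as a pair because it may be negative. *)
Definition local_section := forall x, on_zeros I x ->
  exists (D d : nat) (f : T -> P) (g : P),
    [/\ forall i, f i \is D.-homog, g \is d.-homog, (D + s = d + t)%N, g.@[x ord0] != 0
      & forall z, on_zeros I z -> g.@[z ord0] != 0 ->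
          Z z (fun i => sigma z i - (f i).@[z ord0] / g.@[z ord0])].

Definition clears d g (F : T -> P) := (forall i, shifted_homog s t d (F i)) /\
  forall z, on_zeros I z -> Z z (fun i => g.@[z ord0] * sigma z i - (F i).@[z ord0]).

(** Asked of every homogeneous component, which makes the denominators an ideal of P to which the
    Nullstellensatz applies. *)
Definition denominator g := forall d, exists F, clears d (hc d g) F.

Lemma clears0 d g : I g -> clears d g (fun=> 0).
Proof.
move=> Ig; split=> [i D _|z [_ /(_ _ Ig) g0]]; first exact: hc0.
by rewrite (_ : (fun i => _) = fun=> 0) //; apply: funext => i; rewrite g0 meval0 mul0r subr0.
Qed.

Lemma clears00 d : clears d 0 (fun=> 0).
Proof. by apply: clears0; apply: ideal0. Qed.

Lemma clearsD d g g' F F' : clears d g F -> clears d g' F' ->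
  clears d (g + g') (fun i => F i + F' i).
Proof.
move=> [h1 h2] [h3 h4]; split=> [i D ne|z hz]; first by rewrite hcD h1 // h3 // addr0.
rewrite (_ : (fun i => _) = (fun i => (g.@[z ord0] * sigma z i - (F i).@[z ord0]) +
  (g'.@[z ord0] * sigma z i - (F' i).@[z ord0]))).
  by apply: ZD; [apply: h2 | apply: h4].
by apply: funext => i; rewrite !mevalD; ring.
Qed.

Lemma clearsM m d p g F : p \is m.-homog -> clears d g F ->
  clears (m + d) (p * g) (fun i => p * F i).
Proof.
move=> hp [h1 h2]; split=> [i D ne|z hz].
  case: (ltnP D m) => Dm; first exact: hcM_lt Dm.
  by rewrite -(subnKC Dm) hcM // h1 ?mulr0 //; lia.
rewrite (_ : (fun i => _) = (fun i => p.@[z ord0] * (g.@[z ord0] * sigma z i - (F i).@[z ord0]))).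
  by apply: ZZ; apply: h2.
by apply: funext => i; rewrite !mevalM; ring.
Qed.

Lemma denominator_ideal : is_ideal denominator.
Proof.
have D0 : denominator 0 by move=> d; exists (fun=> 0); rewrite hc0; apply: clears00.
have DD f g : denominator f -> denominator g -> denominator (f + g).
  move=> hf hg d; have [F hF] := hf d; have [G hG] := hg d.
  by exists (fun i => F i + G i); rewrite hcD; apply: clearsD.
split=> // p g hg; elim/mpolyind: p => [|c m p _ _ IHp]; first by rewrite mul0r.
rewrite mulrDl; apply: (DD) => // d.
have hm : c *: 'X_[m] \is (mdeg m).-homog by apply: rpredZ; rewrite dhomogX.
case: (ltnP d (mdeg m)) => dm.
  by exists (fun=> 0); rewrite (hcM_lt _ hm dm); apply: clears00.
have [F hF] := hg (d - mdeg m)%N; exists (fun i => (c *: 'X_[m]) * F i).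
by rewrite -{1 2}(subnKC dm) hcM //; apply: clearsM.
Qed.

Hypothesis hs : local_section.

Lemma power_denominator c : exists N, forall n, (N <= n)%N -> exists F, clears n (lf c ^+ n) F.
Proof.
have hlc n : lf c ^+ n \is n.-homog by have := dhomogMn n (lin_form_homog c); rewrite mul1n.
have hJ := denominator_ideal.
have [N hN] : exists N, denominator (lf c ^+ N).
  apply: contrapT => /forallNP h; have [x Jx lx] := nullstellensatz_rV unc hJ h.
  have hx : on_zeros I x.
    split; first by apply: contra lx => /eqP ->; apply/eqP/lin_form_eq0; rewrite mul0mx.
    by move=> g Ig; apply: Jx => d; exists (fun=> 0); apply: clears0; apply: gI.
  have [D [d [f [g [hf hg Dd gx hz]]]]] := hs hx.
  (* The square is needed: f/g represents sigma only where g is nonzero, while at the other points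
     g^2 sigma and g f both vanish. *)
  suff /Jx/eqP : denominator (g * g) by rewrite mevalM mulf_eq0 (negPf gx).
  have hgg := dhomogM hg hg.
  move=> e; have [->|ne] := eqVneq e (d + d)%N; last first.
    by exists (fun=> 0); rewrite (hc_ne hgg) 1?eq_sym //; apply: clears00.
  exists (fun i => g * f i); rewrite hc_id //; split.
    by move=> i D' ne; apply: (hc_ne (dhomogM hg (hf i))); move: ne; apply: contra => /eqP <-; lia.
  move=> z zz; have [g0|g0] := eqVneq g.@[z ord0] 0.
    rewrite (_ : (fun i => _) = fun=> 0) //.
    by apply: funext => i; rewrite !mevalM g0 !mul0r subr0.
  rewrite (_ : (fun i => _) = fun i => g.@[z ord0] ^+ 2 * (sigma z i - (f i).@[z ord0] / g.@[z ord0])).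
    by apply: ZZ; apply: hz.
  by apply: funext => i; rewrite !mevalM; field.
exists N => n Nn.
have : denominator (lf c ^+ n) by rewrite -(subnK Nn) exprD; apply: (idealMl _ hJ).
by move=> /(_ n); rewrite hc_id.
Qed.

End Denominators.

(** * Gluing along a regular sequence *)

Section Extension.
Variable K : numClosedFieldType.
Hypothesis unc : uncountable K.
Local Notation P := {mpoly K[4]}.
Local Notation lf := (@lin_form K 4).
Implicit Types (f g : P) (x z r : 'rV[K]_4) (c : 'cV[K]_4).

Variables (I : P -> Prop) (u v : P).
Hypothesis good : good_ideal I u v.

Let hI : is_ideal I := good_is_ideal good.
Let gI : graded I := good_graded good.

Let hu n : u ^+ n \is n.-homog.
Proof.
by have [c ->] := good_u good; have := dhomogMn n (lin_form_homog c); rewrite mul1n.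
Qed.

Let hv n : v ^+ n \is n.-homog.
Proof.
by have [c ->] := good_v good; have := dhomogMn n (lin_form_homog c); rewrite mul1n.
Qed.

Let nvu m n : nzd (add_gen I (u ^+ m)) (v ^+ n).
Proof. apply: nzdX; apply: nzd_add_genX => //; [exact: good_nzd_u good|exact: good_nzd_v good]. Qed.

Let nu n : nzd I (u ^+ n).
Proof. by apply: nzdX; exact: good_nzd_u good. Qed.

Lemma vanish_zeros f z : I f -> on_zeros I z -> f.@[z ord0] = 0.
Proof. by move=> If [_]; apply. Qed.

Lemma zeros_sat n f : (forall z, on_zeros I z -> (u.@[z ord0]) ^+ n * f.@[z ord0] = 0) ->
  forall z, on_zeros I z -> f.@[z ord0] = 0.
Proof.
move=> h z hz; apply: vanish_zeros hz; apply: (nu (n := n)); apply: (good_radical good) => x hx.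
by rewrite mevalM rmorphXn; apply: h.
Qed.

Lemma coordinate_form i : 'X_i = lf (delta_mx i ord0).
Proof.
rewrite /lin_form (bigD1 i) //= big1 ?addr0 => [|j ji]; first by rewrite mxE !eqxx scale1r.
by rewrite mxE (negPf ji) scale0r.
Qed.

(* Glue sections over {u <> 0} and {v <> 0} along a regular sequence. *)
Theorem function_extension s t (h : 'rV[K]_4 -> K) :
  local_section I s t (fun z (M : unit -> K) => M tt = 0) (fun z _ => h z) ->
  exists2 H : P, shifted_homog s t 0 H & forall z, on_zeros I z -> h z = H.@[z ord0].
Proof.
move=> hs.
have den c : exists N, forall n, (N <= n)%N -> exists F, shifted_homog s t n F /\
    forall z, on_zeros I z -> (lf c).@[z ord0] ^+ n * h z = F.@[z ord0].
  have [|||N hN] := @power_denominator _ unc I unit s t hI gI _ _ _ _ _ hs c.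
  - by move=> z M N -> ->; rewrite addr0.
  - by move=> z a M ->; rewrite mulr0.
  - by [].
  exists N => n /hN [F [hF1 hF2]]; exists (F tt); split; first exact: hF1.
  by move=> z /hF2 /eqP; rewrite rmorphXn subr_eq0 => /eqP.
have [[cu ue] [cv ve]] := (good_u good, good_v good).
have [N1 h1] := den cu; have [N2 h2] := den cv.
(* Adding [s] makes the degree n + t - s nonnegative. *)
pose n := (N1 + N2 + s)%N.
have [F [hF1 hF2]] := h1 n ltac:(rewrite /n; lia).
have [G [hG1 hG2]] := h2 n ltac:(rewrite /n; lia).
rewrite -ue in hF2; rewrite -ve in hG2.
(* v^n F and u^n G agree on the zeros, hence modulo I, and regularity makes F divisible by u^n. *)
have [H hH] : add_gen I (u ^+ n) F.
  apply: (nvu (m := n) (n := n)); exists G; apply: (good_radical good) => z hz.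
  by rewrite mevalB !mevalM !rmorphXn /= -hF2 // -hG2 //; ring.
have Fhom : F \is (n + t - s).-homog by apply: shifted_homogP => //; rewrite /n; lia.
pose H' := if (s <= t)%N then hc (t - s) H else 0.
have hH' : I (F - H' * u ^+ n).
  have := gI (n + t - s)%N hH; rewrite hcB hc_id //; congr I; congr (_ - _).
  rewrite /H'; case: leqP => st.
    by rewrite (_ : (n + t - s)%N = ((t - s) + n)%N) ?hcMr //; lia.
  by rewrite mulrC (hcM_lt _ (hu n)) ?mul0r //; lia.
exists H'.
  move=> D; rewrite /H'; case: leqP => st; last by rewrite hc0.
  move=> ne; apply: (hc_ne (hc_homog _ _)).
  by move: ne; apply: contra => /eqP <-; rewrite subnK.
(* The identity u^n h = u^n H' says nothing where u vanishes. A coordinate nonzero at z gives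
   another denominator, and u^n is cancelled from an identity of polynomials on the whole zero
   set. *)
move=> z hz; have [z0 _] := hz; have /rV0Pn[i zi] := z0.
have [N3 h3] := den (delta_mx i ord0); have [L [_ hL]] := h3 N3 (leqnn _).
rewrite -coordinate_form in hL.
have key : forall z, on_zeros I z -> (L - 'X_i ^+ N3 * H').@[z ord0] = 0.
  apply: (@zeros_sat n) => x hx.
  rewrite mevalB mevalM -hL // rmorphXn /=.
  have /eqP := vanish_zeros hH' hx; rewrite mevalB mevalM rmorphXn /= -hF2 // => e.
  rewrite subr_eq0 in e; have {}e := eqP e.
  transitivity (('X_i).@[x ord0] ^+ N3 * (u.@[x ord0] ^+ n * h x - H'.@[x ord0] * u.@[x ord0] ^+ n)); first by ring.
  by rewrite e subrr mulr0.
have /eqP := key z hz; rewrite mevalB mevalM rmorphXn /= -hL // -mulrBr mulf_eq0 expf_eq0 mevalXU (negPf zi) andbF /=.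
by rewrite subr_eq0 => /eqP.
Qed.


(* Matrices of the form z^T w + w^T z, cut out by linear equations in N. *)
Definition sym_tangent z (N : 'I_4 * 'I_4 -> K) :=
  (forall i j, N (i, j) = N (j, i)) /\
  forall i k l, z ord0 i ^+ 2 * N (k, l) + z ord0 k * z ord0 l * N (i, i) -
    z ord0 i * z ord0 l * N (k, i) - z ord0 k * z ord0 i * N (i, l) = 0.

Lemma sym_tangentD z M N : sym_tangent z M -> sym_tangent z N ->
  sym_tangent z (fun i => M i + N i).
Proof.
move=> [h1 h2] [h3 h4]; split=> [i j|i k l]; first by rewrite h1 h3.
by rewrite -[RHS]addr0 -{1}(h2 i k l) -(h4 i k l); ring.
Qed.

Lemma sym_tangentZ z a M : sym_tangent z M -> sym_tangent z (fun i => a * M i).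
Proof.
move=> [h1 h2]; split=> [i j|i k l]; first by rewrite h1.
by rewrite -[RHS](mulr0 a) -(h2 i k l); ring.
Qed.

Lemma sym_tangent0 z : sym_tangent z (fun=> 0).
Proof. by split=> // i k l; rewrite !mulr0 !subr0 addr0. Qed.

Lemma sym_tangentB z M N : sym_tangent z M -> sym_tangent z N ->
  sym_tangent z (fun i => M i - N i).
Proof.
move=> hM hN; rewrite (_ : (fun i => _) = fun i => M i + (-1) * N i).
  by apply: sym_tangentD => //; apply: sym_tangentZ.
by apply: funext => i; rewrite mulN1r.
Qed.

(** w is recovered from N(i, i) = 2 z_i w_i and N(i, j) = z_i w_j + w_i z_j, for any i with z_i
    nonzero. *)
Lemma sym_tangentE z N : z != 0 ->
  sym_tangent z N <-> exists w : 'I_4 -> K, forall k l, N (k, l) = z ord0 k * w l + w k * z ord0 l.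
Proof.
move=> z0; split=> [[h1 h2]|[w hw]]; last first.
  by split=> [i j|i k l]; rewrite !hw; ring.
have /rV0Pn[i zi] := z0.
exists (fun j => (N (i, j) - z ord0 j * N (i, i) / (2 * z ord0 i)) / z ord0 i) => k l.
have e : N (k, l) = (z ord0 i * z ord0 l * N (k, i) + z ord0 k * z ord0 i * N (i, l) -
    z ord0 k * z ord0 l * N (i, i)) / z ord0 i ^+ 2.
  apply: (mulfI (expf_neq0 2 zi)); rewrite mulrC [RHS]mulrC divfK ?expf_neq0 // mulrC.
  by apply/eqP; rewrite -subr_eq0 -(h2 i k l); apply/eqP; ring.
by rewrite e (h1 k i); field; rewrite zi.
Qed.

Lemma sym_tangent_sat n (N : 'I_4 * 'I_4 -> P) :
  (forall z, on_zeros I z -> sym_tangent z (fun i => u.@[z ord0] ^+ n * (N i).@[z ord0])) ->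
  forall z, on_zeros I z -> sym_tangent z (fun i => (N i).@[z ord0]).
Proof.
move=> h z hz; split=> [i j|i k l].
  apply/eqP; rewrite -subr_eq0 -mevalB; apply/eqP.
  apply: (@zeros_sat n) hz => x hx; have [h1 _] := h x hx.
  by rewrite mevalB mulrBr h1 subrr.
pose E : P := 'X_i ^+ 2 * N (k, l) + 'X_k * 'X_l * N (i, i) -
    'X_i * 'X_l * N (k, i) - 'X_k * 'X_i * N (i, l).
have EE x : E.@[x ord0] = x ord0 i ^+ 2 * (N (k, l)).@[x ord0] + x ord0 k * x ord0 l * (N (i, i)).@[x ord0] -
    x ord0 i * x ord0 l * (N (k, i)).@[x ord0] - x ord0 k * x ord0 i * (N (i, l)).@[x ord0].
  by rewrite !(mevalB, mevalD, mevalM, mevalXU, rmorphXn) /= ?mevalXU.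
rewrite -EE; apply: (@zeros_sat n) hz => x hx; have [_ h2] := h x hx.
by rewrite EE -(h2 i k l); ring.
Qed.

(** Each linear form U gives 2 U^2 w as a polynomial expression; those for u and v are glued by
    regularity, and u^2 divides out. *)
Lemma polynomial_tangent d (N : 'I_4 * 'I_4 -> P) :
  (forall i, N i \is d.+1.-homog) ->
  (forall z, on_zeros I z -> sym_tangent z (fun i => (N i).@[z ord0])) ->
  exists2 w : 'I_4 -> P, (forall j, w j \is d.-homog) &
    forall k l, I (N (k, l) - ('X_k * w l + w k * 'X_l)).
Proof.
move=> hN tN.
(* With U and W the values of c on z and w, the row c N is U w + W z and c N c^T is 2 U W, so this
   combination equals 2 U^2 w. *)
pose p (c : 'cV[K]_4) j : P := 2%:R * lf c * (\sum_i (c i ord0)%:MP * N (i, j)) -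
  (\sum_i \sum_j (c i ord0 * c j ord0)%:MP * N (i, j)) * 'X_j.
have pE c z (w : 'I_4 -> K) j :
    (forall k l, (N (k, l)).@[z ord0] = z ord0 k * w l + w k * z ord0 l) ->
    (p c j).@[z ord0] = 2%:R * (lf c).@[z ord0] ^+ 2 * w j.
  move=> hw; rewrite /p mevalB !mevalM mevalXU rmorph_nat.
  set U := (lf c).@[_]; pose W := \sum_i c i ord0 * w i.
  have UE : U = \sum_i c i ord0 * z ord0 i.
    by rewrite /U meval_lin_form mxE; apply: eq_bigr => i _; rewrite mulrC.
  have -> : (\sum_i (c i ord0)%:MP * N (i, j)).@[z ord0] = U * w j + W * z ord0 j.
    rewrite meval_sum UE !mulr_suml -big_split; apply: eq_bigr => i _ /=.
    by rewrite mevalM mevalC hw; ring.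
  have -> : (\sum_i \sum_j (c i ord0 * c j ord0)%:MP * N (i, j)).@[z ord0] = 2%:R * U * W.
    transitivity (U * W + W * U); last by ring.
    rewrite meval_sum {1}UE /W !mulr_suml -big_split; apply: eq_bigr => i _ /=.
    rewrite meval_sum UE !mulr_sumr -big_split; apply: eq_bigr => k _ /=.
    by rewrite mevalM mevalC hw; ring.
  by ring.
have [[cu ue] [cv ve]] := (good_u good, good_v good).
have tw z : on_zeros I z -> exists w : 'I_4 -> K,
    forall k l, (N (k, l)).@[z ord0] = z ord0 k * w l + w k * z ord0 l.
  by move=> hz; apply/(@sym_tangentE z (fun i => (N i).@[z ord0])); [case: hz | apply: tN].
have /choice [b hb] : forall j, exists b, I (p cu j - b * u ^+ 2).
  move=> j; apply: (nvu (m := 2) (n := 2)); exists (p cv j).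
  apply: (good_radical good) => z hz; have [w hw] := tw z hz.
  by rewrite mevalB !mevalM ?rmorphXn /= (pE _ _ w) // (pE _ _ w) // ue ve; ring.
have two : (2%:R : K) != 0 by rewrite pnatr_eq0.
pose w j : P := 2%:R^-1 *: b j.
have hw k l : I (N (k, l) - ('X_k * w l + w k * 'X_l)).
  apply: (nu (n := 2)); apply: (good_radical good) => z hz; have [w' hw'] := tw z hz.
  have be j : (b j).@[z ord0] * u.@[z ord0] ^+ 2 = 2%:R * u.@[z ord0] ^+ 2 * w' j.
    have := vanish_zeros (hb j) hz; rewrite mevalB mevalM rmorphXn /= (pE _ _ w') // -ue.
    by move/eqP; rewrite subr_eq0 => /eqP.
  rewrite mevalM rmorphXn /= mevalB mevalD !mevalM !mevalXU hw' !mevalZ.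
  set U := u.@[z ord0] in be *.
  transitivity (z ord0 k * (U ^+ 2 * w' l - 2%:R^-1 * ((b l).@[z ord0] * U ^+ 2)) +
     z ord0 l * (U ^+ 2 * w' k - 2%:R^-1 * ((b k).@[z ord0] * U ^+ 2))); first by ring.
  by rewrite !be; field.
exists (fun j => hc d (w j)) => [j|k l]; first exact: hc_homog.
have hX i : ('X_i : P) \is 1.-homog by rewrite coordinate_form; apply: lin_form_homog.
have := gI d.+1 (hw k l); rewrite hcB hcD hc_id //.
by rewrite -[X in hc X ('X_k * _)]add1n -[X in hc X (_ * 'X_l)]addn1 hcM // hcMr.
Qed.

Lemma homog0_const f : f \is 0.-homog -> f = (f@_0%MM)%:MP.
Proof.
move=> /dhomogP h; apply/mpolyP => m; rewrite mcoeffC.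
case: (m =P 0%MM) => [->|/eqP ne]; first by rewrite mulr1.
rewrite mulr0; apply: memN_msupp_eq0; apply: contra ne => /h /= /eqP.
by rewrite mdeg_eq0.
Qed.

(* An obstruction w in H^1 with z_i w_j + z_j w_i = 0 is killed by all quadrics: z_i z_k w_j is
   symmetric in (i, k) and antisymmetric in (k, j). *)
Lemma antisymmetric_kill (J : P -> Prop) (w : 'I_4 -> P) : is_ideal J ->
  (forall k l, J ('X_k * w l + w k * 'X_l)) -> forall i k j, J ('X_i * ('X_k * w j)).
Proof.
move=> hJ h i k j.
have two : ((2%:R : K)^-1)%:MP * 2%:R = 1 :> P.
  by rewrite -mpolyC_nat -mpolyCM mulVf ?mpolyC1 // pnatr_eq0.
rewrite -['X_i * _]mul1r -two -mulrA; apply: (idealMl _ hJ).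
have -> : 2%:R * ('X_i * ('X_k * w j)) = 'X_i * ('X_k * w j + w k * 'X_j) -
   'X_j * ('X_i * w k + w i * 'X_k) + 'X_k * ('X_i * w j + w i * 'X_j) by ring.
by apply: (idealD hJ); [apply: (idealB hJ)|]; apply: (idealMl _ hJ).
Qed.

(** The lifts F/u^n and G/v^n differ by the tangent matrix of w/(uv)^n, whose class is the
    obstruction. Once it vanishes, tangent matrices correct F to a multiple m u^n, with m of degree
    2 - 2k. *)
Theorem tangent_section_extension k (sigma : 'rV[K]_4 -> 'I_4 * 'I_4 -> K) : (0 < k)%N ->
  local_section I (2 * k) 2 sym_tangent sigma ->
  (forall z i j, sigma z (i, j) = sigma z (j, i)) ->
  exists m : 'I_4 * 'I_4 -> K, [/\ forall i j, m (i, j) = m (j, i),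
    (1 < k)%N -> forall i, m i = 0
    & forall z, on_zeros I z -> sym_tangent z (fun i => sigma z i - m i)].
Proof.
move=> k0 hs ssym.
have den c : exists N, forall n, (N <= n)%N -> exists F : 'I_4 * 'I_4 -> P,
   (forall i, shifted_homog (2 * k) 2 n (F i)) /\
    forall z, on_zeros I z -> sym_tangent z (fun i => (lf c).@[z ord0] ^+ n * sigma z i - (F i).@[z ord0]).
  have [N hN] := power_denominator unc hI gI sym_tangentD sym_tangentZ sym_tangent0 hs c.
  exists N => n /hN [F [hF1 hF2]]; exists F; split=> // z /hF2.
  by rewrite rmorphXn.
have [[cu ue] [cv ve]] := (good_u good, good_v good).
have [N1 h1] := den cu; have [N2 h2] := den cv.
pose n := (N1 + N2 + 2 * k)%N.
have nk : (2 * k <= n)%N by rewrite /n; lia.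
have [F [hF1 hF2]] := h1 n ltac:(rewrite /n; lia).
have [G [hG1 hG2]] := h2 n ltac:(rewrite /n; lia).
rewrite -ue in hF2; rewrite -ve in hG2.
have Fhom i : F i \is (n + 2 - 2 * k).-homog by apply: shifted_homogP (hF1 i); lia.
have Ghom i : G i \is (n + 2 - 2 * k).-homog by apply: shifted_homogP (hG1 i); lia.
pose e := (n + (n + 1 - 2 * k))%N.
pose N i := v ^+ n * F i - u ^+ n * G i.
have Nhom i : N i \is e.+1.-homog.
  have -> : e.+1 = (n + (n + 2 - 2 * k))%N by rewrite /e; lia.
  by apply: rpredB; apply: dhomogM.
have [|w hw Nw] := polynomial_tangent Nhom.
  move=> z hz.
  rewrite (_ : (fun i => _) = fun i => u.@[z ord0] ^+ n * (v.@[z ord0] ^+ n * sigma z i - (G i).@[z ord0]) -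
     v.@[z ord0] ^+ n * (u.@[z ord0] ^+ n * sigma z i - (F i).@[z ord0])).
    by apply: sym_tangentB; apply: sym_tangentZ; [apply: hG2 | apply: hF2].
  by apply: funext => i; rewrite /N mevalB !mevalM !rmorphXn /=; ring.
set J := powers_ideal I u v n.
have hJ : is_ideal J by apply: powers_ideal_ideal.
have NJ i : J (N i).
  apply: (idealB hJ); first by rewrite mulrC; apply: add_genr; apply: add_gen_ideal.
  by apply: add_genl; rewrite mulrC; apply: add_genr.
have wJ1 a b : J ('X_a * w b + w a * 'X_b).
  rewrite -(subKr (N (a, b)) (_ + _)); apply: (idealB hJ) => //.
  by do 2!apply: add_genl; apply: Nw.
have hX i : ('X_i : P) \is 1.-homog by rewrite coordinate_form; apply: lin_form_homog.
(* The degrees e = 2n + 1 - 2k and e + 1 are at most 2n since k >= 1, so the socle condition applies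
   twice: from quadrics to linear forms, then to w itself. *)
have wJ j : J (w j).
  apply: (powers_socle good _ (hw j)); first by rewrite /e; lia.
  move=> a; apply: (powers_socle good (d := (1 + e)%N)); first by rewrite /e; lia.
    exact: dhomogM.
  by move=> i; apply: antisymmetric_kill.
have /choice [b hb] : forall j, exists b, add_gen I (u ^+ n) (w j - b * v ^+ n).
  by move=> j; have := wJ j.
(* Subtracting v^n times the tangent matrix of b from N leaves a multiple of u^n modulo I; then v^n
   cancels by regularity. *)
have /choice [m hm] : forall i, exists m,
    I (F i - ('X_i.1 * b i.2 + b i.1 * 'X_i.2) - m * u ^+ n).
  move=> [a c] /=.
  have [aa ha] := hb a; have [ac hc'] := hb c.
  apply: (nvu (m := n) (n := n)); exists (G (a, c) + 'X_a * ac + aa * 'X_c).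
  have := idealD hI (Nw a c) (idealD hI (idealMl 'X_a hI hc') (idealMl 'X_c hI ha)).
  by congr I; rewrite /N; ring.
pose m' i : K := if (k == 1)%N then (hc 0 (m i))@_0%MM else 0.
pose b' j := hc (n + 1 - 2 * k) (b j).
have hm' i : I (F i - ('X_i.1 * b' i.2 + b' i.1 * 'X_i.2) - (m' i)%:MP * u ^+ n).
  have := gI (n + 2 - 2 * k)%N (hm i); rewrite !hcB hcD (hc_id (Fhom i)).
  have -> : hc (n + 2 - 2 * k) (m i * u ^+ n) = (m' i)%:MP * u ^+ n.
    rewrite /m'; case: eqP => [k1|k1].
      rewrite (_ : (n + 2 - 2 * k)%N = (0 + n)%N) ?hcMr //; last by lia.
      by congr (_ * _); apply: homog0_const; apply: hc_homog.
    by rewrite mulrC (hcM_lt _ (hu n)) ?mpolyC0 ?mul0r //; lia.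
  have -> : (n + 2 - 2 * k)%N = (1 + (n + 1 - 2 * k))%N by lia.
  by rewrite [b i.1 * _]mulrC !hcM // [b' i.1 * _]mulrC.
have tm z : on_zeros I z -> sym_tangent z (fun i => u.@[z ord0] ^+ n * (sigma z i - m' i)).
  move=> hz; rewrite (_ : (fun i => _) = fun i => (u.@[z ord0] ^+ n * sigma z i - (F i).@[z ord0]) +
     ('X_i.1 * b' i.2 + b' i.1 * 'X_i.2).@[z ord0]).
    apply: sym_tangentD; first exact: hF2.
    case: (hz) => z0 _; apply/(sym_tangentE _ z0); exists (fun j => (b' j).@[z ord0]) => a c /=.
    by rewrite mevalD !mevalM !mevalXU.
  apply: funext => i; have := vanish_zeros (hm' i) hz.
  rewrite !mevalB [(_ * u ^+ n).@[_]]mevalM mevalC rmorphXn /= => /eqP; rewrite subr_eq0 => /eqP h.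
  transitivity (u.@[z ord0] ^+ n * sigma z i - m' i * u.@[z ord0] ^+ n); first by ring.
  by rewrite -h; ring.
(* u^n (sigma - m') is a tangent matrix, hence symmetric, so m' may be averaged with its
   transpose. *)
pose M i := 2%:R^-1 * (m' i + m' (i.2, i.1)).
have tM z : on_zeros I z -> sym_tangent z (fun i => u.@[z ord0] ^+ n * (sigma z i - M i)).
  move=> hz; have tz := tm z hz; have [sz _] := tz; move: tz; congr sym_tangent.
  apply: funext => -[i j]; rewrite /M /=; have := sz i j; rewrite (ssym z j i) !mulrBr => /addrI /oppr_inj e'.
  have two : (2%:R : K) != 0 by rewrite pnatr_eq0.
  congr (_ - _); rewrite mulrCA mulrDr -e'; by field.
exists M; split=> [i j||z hz].
- by rewrite /M addrC.
- by move=> k1 i; rewrite /M /m' !gtn_eqF // addr0 mulr0.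
have [z0 _] := hz; have /rV0Pn[i zi] := z0.
have [N3 h3] := den (delta_mx i ord0); have [L [_ hL]] := h3 N3 (leqnn _).
rewrite -coordinate_form in hL.
have key : forall z, on_zeros I z -> sym_tangent z (fun j => (L j - (M j)%:MP * 'X_i ^+ N3).@[z ord0]).
  apply: (@sym_tangent_sat n) => x hx.
  rewrite (_ : (fun j => _) = fun j => ('X_i).@[x ord0] ^+ N3 * (u.@[x ord0] ^+ n * (sigma x j - M j)) -
     u.@[x ord0] ^+ n * (('X_i).@[x ord0] ^+ N3 * sigma x j - (L j).@[x ord0])).
    by apply: sym_tangentB; apply: sym_tangentZ; [apply: tM | apply: hL].
  by apply: funext => j; rewrite mevalB mevalM mevalC rmorphXn /=; ring.
rewrite (_ : (fun j => _) = fun j => (z ord0 i ^- N3) * ((('X_i).@[z ord0] ^+ N3 * sigma z j - (L j).@[z ord0]) +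
   (L j - (M j)%:MP * 'X_i ^+ N3).@[z ord0])).
  by apply: sym_tangentZ; apply: sym_tangentD; [apply: hL | apply: key].
apply: funext => j; rewrite mevalB mevalM mevalC rmorphXn /= mevalXU.
have zN : z ord0 i ^+ N3 != 0 by rewrite expf_neq0.
by field.
Qed.

End Extension.

(** * The cone over the Veronese threefold *)

Definition pair_of (l : 'I_10) : 'I_4 * 'I_4 :=
  let p := nth (0, 0)%N veronese2_index l in (inord p.1, inord p.2).

Definition index_of (i j : 'I_4) : 'I_10 :=
  inord (index (minn i j, maxn i j) veronese2_index).

Lemma index_ofC i j : index_of i j = index_of j i.
Proof. by rewrite /index_of minnC maxnC. Qed.

Lemma index_pair l : index_of (pair_of l).1 (pair_of l).2 = l.
Proof.
apply: val_inj; rewrite /index_of /pair_of /=.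
by case: l; do 10?[case=> /=; first by move=> _; rewrite !inordK // inordK]; move=> n /=.
Qed.

Lemma pair_index i j : pair_of (index_of i j) = (i, j) \/ pair_of (index_of i j) = (j, i).
Proof.
rewrite /pair_of /index_of inordK; last first.
  by rewrite (leq_trans (n := size veronese2_index)) // index_mem;
    case: i => -[|[|[|[|]]]] // ?; case: j => -[|[|[|[|]]]].
rewrite nth_index; last first.
  by case: i => -[|[|[|[|]]]] // ?; case: j => -[|[|[|[|]]]].
by have [ij|ij] := leqP i j; [left|right]; rewrite !inord_val.
Qed.

Lemma veroneseE (K : fieldType) (z : 'rV[K]_4) l :
  veronese2 z ord0 l = z ord0 (pair_of l).1 * z ord0 (pair_of l).2.
Proof. by rewrite mxE. Qed.

(* Keeps unification from evaluating the index computations. *)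
#[global] Opaque index_of pair_of.

Section ChainRule.
Variable K : fieldType.

Lemma chain_rule m n (t : n.-tuple {mpoly K[m]}) (F : {mpoly K[n]}) (z w : 'rV[K]_m) :
  dd (F \mPo t) z w =
  dd F (\row_l (tnth t l).@[z ord0]) (\row_l dd (tnth t l) z w).
Proof.
set tz := \row_l _; set tw := \row_l dd _ _ _.
have tzE (G : {mpoly K[n]}) : (G \mPo t).@[z ord0] = G.@[tz ord0].
  by rewrite comp_mpoly_meval; apply: meval_eq => l; rewrite mxE.
pose C (G : {mpoly K[n]}) := dd (G \mPo t) z w = dd G tz tw.
have CM G1 G2 : C G1 -> C G2 -> C (G1 * G2).
  by rewrite /C rmorphM /= !ddM !tzE => -> ->.
have CC c : C c%:MP by rewrite /C comp_mpolyC !ddC.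
have C1 : C 1 by rewrite -mpolyC1.
have CX i : C 'X_i.
  by rewrite /C comp_mpolyXU -tnth_nth ddX [RHS]mxE.
elim/mpolyind: F => [|c q p _ _ IHp].
  by rewrite comp_mpoly0 -!mpolyC0 !ddC.
rewrite comp_mpolyD !ddDl IHp; congr (_ + _); rewrite -mul_mpolyC.
apply: (CM) => //; rewrite mpolyXE_id; elim/big_rec: _ => // i q' _ hq; apply: (CM) => //.
by elim: (q i) => // k IHk; rewrite exprS; apply: (CM).
Qed.

Lemma comp_homog m n (t : n.-tuple {mpoly K[m]}) b d (F : {mpoly K[n]}) :
  (forall l, tnth t l \is b.-homog) -> F \is d.-homog -> F \mPo t \is (b * d)%N.-homog.
Proof.
move=> ht /dhomogP hF; rewrite comp_mpolyEX big_seq; apply: rpred_sum => q /hF /= <-.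
apply: rpredZ; rewrite comp_mpolyX mdegE big_distrr /=.
elim/big_rec2: _ => [|i d' p _ hp]; first by rewrite dhomog1.
by apply: dhomogM => //; apply: dhomogMn.
Qed.

Lemma deriv_homog n d (F : {mpoly K[n]}) j : F \is d.+1.-homog -> F^`M(j) \is d.-homog.
Proof.
move=> /dhomogP hF; apply/dhomogP => m; rewrite mcoeff_msupp mcoeff_deriv => h.
have : (m + U_(j))%MM \in msupp F.
  by rewrite mcoeff_msupp; apply: contra h => /eqP ->; rewrite mul0rn.
by move=> /hF /=; rewrite mdegD mdeg1 addn1 => -[].
Qed.

End ChainRule.

Section Veronese.
Variable K : numClosedFieldType.
Hypothesis unc : uncountable K.
Implicit Types (z w : 'rV[K]_4) (x v : 'rV[K]_10).

Definition symm v (p : 'I_4 * 'I_4) : K := v ord0 (index_of p.1 p.2).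
Definition unsym (M : 'I_4 * 'I_4 -> K) : 'rV[K]_10 := \row_l M (pair_of l).

Lemma symm_sym v i j : symm v (i, j) = symm v (j, i).
Proof. by rewrite /symm /= index_ofC. Qed.

Lemma symmK M : (forall i j, M (i, j) = M (j, i)) -> symm (unsym M) = M.
Proof.
move=> h; apply: funext => -[i j]; rewrite /symm mxE /=.
by have [->|->] := pair_index i j.
Qed.

Lemma unsymK v : unsym (symm v) = v.
Proof. by apply/rowP => l; rewrite mxE /symm index_pair. Qed.

Lemma symmD v v' : symm (v + v') = fun p => symm v p + symm v' p.
Proof. by apply: funext => p; rewrite /symm mxE. Qed.

Lemma symmB v v' : symm (v - v') = fun p => symm v p - symm v' p.
Proof. by apply: funext => p; rewrite /symm !mxE. Qed.

Lemma symmZ a v : symm (a *: v) = fun p => a * symm v p.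
Proof. by apply: funext => p; rewrite /symm mxE. Qed.

Lemma symm_veronese z i j : symm (veronese2 z) (i, j) = z ord0 i * z ord0 j.
Proof.
rewrite /symm /= veroneseE; have [-> //|->] := pair_index i j.
by rewrite mulrC.
Qed.

(* The differential of the Veronese map: w |-> z^T w + w^T z. *)
Definition dver z w : 'rV[K]_10 :=
  \row_l (z ord0 (pair_of l).1 * w ord0 (pair_of l).2 + w ord0 (pair_of l).1 * z ord0 (pair_of l).2).

Lemma dver_unsym z w : dver z w = unsym (fun p => z ord0 p.1 * w ord0 p.2 + w ord0 p.1 * z ord0 p.2).
Proof. by apply/rowP => l; rewrite !mxE. Qed.

Lemma symm_dver z w : symm (dver z w) = fun p => z ord0 p.1 * w ord0 p.2 + w ord0 p.1 * z ord0 p.2.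
Proof. by rewrite dver_unsym symmK // => i j /=; ring. Qed.

Definition vpoly : 10.-tuple {mpoly K[4]} :=
  [tuple 'X_(pair_of l).1 * 'X_(pair_of l).2 | l < 10].

Lemma vpoly_homog l : tnth vpoly l \is 2.-homog.
Proof.
rewrite tnth_mktuple !coordinate_form; exact: (dhomogM (lin_form_homog _) (lin_form_homog _)).
Qed.

Lemma meval_vpoly (F : {mpoly K[10]}) z : (F \mPo vpoly).@[z ord0] = F.@[veronese2 z ord0].
Proof.
rewrite comp_mpoly_meval; apply: meval_eq => l.
by rewrite tnth_mktuple mevalM !mevalXU veroneseE.
Qed.

Lemma dd_vpoly (F : {mpoly K[10]}) z w : dd (F \mPo vpoly) z w = dd F (veronese2 z) (dver z w).
Proof.
rewrite chain_rule; congr dd; apply/rowP => l; rewrite !mxE tnth_mktuple.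
  by rewrite mevalM !mevalXU.
by rewrite ddM !ddX !mevalXU; ring.
Qed.

Lemma sym_tangent_dver z v : z != 0 -> sym_tangent z (symm v) <-> exists w, v = dver z w.
Proof.
move=> z0; rewrite sym_tangentE //; split=> [[w hw]|[w ->]].
  exists (\row_i w i); rewrite -[v]unsymK dver_unsym; congr unsym; apply: funext => -[i j].
  by rewrite hw /= !mxE.
by exists (fun i => w ord0 i) => i j; rewrite symm_dver.
Qed.

Lemma veronese_ideal_pullback F : veronese2_ideal K F <-> F \mPo vpoly = 0.
Proof.
split=> [h|h z]; first by apply: (mpoly_fun_eq0 unc) => z; rewrite meval_vpoly h.
by rewrite -meval_vpoly h meval0.
Qed.

(** The 2 by 2 minors of the symmetric matrix; they determine the points and the tangent spaces of
    the cone, which is what the proof needs of the ideal. *)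
Definition minor i j k l : {mpoly K[10]} :=
  'X_(index_of i j) * 'X_(index_of k l) - 'X_(index_of i l) * 'X_(index_of k j).

Lemma meval_minor i j k l x : (minor i j k l).@[x ord0] =
  symm x (i, j) * symm x (k, l) - symm x (i, l) * symm x (k, j).
Proof.
rewrite /minor /symm /=.
move: (index_of i j) (index_of k l) (index_of i l) (index_of k j) => a b c d.
by rewrite mevalB !mevalM !mevalXU.
Qed.

Lemma dd_minor i j k l x v : dd (minor i j k l) x v =
  symm x (i, j) * symm v (k, l) + symm x (k, l) * symm v (i, j) -
  (symm x (i, l) * symm v (k, j) + symm x (k, j) * symm v (i, l)).
Proof.
rewrite /minor /symm /=.
move: (index_of i j) (index_of k l) (index_of i l) (index_of k j) => a b c d.
by rewrite ddB !ddM !ddX !mevalXU.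
Qed.

Lemma minor_ideal i j k l : veronese2_ideal K (minor i j k l).
Proof.
by move=> z; rewrite meval_minor !symm_veronese; ring.
Qed.

Lemma veronese_neq0 z : (veronese2 z != 0) = (z != 0).
Proof.
apply/idP/idP; apply: contra => /eqP.
  by move=> ->; apply/eqP/rowP => l; rewrite veroneseE 3!mxE mul0r.
move=> /rowP e; apply/eqP/rowP => i; rewrite [RHS]mxE.
have := symm_veronese z i i; rewrite /symm e mxE => /esym/eqP.
by rewrite mulf_eq0 orbb => /eqP.
Qed.

(** A nonzero symmetric matrix with vanishing minors has a nonzero diagonal entry; the row of that
    entry divided by its square root is z. *)
Lemma on_cone_veronese x : on_cone (veronese2_ideal K) x <-> exists2 z, z != 0 & x = veronese2 z.
Proof.
split; last first.
  move=> [z z0 ->]; split; first by rewrite veronese_neq0.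
  by move=> F; apply.
move=> [x0 hx].
have hm i j k l : symm x (i, j) * symm x (k, l) = symm x (i, l) * symm x (k, j).
  have := hx _ (minor_ideal i j k l); rewrite meval_minor => /eqP.
  by rewrite subr_eq0 => /eqP.
have [i di] : exists i, symm x (i, i) != 0.
  apply: contrapT => /forallNP h; case/eqP: x0; rewrite -[x]unsymK; apply/rowP => l; rewrite !mxE.
  case: (pair_of l) => a b; apply/eqP.
  have /negP/negPn/eqP ha := h a; have := hm a a b b; rewrite ha mul0r (symm_sym x b a) => /esym/eqP.
  by rewrite mulf_eq0 orbb.
pose s := sqrtC (symm x (i, i)).
have s2 : s ^+ 2 = symm x (i, i) by rewrite sqrtCK.
have s0 : s != 0 by rewrite sqrtC_eq0.
pose z : 'rV[K]_4 := \row_j (symm x (i, j) / s).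
have xz : x = veronese2 z.
  apply/rowP => l; rewrite veroneseE !mxE -[in LHS](unsymK x) mxE.
  case: (pair_of l) => a b /=; have := hm i i a b; rewrite -s2 (symm_sym x a i) => e.
  apply: (mulfI (expf_neq0 2 s0)); rewrite e; by field.
by exists z => //; rewrite -veronese_neq0 -xz.
Qed.

Lemma cone_tangentE N (I : ideal_pred K N) (x v : 'rV[K]_N.+1) :
  cone_tangent I x v <-> forall F, I F -> dd F x v = 0.
Proof. by []. Qed.

Lemma cone_tangent_veronese z v : z != 0 ->
  cone_tangent (veronese2_ideal K) (veronese2 z) v <-> sym_tangent z (symm v).
Proof.
move=> z0; split=> [h|/(sym_tangent_dver _ z0) [w ->] F /veronese_ideal_pullback h]; last first.
  by have := dd_vpoly F z w; rewrite h -mpolyC0 ddC /dd => <-.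
split=> [i j|i k l]; first exact: symm_sym.
have := h _ (minor_ideal i i k l); rewrite -/(dd _ _ _) dd_minor !symm_veronese => <-.
by move: (symm v) => M; ring.
Qed.

Lemma hypersurface_cone N (I : ideal_pred K N) q (x : 'rV_N.+1) : is_ideal I ->
  on_cone (hypersurface_section I q) x <-> on_cone I x /\ q.@[x ord0] = 0.
Proof.
move=> hI; split=> [[x0 h]|[[x0 h] qx]].
  split; [split=> // F IF|]; apply: h.
    by exists F, 0; rewrite mul0r addr0.
  by exists 0, 1; rewrite mul1r add0r; split=> //; apply: ideal0.
by split=> // _ [G [A [IG ->]]]; rewrite mevalD mevalM h // qx mulr0 addr0.
Qed.

Lemma hypersurface_tangent N (I : ideal_pred K N) q (x v : 'rV_N.+1) : is_ideal I -> on_cone I x ->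
  q.@[x ord0] = 0 ->
  cone_tangent (hypersurface_section I q) x v <-> cone_tangent I x v /\ dd q x v = 0.
Proof.
move=> hI [x0 hx] qx; rewrite !cone_tangentE; split=> [h|[h dq]].
  split=> [F IF|]; apply: h.
    by exists F, 0; rewrite mul0r addr0.
  by exists 0, 1; rewrite mul1r add0r; split=> //; apply: ideal0.
by move=> _ [G [A [IG ->]]]; rewrite ddDl ddM h // dq qx mulr0 mul0r !addr0.
Qed.

Lemma linear_cone N M (I : ideal_pred K N) (A : 'M[K]_(M.+1, N.+1)) (y : 'rV_M.+1) : row_free A ->
  on_cone (linear_section I A) y <-> on_cone I (y *m A).
Proof.
move=> fA; have yA : (y *m A != 0) = (y != 0).
  apply/idP/idP; apply: contra => /eqP; first by move=> ->; rewrite mul0mx.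
  by move/(congr1 (mulmx^~ (pinvmx A))); rewrite -mulmxA mulmxVp // mulmx1 mul0mx => ->.
rewrite /on_cone yA; split=> -[y0 h]; split=> //.
  by move=> F IF; rewrite -meval_lin_subst; apply: h; exists F.
by move=> _ [G IG ->]; rewrite meval_lin_subst; apply: h.
Qed.

Lemma linear_tangent N M (I : ideal_pred K N) (A : 'M[K]_(M.+1, N.+1)) (y v : 'rV_M.+1) :
  cone_tangent (linear_section I A) y v <-> cone_tangent I (y *m A) (v *m A).
Proof.
have E G : dd (G \mPo lin_subst A) y v = dd G (y *m A) (v *m A).
  rewrite chain_rule; congr dd; apply/rowP => j; rewrite mxE tnth_mktuple.
    rewrite meval_sum mxE; apply: eq_bigr => i _; by rewrite mevalZ mevalXU mulrC.
  rewrite mxE (big_morph (fun f => dd f y v) (fun a b => ddDl a b y v) (_ : dd 0 y v = 0)).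
    by apply: eq_bigr => i _; rewrite -mul_mpolyC ddM ddC mulr0 addr0 mevalC ddX mulrC.
  by rewrite -mpolyC0 ddC.
rewrite !cone_tangentE; split=> [h F IF|h _ [G IG ->]].
  by rewrite -E; apply: h; exists F.
by have := h G IG; rewrite -E.
Qed.

Lemma veronese_is_ideal : is_ideal (veronese2_ideal K).
Proof.
split=> [z|F G hF hG z|A F hF z]; first by rewrite meval0.
  by rewrite mevalD hF hG addr0.
by rewrite mevalM hF mulr0.
Qed.

Lemma dver_coef (c : 'cV[K]_10) i j :
  (dver (delta_mx ord0 i) (delta_mx ord0 j) *m c) ord0 ord0 = c (index_of i j) ord0 *+ (i == j).+1.
Proof.
pose D := dver (delta_mx ord0 i) (delta_mx ord0 j).
have D1 : D ord0 (index_of i j) = (i == j).+1%:R.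
  have := symm_dver (delta_mx ord0 i) (delta_mx ord0 j) => /(congr1 (fun f => f (i, j))).
  rewrite /symm /= -/D => ->; rewrite !mxE !eqxx /= [j == i]eq_sym.
  by case: eqP => _; rewrite ?mulr1 ?mulr0 ?addr0.
rewrite mxE -/D (bigD1 (index_of i j)) //= big1 ?addr0 => [|l ne].
  by rewrite D1 mulr_natl.
rewrite mxE !mxE !eqxx /=.
have [h1|h1] := boolP (((pair_of l).1 == i) && ((pair_of l).2 == j)).
  by case/negP: ne; case/andP: h1 => /eqP <- /eqP <-; rewrite index_pair.
have [h2|h2] := boolP (((pair_of l).1 == j) && ((pair_of l).2 == i)).
  by case/negP: ne; case/andP: h2 => /eqP <- /eqP <-; rewrite index_ofC index_pair.
rewrite -!natrM !mulnb; rewrite andbC in h2; rewrite (negPf h1).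
by rewrite [(_ == j) && _]andbC (negPf h2) addr0 mul0r.
Qed.

(** The pulled back form is zero, and its derivative at e_i along e_j is the coefficient at (i, j),
    doubled on the diagonal. *)
Lemma veronese_span (c : 'cV[K]_10) : (forall z, veronese2 z *m c = 0) -> c = 0.
Proof.
move=> h; pose f := lin_form c \mPo vpoly.
have f0 : f = 0 by apply: (mpoly_fun_eq0 unc) => z; rewrite meval_vpoly lin_form_eq0.
apply/colP => l; rewrite [RHS]mxE -(index_pair l).
set i := _.1; set j := _.2.
have := dd_vpoly (lin_form c) (delta_mx ord0 i) (delta_mx ord0 j).
rewrite -/f f0 -mpolyC0 ddC dd_lin_form dver_coef => /esym/eqP.
by rewrite -mulr_natr mulf_eq0 pnatr_eq0 orbF => /eqP.
Qed.

Lemma linear_coefs (f : {mpoly K[4]}) z : f \is 1.-homog ->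
  f.@[z ord0] = \sum_i (f^`M(i))@_0%MM * z ord0 i.
Proof.
move=> hf; have := euler z hf; rewrite mul1r => <-; apply: eq_bigr => i _; congr (_ * _).
by rewrite {1}(homog0_const (deriv_homog i hf)) mevalC.
Qed.

(** Euler's relation twice: 2H is the sum of a_ij z_i z_j, with a_ij the second partial
    derivatives. *)
Lemma quadric_lift (H : {mpoly K[4]}) : H \is 2.-homog ->
  exists c : 'cV[K]_10, forall z, H.@[z ord0] = (veronese2 z *m c) ord0 ord0.
Proof.
move=> hH; pose a i j := ((H^`M(i))^`M(j))@_0%MM.
exists (2%:R^-1 *: \sum_i \sum_j a i j *: delta_mx (index_of i j) ord0) => z.
have two : (2%:R : K) != 0 by rewrite pnatr_eq0.
rewrite -scalemxAr [RHS]mxE; apply: (mulfI two); rewrite mulrA divff // mul1r -(euler z hH).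
rewrite mulmx_sumr summxE; apply: eq_bigr => i _.
rewrite mulmx_sumr summxE (linear_coefs z (deriv_homog i hH)) mulr_suml; apply: eq_bigr => j _.
rewrite -scalemxAr [RHS]mxE -colE [col _ _ _ _]mxE -mulrA; congr (_ * _).
by rewrite -(symm_veronese z j i) symm_sym.
Qed.

End Veronese.

(** * Sections of the normal bundle *)

Lemma mulmx_trC (K : fieldType) n (a b : 'rV[K]_n) :
  (a *m b^T) ord0 ord0 = (b *m a^T) ord0 ord0.
Proof. by rewrite !mxE; apply: eq_bigr => i _; rewrite !mxE mulrC. Qed.

Section NormalSections.
Variables (K : numClosedFieldType) (N : nat) (I : ideal_pred K N) (k n : nat).
Local Notation V := 'rV[K]_N.+1.
Variable Rel : V -> V -> 'rV[K]_n -> Prop.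
Hypothesis RelD : forall y a v v' c c', Rel y v c -> Rel y v' c' ->
  Rel y (a *: v + v') (a *: c + c').
Hypothesis Rel0 : forall y v, on_cone I y -> Rel y v 0 <-> cone_tangent I y v.

Lemma RelB y v v' c c' : Rel y v c -> Rel y v' c' -> Rel y (v - v') (c - c').
Proof.
by move=> h h'; rewrite [v - _]addrC [c - _]addrC -(scaleN1r v') -(scaleN1r c'); apply: RelD.
Qed.

(** [Rel y v c] reads: at y, the vector v represents the section with parameters c. Values chosen
    arbitrarily at each point differ from the local lifts by tangent vectors, so the choice is
    regular. *)
Lemma section_of_local_lifts c :
  (forall x, on_cone I x -> exists (m e : nat) (f : 'I_N.+1 -> {mpoly K[N.+1]}) (g : {mpoly K[N.+1]}),
    [/\ forall j, f j \is m.-homog, g \is e.-homog, (m + k = e + 1)%N, g.@[x ord0] != 0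
      & forall y, on_cone I y -> g.@[y ord0] != 0 ->
          Rel y (\row_j ((f j).@[y ord0] / g.@[y ord0])) c]) ->
  exists2 s, normal_section I k s & forall y, on_cone I y -> Rel y (s y) c.
Proof.
move=> h; have /choice [s hs] : forall y, exists v, on_cone I y -> Rel y v c.
  move=> y; have [hy|] := pselect (on_cone I y); last by exists 0.
  have [m [e [f [g [_ _ _ g0 hg]]]]] := h y hy.
  by eexists => _; apply: hg.
exists s => // x hx; have [m [e [f [g [hf hg mk g0 hR]]]]] := h x hx.
exists m, e, f, g; split=> // y hy gy; apply/(Rel0 _ hy).
by rewrite -(subrr c); apply: RelB; [apply: hs | apply: hR].
Qed.

Lemma h0_normal_of_rel :
  (forall i, exists2 s, normal_section I k s &
     forall y, on_cone I y -> Rel y (s y) (delta_mx ord0 i)) ->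
  (forall c, (forall y, on_cone I y -> Rel y 0 c) -> c = 0) ->
  (forall t, normal_section I k t -> exists c, forall y, on_cone I y -> Rel y (t y) c) ->
  h0_normal I k n.
Proof.
move=> hs inj surj; have /choice [s hs'] : forall i, exists s, normal_section I k s /\
     forall y, on_cone I y -> Rel y (s y) (delta_mx ord0 i).
  by move=> i; have [s h1 h2] := hs i; exists s.
have Rsum (c : 'I_n -> K) y : on_cone I y -> Rel y (\sum_i c i *: s i y) (\row_i c i).
  move=> hy; have -> : \row_i c i = \sum_i c i *: delta_mx ord0 i :> 'rV_n.
    by rewrite [LHS]row_sum_delta; apply: eq_bigr => i _; rewrite mxE.
  elim/big_rec2: _ => [|i v w _ h]; first by apply/Rel0 => // F _; rewrite big1 // => j _; rewrite mxE mulr0.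
  by apply: RelD => //; have [_ h2] := hs' i; apply: h2.
exists s; split.
- by move=> i; have [] := hs' i.
- move=> c hc i.
  suff /rowP /(_ i) : \row_i c i = 0 by rewrite !mxE.
  apply: inj => y hy; have := hc y hy => /(Rel0 _ hy); rewrite subr0 => h0.
  rewrite -(subrr (\sum_(i < n) c i *: s i y)) -[X in Rel _ _ X]subr0.
  by apply: RelB => //; apply: Rsum.
- move=> t /surj [c hc]; exists (fun i => c ord0 i) => y hy; apply/(Rel0 _ hy).
  have := RelB (hc y hy) (Rsum (fun i => c ord0 i) y hy).
  by rewrite (_ : c - _ = 0) //; apply/rowP => i; rewrite !mxE subrr.
Qed.

End NormalSections.

(** * Common treatment of the three varieties, pulled back to P^3 *)

Section Pullback.
Variable K : numClosedFieldType.
Hypothesis unc : uncountable K.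
Local Notation P := {mpoly K[4]}.
Implicit Types (z w : 'rV[K]_4) (m : 'rV[K]_10).

Variables (N : nat) (I : ideal_pred K N) (B : 'M[K]_(N.+1, 10)) (q : {mpoly K[10]}).
Variables (J : P -> Prop) (u0 v0 : P).
Local Notation V := 'rV[K]_N.+1.
Implicit Types (x y v : V).

Hypotheses (good : good_ideal J u0 v0) (J1 : ~ J 1) (hq : q \is 2.-homog) (fB : row_free B).

(** [B] embeds the ambient space of X in P^9 and is the identity except for the curve; q is 0 for
    the threefold. On the image of [B] the pseudo-inverse is a true inverse. *)
Definition ypos z : V := veronese2 z *m pinvmx B.

Hypothesis yposK : forall z, on_zeros J z -> ypos z *m B = veronese2 z.
Hypothesis coneE : forall y, on_cone I y <-> exists2 z, on_zeros J z & y *m B = veronese2 z.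
Hypothesis tanE : forall z y v, on_zeros J z -> y *m B = veronese2 z ->
  cone_tangent I y v <-> sym_tangent z (symm (v *m B)) /\ dd q (veronese2 z) (v *m B) = 0.

Lemma yposE z y : y *m B = veronese2 z -> ypos z = y.
Proof. by move=> h; rewrite /ypos -h -mulmxA mulmxVp // mulmx1. Qed.

Lemma ypos_cone z : on_zeros J z -> on_cone I (ypos z).
Proof. by move=> hz; apply/coneE; exists z; rewrite ?yposK. Qed.

Definition ypoly : N.+1.-tuple P := [tuple \sum_l pinvmx B l i *: tnth (vpoly K) l | i < N.+1].

Lemma ypoly_homog i : tnth ypoly i \is 2.-homog.
Proof.
by rewrite tnth_mktuple; apply: rpred_sum => l _; apply: rpredZ; apply: vpoly_homog.
Qed.

Lemma meval_ypoly f z : (f \mPo ypoly).@[z ord0] = f.@[ypos z ord0].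
Proof.
rewrite comp_mpoly_meval; apply: meval_eq => i.
rewrite tnth_mktuple meval_sum mxE; apply: eq_bigr => l _.
by rewrite mevalZ tnth_mktuple mevalM !mevalXU veroneseE mulrC.
Qed.

Lemma zeros_nonempty : exists z, on_zeros J z.
Proof.
apply: contrapT => /forallNP h; apply: J1; apply: (good_radical good) => x hx.
by have := h x.
Qed.

(** If m = z^T w + w^T z at all zeros, then w is a regular function of degree -1, hence 0 by
    extension. *)
Lemma constant_tangent m : (forall z, on_zeros J z -> sym_tangent z (symm m)) -> m = 0.
Proof.
move=> h.
have /choice [w hw] : forall z, exists w : 'I_4 -> K, on_zeros J z ->
    forall a b, symm m (a, b) = z ord0 a * w b + w a * z ord0 b.
  move=> z; have [hz|] := pselect (on_zeros J z); last by exists (fun=> 0).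
  have [z0 _] := hz; have /(sym_tangentE _ z0) [w hw] := h z hz; by exists w.
have w0 z j : on_zeros J z -> w z j = 0.
  move=> hz; have [|H hH hw0] := @function_extension _ unc _ _ _ good 1 0 (fun z => w z j); last first.
    by rewrite hw0 // (shifted_homog_eq0 _ hH) // meval0.
  move=> x hx; have [x0 _] := hx; have /rV0Pn[i xi] := x0.
    (* From m_ii = 2 z_i w_i and m_ij = z_i w_j + w_i z_j, the numerator equals 2 z_i^2 w_j. *)
    exists 1%N, 2%N, (fun=> (2%:R * symm m (i, j)) *: 'X_i - symm m (i, i) *: 'X_j),
      (2%:R *: ('X_i * 'X_i)).
    have hX a : ('X_a : P) \is 1.-homog by rewrite coordinate_form; apply: lin_form_homog.
    have two : (2%:R : K) != 0 by rewrite pnatr_eq0.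
    split => //.
    - by move=> _; apply: rpredB; apply: rpredZ; apply: hX.
    - by apply: rpredZ; apply: (dhomogM (hX i) (hX i)).
    - by rewrite mevalZ mevalM mevalXU !mulf_neq0.
    move=> y hy; rewrite mevalZ mevalM mevalXU !mulf_eq0 (negPf two) /= orbb => yi.
    rewrite mevalB !mevalZ !mevalXU !(hw y hy); field.
    by rewrite yi.
have [z hz] := zeros_nonempty.
rewrite -[m]unsymK; apply/rowP => l; rewrite !mxE; case: (pair_of l) => a b.
by rewrite (hw z hz) !w0 // mulr0 mul0r addr0.
Qed.

Section Analysis.
Variables (k : nat) (t : V -> V).
Hypotheses (k0 : (0 < k)%N) (ht : normal_section I k t).

(** The coordinates of [ypos] are quadrics, so pulling back doubles degrees. The derivative dq(t -
    m) is a well-defined function because t is determined up to vectors tangent to X, on which dq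
    vanishes. *)
Lemma section_analysis : exists m (H : P), [/\ (1 < k)%N -> m = 0, shifted_homog (2 * k) 4 0 H
  & forall z y, on_zeros J z -> y *m B = veronese2 z ->
      sym_tangent z (symm (t y *m B - m)) /\ dd q (veronese2 z) (t y *m B - m) = H.@[z ord0]].
Proof.
pose sigma z := symm (t (ypos z) *m B).
have loc z : on_zeros J z -> exists (d e : nat) (f : 'I_N.+1 -> P) (g : P),
    [/\ forall i, f i \is (2 * d).-homog, g \is (2 * e).-homog, (d + k = e + 1)%N, g.@[z ord0] != 0
      & forall x : 'rV[K]_4, on_zeros J x -> g.@[x ord0] != 0 ->
        sym_tangent x (symm ((t (ypos x) - \row_i ((f i).@[x ord0] / g.@[x ord0])) *m B)) /\
        dd q (veronese2 x) ((t (ypos x) - \row_i ((f i).@[x ord0] / g.@[x ord0])) *m B) = 0].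
  move=> hz; have [d [e [f [g [hf hg de gz hfg]]]]] := ht (ypos_cone hz).
  exists d, e, (fun i => f i \mPo ypoly), (g \mPo ypoly); split=> //.
  - by move=> i; apply: comp_homog => //; apply: ypoly_homog.
  - by apply: comp_homog => //; apply: ypoly_homog.
  - by rewrite meval_ypoly.
  move=> x hx; rewrite meval_ypoly => gx; apply/(tanE _ hx (yposK hx)).
  have := hfg _ (ypos_cone hx) gx; congr cone_tangent; congr (_ - _).
  by apply/rowP => i; rewrite !mxE meval_ypoly.
have [||M [Msym M0 hM]] := @tangent_section_extension _ unc _ _ _ good k sigma k0.
- move=> z hz; have [d [e [f [g [hf hg de gz hfg]]]]] := loc z hz.
  exists (2 * d)%N, (2 * e)%N, (fun p => \sum_i B i (index_of p.1 p.2) *: f i), g; split=> //.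
  + by move=> p; apply: rpred_sum => i _; apply: rpredZ; apply: hf.
  + lia.
  move=> x hx gx; have [h _] := hfg x hx gx; move: h; congr sym_tangent.
  rewrite mulmxBl symmB; apply: funext => p; congr (_ - _).
  rewrite /symm mxE meval_sum mulr_suml; apply: eq_bigr => i _.
  by rewrite mxE mevalZ; ring.
- by move=> z i j; apply: symm_sym.
pose m := unsym M.
have mM : symm m = M by apply: symmK.
have m0 : (1 < k)%N -> m = 0.
  by move=> k1; apply/rowP => l; rewrite !mxE M0.
pose h z := dd q (veronese2 z) (t (ypos z) *m B - m).
have [|H hH hE] := @function_extension _ unc _ _ _ good (2 * k) 4 h; last first.
  exists m, H; split=> // z y hz yz; split; last first.
    by rewrite -hE // /h (yposE yz).
  by rewrite symmB mM; have := hM z hz; rewrite /sigma (yposE yz).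
move=> z hz; have [d [e [f [g [hf hg de gz hfg]]]]] := loc z hz.
(* The derivative of q along f - g m, to be divided by g. It is homogeneous because m = 0 unless k =
   1, and then d = e. *)
pose num : P := \sum_l (q^`M(l) \mPo vpoly K) * (\sum_i B i l *: f i - m ord0 l *: g).
have dq l : q^`M(l) \mPo vpoly K \is 2.-homog.
  by have := comp_homog (@vpoly_homog K) (deriv_homog l hq); rewrite muln1.
exists (2 + 2 * d)%N, (2 * e)%N, (fun=> num), g; split=> //.
- move=> _; apply: rpred_sum => l _; apply: dhomogM => //; apply: rpredB.
    by apply: rpred_sum => i _; apply: rpredZ; apply: hf.
  have [k1|k1] := leqP k 1; last by rewrite m0 // mxE scale0r rpred0.
  by apply: rpredZ; rewrite (_ : d = e) //; lia.
- lia.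
move=> x hx gx; have [_] := hfg x hx gx; rewrite mulmxBl ddBr => /eqP; rewrite subr_eq0 => /eqP e1.
rewrite /h ddBr e1 -ddBr; apply/eqP; rewrite subr_eq0; apply/eqP.
rewrite /num meval_sum mulr_suml; apply: eq_bigr => l _.
rewrite mevalM meval_vpoly -mulrA; congr (_ * _).
rewrite !mxE mevalB mevalZ meval_sum mulrBl mulfK //; congr (_ - _).
rewrite mulr_suml; apply: eq_bigr => i _; by rewrite mxE mevalZ; ring.
Qed.

End Analysis.

Section Count.
Variables (k n : nat) (mu : 'M[K]_(n, 10)) (E : 'rV[K]_4 -> 'cV[K]_n).
Hypothesis k0 : (0 < k)%N.

(** The parameters c encode the pair (m, H): m is [c *m mu], and H(z) is c paired with [E z]. *)
Definition lifts y v (c : 'rV[K]_n) := forall z, on_zeros J z -> y *m B = veronese2 z ->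
  sym_tangent z (symm (v *m B - c *m mu)) /\
  dd q (veronese2 z) (v *m B - c *m mu) = (c *m E z) ord0 ord0.

Lemma liftsD y a v v' c c' : lifts y v c -> lifts y v' c' -> lifts y (a *: v + v') (a *: c + c').
Proof.
move=> h h' z hz yz; have [h1 h2] := h z hz yz; have [h1' h2'] := h' z hz yz.
have e : (a *: v + v') *m B - (a *: c + c') *m mu =
    a *: (v *m B - c *m mu) + (v' *m B - c' *m mu).
  by rewrite !mulmxDl -!scalemxAl scalerBr opprD addrACA.
rewrite e ddDr ddZr h2 h2' symmD symmZ; split.
  by apply: sym_tangentD => //; apply: sym_tangentZ.
by rewrite mulmxDl -scalemxAl [RHS]mxE; congr (_ + _); rewrite [RHS]mxE.
Qed.

Lemma lifts0 y v : on_cone I y -> lifts y v 0 <-> cone_tangent I y v.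
Proof.
move=> /coneE [z hz yz]; rewrite (tanE v hz yz); split=> [/(_ z hz yz)|h z' hz' yz'].
  by rewrite !mul0mx subr0 mxE.
have := proj1 (tanE v hz' yz') (proj2 (tanE v hz yz) h).
by rewrite !mul0mx subr0 mxE.
Qed.

(** For the threefold q = 0, so dq is zero and H vanishes on the zeros; hence the premise on q in
    the last hypothesis. *)
Lemma h0_normal_count :
  (forall i, exists2 s, normal_section I k s &
     forall y, on_cone I y -> lifts y (s y) (delta_mx ord0 i)) ->
  (forall c : 'rV_n, c *m mu = 0 -> (forall z, on_zeros J z -> (c *m E z) ord0 ord0 = 0) -> c = 0) ->
  (forall m (H : P), ((1 < k)%N -> m = 0) -> shifted_homog (2 * k) 4 0 H ->
    (q = 0 -> forall z, on_zeros J z -> H.@[z ord0] = 0) ->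
    exists2 c : 'rV_n, c *m mu = m & forall z, on_zeros J z -> (c *m E z) ord0 ord0 = H.@[z ord0]) ->
  h0_normal I k n.
Proof.
move=> ex inj surj; apply: (h0_normal_of_rel liftsD lifts0) => // [c hc|t /(section_analysis k0)].
  have c0 : c *m mu = 0.
    apply: constant_tangent => z hz; have [h _] := hc _ (ypos_cone hz) z hz (yposK hz).
    move: h; rewrite mul0mx sub0r -scaleN1r symmZ => /(sym_tangentZ (-1)).
    by congr sym_tangent; apply: funext => p; rewrite mulrA mulrNN !mul1r.
  apply: inj => // z hz; have [_] := hc _ (ypos_cone hz) z hz (yposK hz).
  by rewrite mul0mx c0 subr0 dd0r => ->.
move=> [m [H [m0 hH hmH]]].
have [|c cm cE] := surj m H m0 hH.
  move=> q0 z hz; have [_ <-] := hmH z _ hz (yposK hz).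
  by rewrite q0 -mpolyC0 ddC.
exists c => y /coneE [z0 hz0 yz0] z hz yz.
by rewrite cm cE //; apply: hmH.
Qed.

End Count.

(** * Counting the pairs (m, H) in each twist *)

Section Counts.
Hypothesis vanish_span : forall c : 'cV_10,
  (forall z, on_zeros J z -> veronese2 z *m c = 0) -> B *m c = 0.
(* The two families of vector fields provide local sections with prescribed dq-component and
   prescribed constant component, respectively. *)
Hypothesis transversal_field : forall x, on_cone I x ->
  exists d (tau : 'I_N.+1 -> {mpoly K[N.+1]}) (delta : {mpoly K[N.+1]}),
  [/\ forall j, tau j \is d.-homog, delta \is d.+1.-homog, delta.@[x ord0] != 0
    & forall z y, on_zeros J z -> y *m B = veronese2 z ->
      sym_tangent z (symm ((\row_j (tau j).@[y ord0]) *m B)) /\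
      dd q (veronese2 z) ((\row_j (tau j).@[y ord0]) *m B) = delta.@[y ord0]].
Hypothesis constant_field : forall x m, on_cone I x ->
  exists d (rho : 'I_N.+1 -> {mpoly K[N.+1]}) (g : {mpoly K[N.+1]}),
  [/\ forall j, rho j \is d.-homog, g \is d.-homog, g.@[x ord0] != 0
    & forall z y, on_zeros J z -> y *m B = veronese2 z ->
      sym_tangent z (symm ((\row_j (rho j).@[y ord0]) *m B - g.@[y ord0] *: m)) /\
      dd q (veronese2 z) ((\row_j (rho j).@[y ord0]) *m B - g.@[y ord0] *: m) = 0].

(** The field tau/delta is tangent to the threefold and has q-derivative 1; multiplied by eps it
    realises m = 0 and H = eps. *)
Lemma transversal_section k n (mu : 'M[K]_(n, 10)) (E : 'rV[K]_4 -> 'cV[K]_n) (c : 'rV[K]_n) d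
    (eps : {mpoly K[N.+1]}) : (d + k = 2)%N -> eps \is d.-homog -> c *m mu = 0 ->
  (forall z, on_zeros J z -> (c *m E z) ord0 ord0 = eps.@[ypos z ord0]) ->
  exists2 s, normal_section I k s & forall y, on_cone I y -> lifts mu E y (s y) c.
Proof.
move=> dk heps cmu cE.
apply: (section_of_local_lifts (@liftsD n mu E) (@lifts0 n mu E)) => x hx.
have [e [tau [delta [htau hdelta dx hf]]]] := transversal_field hx.
exists (d + e)%N, e.+1, (fun j => eps * tau j), delta; split=> //.
- by move=> j; apply: dhomogM.
- lia.
move=> y hy dy z hz yz; have [h1 h2] := hf z y hz yz.
rewrite (_ : \row_j _ = (eps.@[y ord0] / delta.@[y ord0]) *: \row_j (tau j).@[y ord0]); last first.
  by apply/rowP => j; rewrite !mxE mevalM; ring.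
rewrite cmu subr0 -scalemxAl symmZ ddZr h2 cE // (yposE yz) divfK //; split=> //.
exact: sym_tangentZ.
Qed.

Lemma constant_section n (mu : 'M[K]_(n, 10)) (E : 'rV[K]_4 -> 'cV[K]_n) (c : 'rV[K]_n) :
  (forall z, on_zeros J z -> (c *m E z) ord0 ord0 = 0) ->
  exists2 s, normal_section I 1 s & forall y, on_cone I y -> lifts mu E y (s y) c.
Proof.
move=> cE.
apply: (section_of_local_lifts (@liftsD n mu E) (@lifts0 n mu E)) => x hx.
have [e [rho [g [hrho hg gx hf]]]] := constant_field (c *m mu) hx.
exists e, e, rho, g; split=> // y hy gy z hz yz; have [h1 h2] := hf z y hz yz.
rewrite (_ : _ - _ = g.@[y ord0]^-1 *: ((\row_j (rho j).@[y ord0]) *m B - g.@[y ord0] *: (c *m mu))).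
  by rewrite symmZ ddZr h2 mulr0 cE //; split=> //; apply: sym_tangentZ.
rewrite scalerBr scalerA mulVf // scale1r scalemxAl; congr (_ *m _ - _).
by apply/rowP => j; rewrite !mxE mulrC.
Qed.

(** Ten parameters for m, and N + 1 linear forms on P^N for H: every quadric on W is linear on Sym^2
    W. *)
Theorem h0_normal_twist1 : h0_normal I 1 (10 + N.+1).
Proof.
apply: (@h0_normal_count 1 (10 + N.+1) (col_mx 1%:M 0) (fun z => col_mx 0 (ypos z)^T)) => //.
- move=> i; case: (split_ordP i) => j ->.
    apply: constant_section => z hz.
    by rewrite delta_mx_lshift mul_row_col mulmx0 mul0mx addr0 mxE.
  apply: (@transversal_section _ _ _ _ _ 1 'X_j) => //.
  + by rewrite dhomogX; apply/eqP/mdeg1.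
  + by rewrite delta_mx_rshift mul_row_col mulmx0 mul0mx addr0.
  move=> z hz; rewrite delta_mx_rshift mul_row_col mulmx0 add0r -rowE [LHS]mxE [LHS]mxE mevalXU.
  by [].
- move=> c; rewrite -(hsubmxK c) mul_row_col mulmx1 mulmx0 addr0 => -> h.
  suff -> : rsubmx c = 0 by rewrite row_mx0.
  have /vanish_span e : forall z, on_zeros J z -> veronese2 z *m (pinvmx B *m (rsubmx c)^T) = 0.
    move=> z hz; rewrite mulmxA; apply: mulmx_rc_eq0; have := h z hz.
    by rewrite mul_row_col mulmx0 add0r mulmx_trC.
  by apply: trmx_inj; rewrite trmx0 -e mulmxA mulmxVp // mul1mx.
move=> m H _ hH _; have hH2 : H \is 2.-homog by apply: (shifted_homogP (s := 2) (t := 4) (d := 0)).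
have [c hc] := quadric_lift hH2.
exists (row_mx m (B *m c)^T).
  by rewrite mul_row_col mulmx1 mulmx0 addr0.
move=> z hz; rewrite mul_row_col mulmx0 add0r hc -trmx_mul [LHS]mxE mulmxA yposK //.
Qed.

Theorem h0_normal_twist2 : h0_normal I 2 1.
Proof.
apply: (@h0_normal_count 2 1 0 (fun _ => 1%:M)) => //.
- move=> i; apply: (@transversal_section _ _ _ _ _ 0 1) => //.
  + exact: dhomog1.
  + by rewrite mulmx0.
  by move=> z hz; rewrite mulmx1 !ord1 mxE !eqxx meval1.
- move=> c _ h; have [z hz] := zeros_nonempty; have := h z hz.
  by rewrite mulmx1 => h0; apply/rowP => i; rewrite ord1 h0 mxE.
move=> m H m0 hH _; exists (H@_0%MM)%:M; first by rewrite m0 // mulmx0.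
have hH0 : H \is 0.-homog by apply: (shifted_homogP (s := 4) (t := 4) (d := 0)).
by move=> z _; rewrite mulmx1 mxE eqxx mulr1n {2}(homog0_const hH0) mevalC.
Qed.

Theorem h0_normal_twist_ge3 k : (3 <= k)%N -> h0_normal I k 0.
Proof.
move=> k3; apply: (@h0_normal_count k 0 0 (fun _ => 0)) => //.
- by lia.
- by case.
- by move=> c _ _; apply/rowP => -[].
move=> m H m0 hH _; exists 0; first by rewrite mul0mx m0 //; lia.
by move=> z hz; rewrite mul0mx mxE (shifted_homog_eq0 _ hH) ?meval0 //; lia.
Qed.

End Counts.

End Pullback.

(** * The Veronese threefold and its hypersurface sections *)

Section Geometry.
Variable K : numClosedFieldType.
Hypothesis unc : uncountable K.
Local Notation P := {mpoly K[4]}.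
Local Notation Y := (veronese2_ideal K).
Implicit Types (z w : 'rV[K]_4) (m : 'rV[K]_10).

Lemma on_zeros_gen (s : seq P) z :
  on_zeros (gen_ideal s) z <-> z != 0 /\ forall f, f \in s -> f.@[z ord0] = 0.
Proof.
split=> -[z0 h]; split=> //; first by move=> f fs; apply: h; apply: gen_ideal_mem.
exact: gen_vanish.
Qed.

Lemma gen_ideal_proper (s : seq P) : (forall f, f \in s -> homog_pos f) -> ~ gen_ideal s 1.
Proof.
move=> h h1; have /eqP : (1 : P).@[(0 : 'rV[K]_4) ord0] = 0.
  apply: (gen_vanish _ h1) => f /h [d d0 hf].
  by rewrite -(scale0r (0 : 'rV_4)) (meval_homog _ _ hf) expr0n eqn0Ngt d0 mul0r.
by rewrite meval1 oner_eq0.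
Qed.

Lemma sym_tangent_symm0 z : sym_tangent z (symm (0 : 'rV[K]_10)).
Proof.
by have := @sym_tangent0 K z; congr sym_tangent; apply: funext => p; rewrite /symm mxE.
Qed.

Lemma pinv1K (n : nat) (v : 'rV[K]_n) : v *m pinvmx 1%:M *m 1%:M = v.
Proof. by rewrite mulmxKpV ?submx1. Qed.

Lemma row_free1 n : row_free (1%:M : 'M[K]_n).
Proof. by rewrite row_free_unit unitmx1. Qed.

Section Space.

Let J : P -> Prop := gen_ideal [::].

Let yposK z : on_zeros J z -> ypos (1%:M : 'M[K]_(9.+1, 10)) z *m 1%:M = veronese2 z.
Proof. by move=> _; apply: pinv1K. Qed.

Let coneE (y : 'rV[K]_9.+1) : on_cone Y y <->
  exists2 z, on_zeros J z & y *m (1%:M : 'M[K]_(9.+1, 10)) = veronese2 z.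
Proof.
rewrite on_cone_veronese; split=> [[z z0 ->]|[z [z0 _]]].
  by exists z; rewrite ?mulmx1 //; apply/on_zeros_gen.
by rewrite mulmx1 => ->; exists z.
Qed.

Let tanE z (y v : 'rV[K]_9.+1) : on_zeros J z ->
  y *m (1%:M : 'M[K]_(9.+1, 10)) = veronese2 z ->
  cone_tangent Y y v <-> sym_tangent z (symm (v *m (1%:M : 'M[K]_(9.+1, 10)))) /\
    dd 0 (veronese2 z) (v *m (1%:M : 'M[K]_(9.+1, 10))) = 0.
Proof.
move=> [z0 _]; rewrite !mulmx1 => ->; rewrite (cone_tangent_veronese unc v z0).
by rewrite -mpolyC0 ddC; split=> [|[]].
Qed.

Let J1 : ~ J 1. Proof. exact: gen_ideal_proper. Qed.

Lemma h0_veronese1 : h0_normal Y 1 10.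
Proof.
have [u [v good]] := good_space unc.
have ct m (y : 'rV[K]_9.+1) : on_cone Y y ->
  exists d (rho : 'I_10 -> {mpoly K[10]}) (g : {mpoly K[10]}),
  [/\ forall j, rho j \is d.-homog, g \is d.-homog, g.@[y ord0] != 0
    & forall z (y : 'rV[K]_9.+1), on_zeros J z -> y *m (1%:M : 'M[K]_(9.+1, 10)) = veronese2 z ->
      sym_tangent z (symm ((\row_j (rho j).@[y ord0]) *m 1%:M - g.@[y ord0] *: m)) /\
      dd 0 (veronese2 z) ((\row_j (rho j).@[y ord0]) *m 1%:M - g.@[y ord0] *: m) = 0].
  move=> _; exists 0%N, (fun j => (m ord0 j)%:MP), 1; split.
  - by move=> j; rewrite -alg_mpolyC; apply: rpredZ; apply: dhomog1.
  - exact: dhomog1.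
  - by rewrite meval1 oner_neq0.
  move=> z x _ _; rewrite -mpolyC0 ddC meval1 scale1r mulmx1 (_ : _ - _ = 0).
    by split=> //; apply: sym_tangent_symm0.
  by apply/rowP => j; rewrite !mxE mevalC subrr.
apply: (@h0_normal_count _ unc _ _ _ 0 _ _ _ good J1 (rpred0 _) (row_free1 _) yposK coneE tanE
  1 10 1%:M (fun=> 0)) => //.
- move=> i; apply: (constant_section coneE tanE (fun x m => @ct m x)) => z _.
  by rewrite mulmx0 mxE.
- by move=> c; rewrite mulmx1.
move=> m H _ hH h; exists m; first by rewrite mulmx1.
by move=> z hz; rewrite mulmx0 mxE h.
Qed.

Lemma h0_veronese_ge2 k : (2 <= k)%N -> h0_normal Y k 0.
Proof.
move=> k2; have [u [v good]] := good_space unc.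
apply: (@h0_normal_count _ unc _ _ _ 0 _ _ _ good J1 (rpred0 _) (row_free1 _) yposK coneE tanE
  k 0 0 (fun=> 0)) => //.
- by lia.
- by case.
- by move=> c _ _; apply/rowP => -[].
move=> m H m0 hH h; exists 0; first by rewrite mul0mx m0.
by move=> z hz; rewrite mul0mx mxE h.
Qed.

End Space.

(** N - d independent differentials vanish on the tangent space of the cone, whose dimension is thus
    at most d + 1. This is how smoothness enters the proof. *)
Lemma smooth_rank N (I : ideal_pred K N) d x r (M : 'M[K]_(r, N.+1)) :
  smooth_of_dim I d -> on_cone I x -> row_free M ->
  (forall i, cone_tangent I x (row i M)) -> (r + (N - d) <= N.+1)%N.
Proof.
move=> [_ sm] hx fM tM; have [F [hF fF _]] := sm x hx.
set D := \matrix_(i, j) _ in fF.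
have MD : M *m D^T = 0.
  apply/row_matrixP => i; rewrite row0 row_mul; apply/rowP => j.
  have [IF _] := hF j; rewrite !mxE -[RHS](tM i _ IF); apply: eq_bigr => l _.
  by rewrite [D^T _ _]mxE [D _ _]mxE mulrC.
have := mulmx0_rank_max MD.
by rewrite mxrank_tr (eqP fM) (eqP fF).
Qed.

Definition dver_mx z : 'M[K]_(4, 10) := \matrix_(i, l) dver z (delta_mx ord0 i) ord0 l.

Lemma mul_dver_mx z w : w *m dver_mx z = dver z w.
Proof.
apply/rowP => l; rewrite !mxE; set a := _.1; set b := _.2.
rewrite [in RHS](row_sum_delta w) !summxE !mulr_sumr mulr_suml -big_split; apply: eq_bigr => i _.
by rewrite /= !mxE -/a -/b; ring.
Qed.

Lemma dver_eq0 z w : z != 0 -> dver z w = 0 -> w = 0.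
Proof.
move=> /rV0Pn[i zi] e; have two : (2%:R : K) != 0 by rewrite pnatr_eq0.
have h j : z ord0 i * w ord0 j + w ord0 i * z ord0 j = 0.
  by have := congr1 (fun f => f (i, j)) (symm_dver z w); rewrite e /symm mxE => <-.
have wi : w ord0 i = 0.
  have /eqP := h i; rewrite [w _ _ * _]mulrC -mulr2n -mulr_natl !mulf_eq0 (negPf two) (negPf zi) /=.
  by move/eqP.
apply/rowP => j; have /eqP := h j; rewrite wi mul0r addr0 mulf_eq0 (negPf zi) [RHS]mxE.
by move/eqP.
Qed.

Lemma row_free_dver_mx z : z != 0 -> row_free (dver_mx z).
Proof. by move=> z0; apply: row_free_ker => w; rewrite mul_dver_mx; apply: dver_eq0. Qed.

(** * Vector fields tangent to the Veronese threefold *)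

Section Fields.
Variables (N : nat) (B : 'M[K]_(N.+1, 10)) (q : {mpoly K[10]}).
Hypothesis hq : q \is 2.-homog.
Local Notation V := 'rV[K]_N.+1.
Local Notation PV := {mpoly K[N.+1]}.

(* The vector field z |-> z_l (z^T e_i + e_i^T z), whose entries are linear in x = z^T z. *)
Definition veronese_field (l i : 'I_4) (c : 'I_10) : PV :=
  ((pair_of c).2 == i)%:R *: tnth (lin_subst B) (index_of l (pair_of c).1) +
  ((pair_of c).1 == i)%:R *: tnth (lin_subst B) (index_of l (pair_of c).2).

Definition field_value (G : 'I_10 -> PV) (y : V) : 'rV[K]_10 := \row_c (G c).@[y ord0].

Definition field_dq (G : 'I_10 -> PV) : PV :=
  \sum_c (q^`M(c) \mPo lin_subst B) * G c.

Definition field_pull (G : 'I_10 -> PV) (j : 'I_N.+1) : PV :=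
  \sum_c pinvmx B c j *: G c.

Lemma lin_subst_homog c : tnth (lin_subst B) c \is 1.-homog.
Proof.
rewrite tnth_mktuple; apply: rpred_sum => i _; apply: rpredZ.
by rewrite dhomogX; apply/eqP/mdeg1.
Qed.

Lemma veronese_field_homog l i c : veronese_field l i c \is 1.-homog.
Proof. by apply: rpredD; apply: rpredZ; apply: lin_subst_homog. Qed.

Lemma field_dq_homog d G : (forall c, G c \is d.-homog) -> field_dq G \is d.+1.-homog.
Proof.
move=> hG; apply: rpred_sum => c _; apply: (dhomogM _ (hG c) (d := 1)).
by have := comp_homog lin_subst_homog (deriv_homog c hq); rewrite muln1.
Qed.

Lemma field_pull_homog d G j : (forall c, G c \is d.-homog) -> field_pull G j \is d.-homog.
Proof. by move=> hG; apply: rpred_sum => c _; apply: rpredZ; apply: hG. Qed.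

Lemma meval_veronese_field l i z (y : V) : y *m B = veronese2 z ->
  field_value (veronese_field l i) y = z ord0 l *: dver z (delta_mx ord0 i).
Proof.
move=> yz.
have E a : (tnth (lin_subst B) a).@[y ord0] = veronese2 z ord0 a.
  rewrite -yz tnth_mktuple meval_sum mxE; apply: eq_bigr => b _.
  by rewrite mevalZ mevalXU mulrC.
have S a b : veronese2 z ord0 (index_of a b) = z ord0 a * z ord0 b.
  by rewrite -(symm_veronese z a b).
apply/rowP => c; rewrite [LHS]mxE [RHS]mxE [dver _ _ _ _]mxE /veronese_field.
case: (pair_of c) => a b /=.
have {S E} E a' b' : (tnth (lin_subst B) (index_of a' b')).@[y ord0] = z ord0 a' * z ord0 b'.
  by rewrite E S.
have := E l a; have := E l b; move: (tnth _ (index_of l a)) (tnth _ (index_of l b)) => p p' e e'.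
by rewrite mevalD !mevalZ e e' !mxE !eqxx /=; ring.
Qed.

Lemma meval_field_dq G (y : V) : (field_dq G).@[y ord0] = dd q (y *m B) (field_value G y).
Proof.
rewrite meval_sum; apply: eq_bigr => c _.
by rewrite mevalM meval_lin_subst [in RHS]mxE.
Qed.

Lemma meval_field_pull G (y : V) :
  \row_j (field_pull G j).@[y ord0] = field_value G y *m pinvmx B.
Proof.
apply/rowP => j; rewrite [LHS]mxE [RHS]mxE meval_sum; apply: eq_bigr => c _.
by rewrite mevalZ [field_value _ _ _ _]mxE mulrC.
Qed.

End Fields.

Lemma sym_tangent_of_dver z a w : sym_tangent z (symm (a *: dver z w)).
Proof.
rewrite symmZ; apply: sym_tangentZ; rewrite symm_dver; split=> [i j|i k l] /=; ring.
Qed.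

Section HypersurfaceSection.
Variable q : {mpoly K[10]}.
Hypothesis hq : q \is 2.-homog.
Let F := q \mPo vpoly K.
Let S := hypersurface_section Y q.

Lemma quartic_homog : F \is 4.-homog.
Proof. exact: (comp_homog (@vpoly_homog K) hq). Qed.

Let hpF : homog_pos F. Proof. by exists 4%N => //; apply: quartic_homog. Qed.

Lemma surface_coneE x : on_cone S x <-> exists2 z, on_zeros (gen_ideal [:: F]) z & x = veronese2 z.
Proof.
rewrite (hypersurface_cone _ _ (veronese_is_ideal K)) on_cone_veronese.
split=> [[[z z0 ->] qz]|[z /on_zeros_gen [z0 h] ->]].
  exists z => //; apply/on_zeros_gen; split=> // f; rewrite inE => /eqP ->.
  by rewrite meval_vpoly.
by split; [exists z | rewrite -meval_vpoly h // inE].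
Qed.

Lemma surface_tangentE z v : on_zeros (gen_ideal [:: F]) z ->
  cone_tangent S (veronese2 z) v <-> sym_tangent z (symm v) /\ dd q (veronese2 z) v = 0.
Proof.
move=> /on_zeros_gen [z0 h]; rewrite -(cone_tangent_veronese unc v z0).
apply: hypersurface_tangent; first exact: veronese_is_ideal.
  by apply/on_cone_veronese; exists z.
by rewrite -meval_vpoly h // inE.
Qed.

(** If dF vanished at z, the four-dimensional space of all z^T w + w^T z would be tangent to the
    cone over S, where dimension 3 is the maximum. *)
Lemma surface_gradient z : smooth_of_dim S 2 -> z != 0 -> F.@[z ord0] = 0 ->
  exists w, dd F z w != 0.
Proof.
move=> sm z0 Fz; apply: contrapT => /forallNP h.
have hz : on_zeros (gen_ideal [:: F]) z.
  by apply/on_zeros_gen; split=> // f; rewrite inE => /eqP ->.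
have hx : on_cone S (veronese2 z) by apply/surface_coneE; exists z.
have := smooth_rank sm hx (row_free_dver_mx z0); rewrite ltnNge => /(_ _)/negP [] // i.
rewrite rowE mul_dver_mx; apply/(surface_tangentE _ hz); split.
  by rewrite -[dver _ _]scale1r; apply: sym_tangent_of_dver.
by apply/eqP/negPn/negP; rewrite -dd_vpoly; apply: h.
Qed.

End HypersurfaceSection.

End Geometry.

Section SmoothSections.
Variable K : numClosedFieldType.
Hypothesis unc : uncountable K.
Local Notation P := {mpoly K[4]}.
Local Notation Y := (veronese2_ideal K).
Implicit Types (z w : 'rV[K]_4) (m : 'rV[K]_10).

Variable q : {mpoly K[10]}.
Hypothesis hq : q \is 2.-homog.
Let F := q \mPo vpoly K.
Let S := hypersurface_section Y q.
Let hF : F \is 4.-homog. Proof. exact: quartic_homog. Qed.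
Let hpF : homog_pos F. Proof. by exists 4%N. Qed.
Let hg (s : seq P) : is_ideal (gen_ideal s). Proof. exact: gen_ideal_ideal. Qed.

(** * The quadric section *)

Section Surface.
Hypothesis sm : smooth_of_dim S 2.
Let J : P -> Prop := gen_ideal [:: F].
Let B : 'M[K]_(9.+1, 10) := 1%:M.

Let hpJ f : f \in [:: F] -> homog_pos f. Proof. by rewrite inE => /eqP ->. Qed.

Lemma quartic_neq0 : F != 0.
Proof.
apply/negP => /eqP F0.
have z0 : delta_mx ord0 ord0 != 0 :> 'rV[K]_4.
  by apply/eqP => /rowP /(_ ord0) /eqP; rewrite !mxE !eqxx oner_eq0.
have [|w] := surface_gradient unc sm z0; first by rewrite -/F F0 meval0.
by rewrite -/F F0 -mpolyC0 ddC eqxx.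
Qed.

Let yposK z : on_zeros J z -> ypos B z *m B = veronese2 z.
Proof. by move=> _; apply: pinv1K. Qed.

Let coneE (y : 'rV[K]_9.+1) : on_cone S y <-> exists2 z, on_zeros J z & y *m B = veronese2 z.
Proof. by rewrite surface_coneE mulmx1. Qed.

Let tanE z (y v : 'rV[K]_9.+1) : on_zeros J z -> y *m B = veronese2 z ->
  cone_tangent S y v <-> sym_tangent z (symm (v *m B)) /\ dd q (veronese2 z) (v *m B) = 0.
Proof. by rewrite !mulmx1 => hz ->; apply: surface_tangentE. Qed.

(** A linear form vanishing on S pulls back to a quadric in (F), which is 0 as F has degree 4. *)
Let vanish_span (c : 'cV_10) : (forall z, on_zeros J z -> veronese2 z *m c = 0) -> B *m c = 0.
Proof.
move=> h; rewrite mul1mx.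
have [u [v good]] := good_surface unc hF quartic_neq0 (fun z nz Fz => surface_gradient unc sm nz Fz).
have h2 : lin_form c \mPo vpoly K \is 2.-homog.
  exact: (comp_homog (@vpoly_homog K) (lin_form_homog c)).
have Jf : J (lin_form c \mPo vpoly K).
  by apply: (good_radical good) => z hz; rewrite meval_vpoly lin_form_eq0 // h.
have [|f0|[]] // := add_gen_hc (hg [::]) hF _ h2 Jf; first exact: gen_ideal_graded.
apply: (veronese_span unc) => z; apply: mulmx_rc_eq0.
by rewrite -meval_lin_form -meval_vpoly f0 meval0.
Qed.

(** Along z_l (z^T e_i + e_i^T z) the derivative of q is z_l times the i-th partial derivative of F;
    suitable l and i make it nonzero at the given point. *)
Let transversal (x : 'rV[K]_9.+1) : on_cone S x ->
  exists d (tau : 'I_10 -> {mpoly K[10]}) (delta : {mpoly K[10]}),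
  [/\ forall j, tau j \is d.-homog, delta \is d.+1.-homog, delta.@[x ord0] != 0
    & forall z (y : 'rV[K]_9.+1), on_zeros J z -> y *m B = veronese2 z ->
      sym_tangent z (symm ((\row_j (tau j).@[y ord0]) *m B)) /\
      dd q (veronese2 z) ((\row_j (tau j).@[y ord0]) *m B) = delta.@[y ord0]].
Proof.
move=> /coneE [z hz xz]; have /on_zeros_gen [z0 hFz] := hz.
have [|w dw] := surface_gradient unc sm z0; first by rewrite hFz // inE.
have [i di] : exists i, dd F z (delta_mx ord0 i) != 0.
  apply: contrapT => /forallNP h; case/eqP: dw.
  rewrite (row_sum_delta w) -/F (big_morph _ (ddDr F z) (dd0r F z)) big1 // => i _.
  by rewrite ddZr; have /negP/negPn/eqP -> := h i; rewrite mulr0.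
have /rV0Pn[l zl] := z0.
exists 1%N, (veronese_field B l i), (field_dq B q (veronese_field B l i)).
have val (y : 'rV[K]_10) : \row_j (veronese_field B l i j).@[y ord0] = field_value (veronese_field B l i) y by [].
split.
- by move=> j; apply: veronese_field_homog.
- by apply: field_dq_homog => // c; apply: veronese_field_homog.
- by rewrite meval_field_dq (meval_veronese_field _ _ xz) xz ddZr -dd_vpoly mulf_neq0.
move=> z' y hz' yz'; rewrite val mulmx1 meval_field_dq yz' (meval_veronese_field _ _ yz').
by split=> //; apply: sym_tangent_of_dver.
Qed.

Let constant (x : 'rV[K]_9.+1) m : on_cone S x ->
  exists d (rho : 'I_10 -> {mpoly K[10]}) (g : {mpoly K[10]}),
  [/\ forall j, rho j \is d.-homog, g \is d.-homog, g.@[x ord0] != 0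
    & forall z (y : 'rV[K]_9.+1), on_zeros J z -> y *m B = veronese2 z ->
      sym_tangent z (symm ((\row_j (rho j).@[y ord0]) *m B - g.@[y ord0] *: m)) /\
      dd q (veronese2 z) ((\row_j (rho j).@[y ord0]) *m B - g.@[y ord0] *: m) = 0].
Proof.
move=> _; exists 0%N, (fun j => (m ord0 j)%:MP), 1; split.
- by move=> j; rewrite -alg_mpolyC; apply: rpredZ; apply: dhomog1.
- exact: dhomog1.
- by rewrite meval1 oner_neq0.
move=> z y _ _; rewrite meval1 scale1r mulmx1 (_ : _ - _ = 0).
  by rewrite dd0r; split=> //; apply: sym_tangent_symm0.
by apply/rowP => j; rewrite !mxE mevalC subrr.
Qed.

Theorem h0_surface : [/\ h0_normal S 1 (10 + 10), h0_normal S 2 1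
  & forall k, (3 <= k)%N -> h0_normal S k 0].
Proof.
have [u [v good]] := good_surface unc hF quartic_neq0 (fun z nz Fz => surface_gradient unc sm nz Fz).
have J1 : ~ J 1 := gen_ideal_proper hpJ.
split.
- exact: (h0_normal_twist1 unc good J1 hq (row_free1 _ _) yposK coneE tanE vanish_span transversal constant).
- exact: (h0_normal_twist2 unc good J1 hq (row_free1 _ _) yposK coneE tanE transversal).
- move=> k; exact: (h0_normal_twist_ge3 unc good J1 hq (row_free1 _ _) yposK coneE tanE).
Qed.

End Surface.

Lemma hyperplane_equation (A : 'M[K]_(9, 10)) : row_free A ->
  exists2 c : 'cV[K]_10, c != 0 & A *m c = 0 /\ forall v : 'rV_10, v *m c = 0 -> v *m pinvmx A *m A = v.
Proof.
move=> fA.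
have kA : kermx A^T != 0.
  by rewrite -mxrank_eq0 mxrank_ker mxrank_tr (eqP fA).
have c0 := nz_row_eq0 (kermx A^T); set r := nz_row _ in c0.
have r0 : r != 0 by rewrite c0.
have Ar : A *m r^T = 0.
  have /sub_kermxP : (r <= kermx A^T)%MS by apply: nz_row_sub.
  by move/(congr1 trmx); rewrite trmx_mul trmxK trmx0.
exists r^T; first by rewrite -trmx0 (inj_eq trmx_inj).
split=> // v vr; apply: mulmxKpV.
have vk : (v <= kermx r^T)%MS by apply/sub_kermxP.
have Ak : (A <= kermx r^T)%MS by apply/sub_kermxP.
apply: submx_trans vk _; rewrite -(mxrank_leqif_sup Ak).
by rewrite mxrank_ker mxrank_tr rank_rV r0 (eqP fA).
Qed.

(** * The hyperplane section *)

Section Curve.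
Variable A : 'M[K]_(8.+1, 10).
Hypothesis fA : row_free A.
Let C := linear_section S A.
Hypothesis sm : smooth_of_dim C 1.
Variable ell : 'cV[K]_10.
Hypotheses (ell0 : ell != 0) (Aell : A *m ell = 0).
Hypothesis spanA : forall v : 'rV_10, v *m ell = 0 -> v *m pinvmx A *m A = v.

Let Q : P := lin_form ell \mPo vpoly K.
Let J : P -> Prop := gen_ideal [:: F; Q].

Lemma quadric_homog : Q \is 2.-homog.
Proof. exact: (comp_homog (@vpoly_homog K) (lin_form_homog ell)). Qed.

Let hpQ : homog_pos Q. Proof. by exists 2%N => //; apply: quadric_homog. Qed.
Let hpJ f : f \in [:: F; Q] -> homog_pos f.
Proof. by rewrite !inE => /orP[] /eqP ->. Qed.

Lemma quadric_neq0 : Q != 0.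
Proof.
apply: contra ell0 => /eqP Q0; apply/eqP/(veronese_span unc) => z.
by apply: mulmx_rc_eq0; rewrite -meval_lin_form -meval_vpoly -/Q Q0 meval0.
Qed.

Lemma meval_quadric z : Q.@[z ord0] = (veronese2 z *m ell) ord0 ord0.
Proof. by rewrite meval_vpoly meval_lin_form. Qed.

Lemma curve_zeros z : on_zeros J z <-> [/\ z != 0, F.@[z ord0] = 0 & Q.@[z ord0] = 0].
Proof.
rewrite on_zeros_gen; split=> [[z0 h]|[z0 Fz Qz]].
  by split=> //; apply: h; rewrite !inE eqxx ?orbT.
by split=> // f; rewrite !inE => /orP[] /eqP ->.
Qed.

Let yposK z : on_zeros J z -> ypos A z *m A = veronese2 z.
Proof.
move=> /curve_zeros [z0 Fz Qz]; apply: spanA; apply: mulmx_rc_eq0.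
by rewrite -meval_quadric.
Qed.

Lemma surface_zeros z : on_zeros J z -> on_zeros (gen_ideal [:: F]) z.
Proof. by move=> /curve_zeros [z0 Fz _]; apply/on_zeros_gen; split=> // f; rewrite inE => /eqP ->. Qed.

Let coneE y : on_cone C y <-> exists2 z, on_zeros J z & y *m A = veronese2 z.
Proof.
rewrite (linear_cone _ _ fA) (surface_coneE q); split=> [[z /on_zeros_gen [z0 h] yz]|[z hz yz]].
  exists z => //; apply/curve_zeros; split=> //; first by rewrite h // inE.
  by rewrite meval_quadric -yz -mulmxA Aell mulmx0 mxE.
by exists z => //; apply: surface_zeros.
Qed.

Let tanE z (y v : 'rV[K]_8.+1) : on_zeros J z -> y *m A = veronese2 z ->
  cone_tangent C y v <-> sym_tangent z (symm (v *m A)) /\ dd q (veronese2 z) (v *m A) = 0.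
Proof.
by move=> hz yz; rewrite linear_tangent yz; apply: surface_tangentE => //; apply: surface_zeros.
Qed.

Lemma common_kernel (f g : P) z : exists r (R : 'M[K]_(r, 4)), [/\ row_free R,
    r = (4 - \rank (col_mx (grad f z) (grad g z)))%N
    & forall i, dd f z (row i R) = 0 /\ dd g z (row i R) = 0].
Proof.
set G := col_mx _ _; exists (\rank (kermx G^T)), (row_base (kermx G^T)); split.
- exact: row_base_free.
- by rewrite mxrank_ker mxrank_tr.
move=> i; have : row i (row_base (kermx G^T)) *m G^T = 0.
  by apply/sub_kermxP; apply: submx_trans (row_sub _ _) _; rewrite eq_row_base.
move: (row i _) => w; rewrite /G tr_col_mx mul_mx_row -[0]row_mx0 => /eq_row_mx [e1 e2].
by rewrite !dd_grad e1 e2; split; rewrite [LHS]mxE.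
Qed.

Lemma gradient_minor (f g : P) z : row_free (col_mx (grad g z) (grad f z)) -> exists i j,
  dd f z (delta_mx ord0 i) * dd g z (delta_mx ord0 j) -
  dd f z (delta_mx ord0 j) * dd g z (delta_mx ord0 i) != 0.
Proof.
move=> fr.
have gE h i : dd h z (delta_mx ord0 i) = grad h z ord0 i.
  by rewrite dd_grad -rowE [LHS]mxE [LHS]mxE.
under eq_exists do under eq_exists do rewrite !gE.
move: (grad f z) (grad g z) fr => a b fr.
have ker (s t : K) : (forall j, s * b ord0 j + t * a ord0 j = 0) -> s = 0 /\ t = 0.
  move=> h; have : row_mx s%:M t%:M *m col_mx b a = 0.
    rewrite mul_row_col !mul_scalar_mx; apply/rowP => j.
    by rewrite [LHS]mxE [X in X + _]mxE [X in _ + X]mxE h [RHS]mxE.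
  move=> e; have : row_mx s%:M t%:M = 0 :> 'rV[K]_(1 + 1).
    by apply: (row_free_inj fr); rewrite e mul0mx.
  rewrite -row_mx0 => /eq_row_mx [/matrixP /(_ ord0 ord0) e1 /matrixP /(_ ord0 ord0) e2].
  by move: e1 e2; rewrite !mxE eqxx !mulr1n.
apply: contrapT => /forallNP h.
have h' i j : a ord0 i * b ord0 j - b ord0 i * a ord0 j = 0.
  have /forallNP /(_ j) /negP/negPn/eqP := h i => <-.
  by rewrite [b _ i * _]mulrC.
have g0 i : b ord0 i = 0.
  have [|_] := ker (a ord0 i) (- b ord0 i).
    by move=> j; rewrite mulNr h'.
  by move/eqP; rewrite oppr_eq0 => /eqP.
have [|/eqP] := ker 1 0; first by move=> j; rewrite g0 mulr0 mul0r addr0.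
by rewrite oner_eq0.
Qed.

(** Directions killed by both gradients inject into the tangent space of the cone over C, of
    dimension at most 2, so the gradients have rank at least 2. *)
Lemma curve_jacobian z : z != 0 -> Q.@[z ord0] = 0 -> F.@[z ord0] = 0 ->
  row_free (col_mx (grad Q z) (grad F z)).
Proof.
move=> z0 Qz Fz; have hz : on_zeros J z by apply/curve_zeros.
have yz := yposK hz; set y := ypos A z in yz.
have hy : on_cone C y by apply/coneE; exists z.
have [r [R [fR rE tang]]] : exists r (R : 'M[K]_(r, 4)), [/\ row_free R,
    r = (4 - \rank (col_mx (grad Q z) (grad F z)))%N
    & forall i, dd Q z (row i R) = 0 /\ dd F z (row i R) = 0].
  exact: common_kernel.
have inH w : dd Q z w = 0 -> dver z w *m pinvmx A *m A = dver z w.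
  by rewrite dd_vpoly dd_lin_form => h; apply: spanA; apply: mulmx_rc_eq0.
pose M := R *m dver_mx z *m pinvmx A.
have MA : M *m A = R *m dver_mx z.
  apply/row_matrixP => i; rewrite /M !row_mul mul_dver_mx; apply: inH.
  exact: (proj1 (tang i)).
have fM : row_free M.
  apply: row_free_ker => v vM.
  have : v *m R *m dver_mx z = 0 by rewrite -mulmxA -MA mulmxA vM mul0mx.
  rewrite mul_dver_mx => /(dver_eq0 z0) vR.
  by apply: (row_free_inj fR); rewrite vR mul0mx.
have tM i : cone_tangent C y (row i M).
  apply/(tanE _ hz yz); rewrite -row_mul MA row_mul mul_dver_mx; have [_ dF] := tang i.
  by rewrite -dd_vpoly dF -[dver _ _]scale1r; split=> //; apply: sym_tangent_of_dver.
have := smooth_rank sm hy fM tM.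
rewrite rE => h; rewrite /row_free eqn_leq rank_leq_row /=.
by move: h; move: (\rank _) => k; lia.
Qed.

Lemma good_J : exists u v, good_ideal J u v.
Proof. exact: (good_curve unc quadric_homog hF quadric_neq0 curve_jacobian). Qed.

(** In degree 2 the ideal (F, Q) contains only multiples of Q, so a linear form vanishing on C is a
    multiple of [ell]. *)
Let vanish_span (c : 'cV_10) : (forall z, on_zeros J z -> veronese2 z *m c = 0) -> A *m c = 0.
Proof.
move=> h; have [u [v good]] := good_J.
have h2 : lin_form c \mPo vpoly K \is 2.-homog.
  exact: (comp_homog (@vpoly_homog K) (lin_form_homog c)).
have Jf : J (lin_form c \mPo vpoly K).
  by apply: (good_radical good) => z hz; rewrite meval_vpoly lin_form_eq0 // h.
have gQ : graded (gen_ideal [:: Q]).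
  by apply: gen_ideal_graded => f; rewrite inE => /eqP ->.
have graded_zero : graded (gen_ideal ([::] : seq P)) by apply: gen_ideal_graded.
have [f0|[]] // := add_gen_hc (hg [:: Q]) hF gQ h2 Jf.
have [f1|[_ [a ha e]]] := add_gen_hc (hg [::]) quadric_homog graded_zero h2 f0.
  rewrite (_ : c = 0) ?mulmx0 //; apply: (veronese_span unc) => z; apply: mulmx_rc_eq0.
  by rewrite -meval_lin_form -meval_vpoly f1 meval0.
rewrite (_ : c = (a@_0%MM) *: ell); first by rewrite -scalemxAr Aell scaler0.
apply/eqP; rewrite -subr_eq0; apply/eqP/(veronese_span unc) => z; apply: mulmx_rc_eq0.
rewrite mulmxBr -scalemxAr [LHS]mxE [X in _ + X]mxE [X in _ - X]mxE.
rewrite -meval_lin_form -meval_vpoly -meval_quadric.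
have -> : a@_0%MM = a.@[z ord0] by rewrite [in RHS](homog0_const ha) mevalC.
by rewrite -mevalM -mevalB e meval0.
Qed.

Definition hyperplane_value (G : 'I_10 -> {mpoly K[9]}) : {mpoly K[9]} := \sum_c ell c ord0 *: G c.

Lemma hyperplane_value_homog d G : (forall c, G c \is d.-homog) -> hyperplane_value G \is d.-homog.
Proof. by move=> hG; apply: rpred_sum => c _; apply: rpredZ; apply: hG. Qed.

Lemma meval_hyperplane_value G (y : 'rV[K]_9) :
  (hyperplane_value G).@[y ord0] = (field_value G y *m ell) ord0 ord0.
Proof.
rewrite meval_sum mxE; apply: eq_bigr => c _.
by rewrite mevalZ [field_value _ _ _ _]mxE mulrC.
Qed.

Lemma field_valueB (a b : {mpoly K[9]}) (G H : 'I_10 -> {mpoly K[9]}) (y : 'rV[K]_9) :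
  field_value (fun c => a * G c - b * H c) y =
  a.@[y ord0] *: field_value G y - b.@[y ord0] *: field_value H y.
Proof. by apply/rowP => c; rewrite !mxE mevalB !mevalM. Qed.

Lemma jacobian_minor z : on_zeros J z -> exists i j,
  dd F z (delta_mx ord0 i) * dd Q z (delta_mx ord0 j) -
  dd F z (delta_mx ord0 j) * dd Q z (delta_mx ord0 i) != 0.
Proof.
move=> /curve_zeros [z0 Fz Qz]; apply: gradient_minor; exact: curve_jacobian.
Qed.

Let spanned (G : 'I_10 -> {mpoly K[9]}) (y : 'rV[K]_9) : field_value G y *m ell = 0 ->
  (\row_j (field_pull A G j).@[y ord0]) *m A = field_value G y.
Proof. by move=> h; rewrite meval_field_pull; apply: spanA. Qed.

Section Fields.
Variables l i j : 'I_4.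
Let T a := veronese_field A l a.
Let lam a := hyperplane_value (T a).
Let del a := field_dq A q (T a).
Let hT a c : T a c \is 1.-homog. Proof. exact: veronese_field_homog. Qed.
Let hlam a : lam a \is 1.-homog. Proof. exact: hyperplane_value_homog. Qed.
Let hdel a : del a \is 2.-homog. Proof. exact: field_dq_homog. Qed.
(** [lam a] and [del a] are the derivatives of [ell] and q along [T a]; up to z_l^2 this is a 2 by 2
    minor of the Jacobian of F and Q. *)
Definition field_minor := del i * lam j - del j * lam i.
Let G c := lam j * T i c - lam i * T j c.

Let lamE a z (y : 'rV[K]_9) : y *m A = veronese2 z ->
  (lam a).@[y ord0] = z ord0 l * dd Q z (delta_mx ord0 a).
Proof.
move=> yz; rewrite meval_hyperplane_value (meval_veronese_field _ _ yz) -scalemxAl mxE.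
by rewrite dd_vpoly dd_lin_form.
Qed.

Let delE a z (y : 'rV[K]_9) : y *m A = veronese2 z ->
  (del a).@[y ord0] = z ord0 l * dd F z (delta_mx ord0 a).
Proof. by move=> yz; rewrite meval_field_dq (meval_veronese_field _ _ yz) yz ddZr -dd_vpoly. Qed.

Lemma field_minorE z (y : 'rV[K]_9) : y *m A = veronese2 z -> field_minor.@[y ord0] = z ord0 l ^+ 2 *
  (dd F z (delta_mx ord0 i) * dd Q z (delta_mx ord0 j) -
   dd F z (delta_mx ord0 j) * dd Q z (delta_mx ord0 i)).
Proof.
move=> yz; rewrite mevalB !mevalM !(lamE _ yz) !(delE _ yz).
by move: (dd F z _) (dd F z _) (dd Q z _) (dd Q z _) => a b c d; ring.
Qed.

Let hfield_minor : field_minor \is 3.-homog.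
Proof. by apply: rpredB; apply: (dhomogM (d := 2) (e := 1)). Qed.

Let tangent_comb (a b : K) z (y : 'rV[K]_9) : y *m A = veronese2 z ->
  sym_tangent z (symm (a *: field_value (T i) y - b *: field_value (T j) y)).
Proof.
move=> yz; rewrite !(meval_veronese_field _ _ yz) -!mul_dver_mx !scalemxAl -mulmxBl mul_dver_mx.
by rewrite -[dver _ _]scale1r; apply: sym_tangent_of_dver.
Qed.

(** In [lam j * T i - lam i * T j] the values of [ell] cancel, so the field lies in the hyperplane,
    and its q-derivative is the minor. *)
Lemma curve_transversal :
  exists tau : 'I_9 -> {mpoly K[9]}, [/\ forall c, tau c \is 2.-homog, field_minor \is 3.-homog
    & forall z (y : 'rV[K]_9), y *m A = veronese2 z ->
      sym_tangent z (symm ((\row_c (tau c).@[y ord0]) *m A)) /\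
      dd q (veronese2 z) ((\row_c (tau c).@[y ord0]) *m A) = field_minor.@[y ord0]].
Proof.
exists (field_pull A G); split=> // [c|z y yz].
  by apply: field_pull_homog => a; apply: rpredB; apply: (dhomogM (d := 1) (e := 1)).
have fv := field_valueB (lam j) (lam i) (T i) (T j) y.
rewrite spanned; last first.
  rewrite fv mulmxBl -!scalemxAl; apply/matrixP => a b; rewrite !ord1 [RHS]mxE.
  rewrite [LHS]mxE [X in X + _]mxE [X in _ + X]mxE [X in _ - X]mxE -!meval_hyperplane_value.
  by rewrite mulrC subrr.
rewrite fv; split; first exact: tangent_comb.
by rewrite ddBr !ddZr -yz -!meval_field_dq mevalB !mevalM; ring.
Qed.

Variable m : 'rV[K]_10.
Let mu := (m *m ell) ord0 ord0.
Let H c := m ord0 c *: field_minor + mu *: (del j * T i c - del i * T j c).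

(** A constant m need not lie in the hyperplane. Scaled by the minor, it is moved there by a tangent
    combination of [T i] and [T j], whose coefficients [del j] and [- del i] leave the derivative of
    q unchanged. *)
Lemma curve_constant :
  exists rho : 'I_9 -> {mpoly K[9]}, [/\ forall c, rho c \is 3.-homog, field_minor \is 3.-homog
    & forall z (y : 'rV[K]_9), y *m A = veronese2 z ->
      sym_tangent z (symm ((\row_c (rho c).@[y ord0]) *m A - field_minor.@[y ord0] *: m)) /\
      dd q (veronese2 z) ((\row_c (rho c).@[y ord0]) *m A - field_minor.@[y ord0] *: m) = 0].
Proof.
exists (field_pull A H); split=> // [c|z y yz].
  apply: field_pull_homog => a; apply: rpredD; apply: rpredZ => //.
  by apply: rpredB; apply: (dhomogM (d := 2) (e := 1)).
have fv : field_value H y = field_minor.@[y ord0] *: m + mu *: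
    ((del j).@[y ord0] *: field_value (T i) y - (del i).@[y ord0] *: field_value (T j) y).
  rewrite -field_valueB; apply/rowP => c; rewrite [LHS]mxE [RHS]mxE [X in _ = X + _]mxE.
  by rewrite [X in _ = _ + X]mxE [field_value _ _ _ _]mxE mevalD !mevalZ [m _ _ * _]mulrC.
rewrite spanned; last first.
  rewrite fv mulmxDl -!scalemxAl mulmxBl -!scalemxAl; apply/matrixP => a b; rewrite !ord1 [RHS]mxE.
  rewrite [LHS]mxE [X in X + _]mxE [X in _ + X]mxE [X in _ + _ * X]mxE.
  rewrite [X in _ + _ * (X + _)]mxE [X in _ + _ * (_ + X)]mxE [X in _ + _ * (_ - X)]mxE.
  rewrite -!meval_hyperplane_value -/mu mevalB !mevalM.
  move: (meval _ (del _)) (meval _ (del _)) (meval _ (hyperplane_value _))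
    (meval _ (hyperplane_value _)) => a1 a2 a3 a4; ring.
rewrite fv addrC addKr; split.
  by rewrite symmZ; apply: sym_tangentZ; apply: tangent_comb.
rewrite ddZr ddBr !ddZr -yz -!meval_field_dq -/(del i) -/(del j); ring.
Qed.

End Fields.

Let transversal (x : 'rV[K]_8.+1) : on_cone C x ->
  exists d (tau : 'I_9 -> {mpoly K[9]}) (delta : {mpoly K[9]}),
  [/\ forall j, tau j \is d.-homog, delta \is d.+1.-homog, delta.@[x ord0] != 0
    & forall z (y : 'rV[K]_8.+1), on_zeros J z -> y *m A = veronese2 z ->
      sym_tangent z (symm ((\row_j (tau j).@[y ord0]) *m A)) /\
      dd q (veronese2 z) ((\row_j (tau j).@[y ord0]) *m A) = delta.@[y ord0]].
Proof.
move=> /coneE [z hz xz]; have [i [j ij]] := jacobian_minor hz.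
have /curve_zeros [/rV0Pn[l zl] _ _] := hz.
have [tau [h1 h2 h3]] := curve_transversal l i j.
exists 2%N, tau, (field_minor l i j); split; [exact: h1 | exact: h2 | | by move=> z' y _; apply: h3].
by rewrite (field_minorE _ _ _ xz) mulf_neq0 // expf_neq0.
Qed.

Let constant (x : 'rV[K]_8.+1) m : on_cone C x ->
  exists d (rho : 'I_9 -> {mpoly K[9]}) (g : {mpoly K[9]}),
  [/\ forall j, rho j \is d.-homog, g \is d.-homog, g.@[x ord0] != 0
    & forall z (y : 'rV[K]_8.+1), on_zeros J z -> y *m A = veronese2 z ->
      sym_tangent z (symm ((\row_j (rho j).@[y ord0]) *m A - g.@[y ord0] *: m)) /\
      dd q (veronese2 z) ((\row_j (rho j).@[y ord0]) *m A - g.@[y ord0] *: m) = 0].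
Proof.
move=> /coneE [z hz xz]; have [i [j ij]] := jacobian_minor hz.
have /curve_zeros [/rV0Pn[l zl] _ _] := hz.
have [rho [h1 h2 h3]] := curve_constant l i j m.
exists 3%N, rho, (field_minor l i j); split; [exact: h1 | exact: h2 | | by move=> z' y _; apply: h3].
by rewrite (field_minorE _ _ _ xz) mulf_neq0 // expf_neq0.
Qed.

Theorem h0_curve : [/\ h0_normal C 1 (10 + 9), h0_normal C 2 1
  & forall k, (3 <= k)%N -> h0_normal C k 0].
Proof.
have [u [v good]] := good_J; have J1 : ~ J 1 := gen_ideal_proper hpJ.
split.
- apply: (h0_normal_twist1 unc good J1 hq fA yposK coneE tanE vanish_span transversal constant).
- exact: (h0_normal_twist2 unc good J1 hq fA yposK coneE tanE transversal).
- by move=> k; apply: (h0_normal_twist_ge3 unc good J1 hq fA yposK coneE tanE).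
Qed.

End Curve.
End SmoothSections.

Theorem mainTheorem6 (R : realType) :
  let Y := veronese2_ideal R[i] in
  (h0_normal Y 1 10 /\ forall k : nat, (2 <= k)%N -> h0_normal Y k 0) /\
  forall q : {mpoly R[i][10]},
    q != 0 -> q \is 2.-homog ->
    let S := hypersurface_section Y q in
    smooth_of_dim S 2 ->
    [/\ h0_normal S 1 (10 + 10),
        h0_normal S 2 1
      & forall k : nat, (3 <= k)%N -> h0_normal S k 0] /\
    forall A : 'M[R[i]]_(9, 10),
      row_free A ->
      let C := linear_section S A in
      smooth_of_dim C 1 ->
      [/\ h0_normal C 1 (10 + 9),
          h0_normal C 2 1
        & forall k : nat, (3 <= k)%N -> h0_normal C k 0].
Proof.
have unc := @uncountable_complex R.
move=> Y; split.
  by split; [apply: h0_veronese1 | move=> k; apply: h0_veronese_ge2].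
move=> q _ hq S smS; split; first exact: h0_surface.
move=> A fA C smC; have [ell ell0 [Aell spanA]] := hyperplane_equation fA.
exact: (h0_curve unc hq fA smC ell0 Aell spanA).
Qed.
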